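(* Consider the one-bit-feedback opportunistic interference alignment scheme described in the context, for an integer $d\ge1$ and $N_R=2d$. Let $d'\in[0,d]$. Suppose the number of users per cell is scaled as $K\propto P^{dd'}$, that is, $K=K(P)$ is a positive integer with $K(P)/P^{dd'}\to\kappa\in(0,\infty)$ as $P\to\infty$. Suppose the threshold $\hat{x}\ge 0$ is chosen such that $$c_{2d,d}\,\hat{x}^{d^2}=\frac{1}{K}\Big(\frac{1}{d^2}\log K+B\Big),$$ where $B\in\mathbb{R}$ is a constant. Then each transmitter $i$ achieves DoF $d'$, that is, $$\liminf_{P\to\infty}\frac{\mathbb{E}[R_i^{k^\dagger}]}{\log_2P}\ge d'.$$
   Context: System model. Fix an integer $d\ge 1$ and set $N_R=2d$. There are three cells $i\in\{1,2,3\}$; transmitter $i$ serves $K$ users $k\in\{1,\dots,K\}$ in cell $i$. The effective channel from transmitter $j$ to user $k$ in cell $i$ is $\mathbf{H}_{i,j}^k\in\mathbb{C}^{N_R\times d}$. All entries of all these matrices are i.i.d. circularly symmetric complex Gaussian with zero mean and unit variance. Transmitter $j$ sends $\mathbf{s}_j\in\mathbb{C}^d$ with $\mathbb{E}[\mathbf{s}_j\mathbf{s}_j^H]=\frac{P}{d}\mathbf{I}_d$. The noise is $\mathcal{CN}(0,\mathbf{I}_{N_R})$, and the SNR equals $P$. For cell $i$, let $p=(i+1\bmod 3)$ and $q=(i+2\bmod3)$ index the two interfering transmitters. Metric. For matrices $\mathbf{A},\mathbf{B}\in\mathbb{C}^{N_R\times d}$ with orthonormal columns, $d_c(\mathbf{A},\mathbf{B})=\frac{1}{\sqrt2}\|\mathbf{A}\mathbf{A}^H-\mathbf{B}\mathbf{B}^H\|_F$.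 User $k$ in cell $i$ computes orthonormal bases $\mathbf{Q}_{ip}^k,\mathbf{Q}_{iq}^k$ of the column spaces of $\mathbf{H}_{i,p}^k$ and $\mathbf{H}_{i,q}^k$, and the metric $\mathcal{D}_i^k=d_c^2(\mathbf{Q}_{ip}^k,\mathbf{Q}_{iq}^k)$. One-bit scheme with threshold $x$. Each user reports 1 if $\mathcal{D}_i^k<x$ and 0 otherwise. Transmitter $i$ selects $k^\dagger$ uniformly at random among users reporting 1. If all users report 0, it selects $k^\dagger$ uniformly at random among all $K$ users. Receiver and rate. With $\mathbf{R}_i^k=\mathbf{H}_{i,p}^k{\mathbf{H}_{i,p}^k}^H+\mathbf{H}_{i,q}^k{\mathbf{H}_{i,q}^k}^H$, the postfilter $\mathbf{U}_i^k\in\mathbb{C}^{N_R\times d}$ consists of the singular vectors of $\mathbf{R}_i^k$ associated with its $d+1,\dots,N_R$-th largest singular values. The rate is $$R_i^k=\log_2\det\Big(\mathbf{I}_d+\tfrac{P}{d}{\mathbf{U}_i^k}^H\mathbf{H}_{i,i}^k{\mathbf{H}_{i,i}^k}^H\mathbf{U}_i^k\Big(\mathbf{I}_d+\tfrac{P}{d}\sum_{j\ne i}{\mathbf{U}_i^k}^H\mathbf{H}_{i,j}^k{\mathbf{H}_{i,j}^k}^H\mathbf{U}_i^k\Big)^{-1}\Big).$$ The DoF at transmitter $i$ is $\lim_{P\to\infty}\mathbb{E}[R_i^{k^\dagger}]/\log_2 P$. Constant. The constant is $$c_{N,d}=\frac{1}{\Gamma(d(N-d)+1)}\prod_{i=1}^{d}\frac{\Gamma(N-i+1)}{\Gamma(d-i+1)},$$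 and $\log$ is the natural logarithm. *)

(* Defs.v *)
From HB Require Import structures.
From mathcomp Require Import all_boot all_order all_algebra.
From mathcomp Require Import all_classical all_reals all_analysis.
From mathcomp Require Import complex.
Set Implicit Arguments. Unset Strict Implicit. Unset Printing Implicit Defensive.
Import Order.TTheory GRing.Theory Num.Theory.
Import numFieldNormedType.Exports.
Local Open Scope classical_set_scope.
Local Open Scope ring_scope.

Section Defs.
Variable R : realType.

Definition NR (d : nat) : nat := (2 * d)%N.

(* Index of a real scalar random variable: (user k, cell i, transmitter j,
   row r, column c, imaginary part?) ; the complex entry (r,c) of H_{i,j}^k
   is X(k,i,j,r,c,false) + i X(k,i,j,r,c,true). Users are indexed by nat:
   with K users per cell only users 0..K-1 are used. *)
Definition chan_idx (d : nat) : Type :=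
  (nat * 'I_3 * 'I_3 * 'I_(NR d) * 'I_d * bool)%type.

Definition mutually_independent {dT} {T : measurableType dT} (I : eqType)
  (Pr : probability T R) (X : I -> T -> R) : Prop :=
  (forall a, measurable_fun setT (X a)) /\
  forall (s : seq I) (B : I -> set R), uniq s ->
    (forall a, measurable (B a)) ->
    Pr (\bigcap_(a in [set a | a \in s]) (X a @^-1` B a)) =
    (\prod_(a <- s) fine (Pr (X a @^-1` B a)))%:E.

(* all entries i.i.d. CN(0,1): real and imaginary parts are independent
   N(0,1/2) real Gaussians *)
Definition iid_CN {dT} {T : measurableType dT} (d : nat)
  (Pr : probability T R) (X : chan_idx d -> T -> R) : Prop :=
  mutually_independent Pr X /\
  forall a (B : set R), measurable B ->
    Pr (X a @^-1` B) = normal_prob 0 (Num.sqrt (2^-1)) B.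

Definition chan {T : Type} (d : nat) (X : chan_idx d -> T -> R)
  (k : nat) (i j : 'I_3) (t : T) : 'M[R[i]]_(NR d, d) :=
  \matrix_(r, c) Complex (X (k, i, j, r, c, false) t) (X (k, i, j, r, c, true) t).

Definition ctr (m n : nat) (A : 'M[R[i]]_(m, n)) : 'M[R[i]]_(n, m) :=
  map_mx (@conjc R) A^T.

Definition frob (m n : nat) (A : 'M[R[i]]_(m, n)) : R :=
  Num.sqrt (\sum_r \sum_c ComplexField.Normc.normc (A r c) ^+ 2).

Definition chordal (m n : nat) (A B : 'M[R[i]]_(m, n)) : R :=
  (Num.sqrt 2)^-1 * frob (A *m ctr A - B *m ctr B).

Definition orth_basis (m n : nat) (A : 'M[R[i]]_(m, n)) : 'M[R[i]]_(m, n) :=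
  xget 0 [set Q : 'M[R[i]]_(m, n) |
           ctr Q *m Q = 1%:M /\ (Q^T == A^T)%MS].

(* postfilter: left singular vectors of Rm associated with its
   (d+1)-th, ..., N_R-th largest singular values, from an SVD
   Rm = W diag(s) V^H with s nonincreasing and nonnegative *)
Definition postfilter (d : nat) (Rm : 'M[R[i]]_(NR d)) : 'M[R[i]]_(NR d, d) :=
  xget 0 [set U : 'M[R[i]]_(NR d, d) |
    exists (W V : 'M[R[i]]_(NR d)) (s : 'rV[R]_(NR d)),
      [/\ ctr W *m W = 1%:M /\ ctr V *m V = 1%:M,
          (forall j, 0 <= s 0 j),
          (forall j j' : 'I_(NR d), (j <= j')%N -> s 0 j' <= s 0 j),
          Rm = W *m diag_mx (map_mx (real_complex R) s) *m ctr V &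
          (forall r c (j : 'I_(NR d)), val j = (d + val c)%N -> U r c = W r j)]].

Definition cellp (i : 'I_3) : 'I_3 := inord ((i + 1) %% 3).
Definition cellq (i : 'I_3) : 'I_3 := inord ((i + 2) %% 3).

Definition metricD {T : Type} (d : nat) (X : chan_idx d -> T -> R)
  (i : 'I_3) (k : nat) (t : T) : R :=
  chordal (orth_basis (chan X k i (cellp i) t))
          (orth_basis (chan X k i (cellq i) t)) ^+ 2.

Definition log2 (x : R) : R := ln x / ln 2.

Definition rate {T : Type} (d : nat) (X : chan_idx d -> T -> R)
  (P : R) (i : 'I_3) (k : nat) (t : T) : R :=
  let Hii := chan X k i i t in
  let Hip := chan X k i (cellp i) t in
  let Hiq := chan X k i (cellq i) t in
  let U := postfilter (Hip *m ctr Hip + Hiq *m ctr Hiq) in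
  let g := real_complex R (P / d%:R) in
  let S := ctr U *m Hii *m ctr Hii *m U in
  let Itf := ctr U *m Hip *m ctr Hip *m U + ctr U *m Hiq *m ctr Hiq *m U in
  log2 (complex.Re (\det (1%:M + g *: S *m invmx (1%:M + g *: Itf)))).

Definition candidates {T : Type} (d : nat) (X : chan_idx d -> T -> R)
  (K : nat) (x : R) (i : 'I_3) (t : T) : seq nat :=
  let S := [seq k <- iota 0 K | metricD X i k t < x] in
  if S is [::] then iota 0 K else S.

(* rate of the selected user k^dagger averaged over the uniform random
   choice of k^dagger (i.e. conditional expectation given the channels) *)
Definition sel_rate {T : Type} (d : nat) (X : chan_idx d -> T -> R)
  (P : R) (K : nat) (x : R) (i : 'I_3) (t : T) : R :=
  let S := candidates X K x i t in
  (\sum_(k <- S) rate X P i k t) / (size S)%:R.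

(* c_{N,d} with Gamma(n+1) = n! *)
Definition cNd (N d : nat) : R :=
  (((d * (N - d))`!)%:R)^-1 *
  \prod_(i < d) (((N - i.+1)`!)%:R / ((d - i.+1)`!)%:R).

End Defs.

(* Main.v *)
(* The rate is nonnegative, so the mean rate may be bounded from below on one
   good event.  If user k reports 1, both interfering column spaces are almost
   equal, and the min-max principle bounds the interference left after the
   postfilter by x |H_q|^2; this costs the factor (1 + g x M)^d, g = P/d, when
   all squared norms are at most M.  Fischer's inequality then gives

     2^rate >= g^(2d) |det [H_p H_ii]|^2 / ((1 + 3 g M) (1 + g x M))^d,

   in which the postfilter no longer occurs.  With M a small power of P and
   x^(d^2) of order (log K) / K this is d' log P up to lower order terms,
   provided that |det [H_p H_ii]| is not polynomially small.

   Two probability estimates for a single user suffice, since a union bound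
   over the K users loses only powers of log P.

   - P(D < x) >= c x^(d^2).  In graph coordinates W = B A^-1, where H = [A; B],
     D is at most a multiple of |W_p - W_q|^2.  As W_p and W_q are independent
     with the same law, they fall into the same cell of a grid with N cells with
     probability at least a constant over N, by Cauchy-Schwarz.

   - P(D < x and |det [H_p H_ii]| small) <= x^(d^2) M^(d^2) P(det small).  Let f
     be the rows of a maximal minor of H_p.  By Cramer's rule D < x confines the
     2 d^2 real coordinates of H_q outside f to intervals of length of order
     sqrt (x M) whose centres depend on the other coordinates only; revealing
     them one at a time costs a factor O(sqrt (x M)) each.

   Only lower bounds by measurable events occur, so the measurability of the
   selection and of the postfilter, which are defined by choice, is not needed. *)
Require Import Defs.
From HB Require Import structures.
From mathcomp Require Import all_boot all_order all_algebra.
From mathcomp Require Import all_classical all_reals all_analysis.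
From mathcomp Require Import measurable_realfun complex ring lra.
Set Implicit Arguments. Unset Strict Implicit. Unset Printing Implicit Defensive.
Import Order.TTheory GRing.Theory Num.Theory.
Import numFieldNormedType.Exports.
Local Open Scope classical_set_scope.
Local Open Scope ring_scope.

(** * Positive semidefinite matrices *)

Section PSD.
Local Open Scope sesquilinear_scope.
Variable C : numClosedFieldType.

(** The obstacle is that selection is biased: whether a user reports depends on H_p, which also
    enters det [H_p H_ii]. Bounding P(det small) alone and summing over the users costs the factor
    K, of order P^(d d'), so the determinant would only be known to exceed a power of P that the
    rate cannot afford to lose. Keeping D < x inside the estimate replaces K by K x^(d^2), which is
    of order log P; hence the joint estimate.

    The exponent d^2 is half the real dimension 2 d^2 of the manifold of d-dimensional subspaces of
    C^(2d), because D is a squared distance.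

    Powers of P balance as follows, up to multiples of a small eps: g^(2d) gives 2d, (1 + 3 g M)^d
    costs d, and as x is about P^(-d'/d), (1 + g x M)^d costs d - d'. What remains is d'.

    Also K x^(d^2) grows like log P when d' > 0, so with probability tending to 1 some user
    reports. *)

Definition psdmx n (A : 'M[C]_n) : Prop :=
  A^t* = A /\ forall v : 'rV[C]_n, 0 <= (v *m A *m v^t*) 0 0.

Lemma trmxCM m n p (A : 'M[C]_(m, n)) (B : 'M[C]_(n, p)) :
  (A *m B)^t* = B^t* *m A^t*.
Proof. by rewrite trmx_mul map_mxM. Qed.

Lemma trmxCD m n (A B : 'M[C]_(m, n)) : (A + B)^t* = A^t* + B^t*.
Proof. by rewrite linearD map_mxD. Qed.

Lemma trmxC1 n : (1%:M : 'M[C]_n)^t* = 1%:M.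
Proof. by rewrite trmx1 map_mx1. Qed.

Lemma trmxCZ m n (c : C) (A : 'M[C]_(m, n)) : (c *: A)^t* = c^* *: A^t*.
Proof. by rewrite linearZ /= map_mxZ. Qed.

Lemma trmxCV n (A : 'M[C]_n) : (invmx A)^t* = invmx (A^t*).
Proof. by rewrite trmx_inv map_invmx. Qed.

Lemma det_trmxC n (A : 'M[C]_n) : \det (A^t*) = (\det A)^*.
Proof. by rewrite det_map_mx det_tr. Qed.

Lemma gram_trE m n (A : 'M[C]_(m, n)) :
  \tr (A *m A^t*) = \sum_i \sum_j `|A i j| ^+ 2.
Proof.
rewrite /mxtrace; apply: eq_bigr => i _; rewrite mxE; apply: eq_bigr => j _.
by rewrite !mxE normCK.
Qed.

Lemma row_gramE n (v : 'rV[C]_n) : (v *m v^t*) 0 0 = \sum_j `|v 0 j| ^+ 2.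
Proof. by rewrite -trace_mx11 gram_trE big_ord1. Qed.

Lemma psd_gram m n (X : 'M[C]_(m, n)) : psdmx (X *m X^t*).
Proof.
split=> [|v]; first by rewrite trmxCM trmxCK.
rewrite mulmxA -mulmxA -trmxCM row_gramE.
by apply: sumr_ge0 => j _; rewrite exprn_ge0.
Qed.

Lemma psd1 n : psdmx (1%:M : 'M[C]_n).
Proof. by have := psd_gram (1%:M : 'M[C]_n); rewrite mul1mx trmxC1. Qed.

Lemma psdD n (A B : 'M[C]_n) : psdmx A -> psdmx B -> psdmx (A + B).
Proof.
move=> [hA pA] [hB pB]; split=> [|v]; first by rewrite trmxCD hA hB.
by rewrite mulmxDr mulmxDl mxE addr_ge0.
Qed.

Lemma psdZ n (c : C) (A : 'M[C]_n) : 0 <= c -> psdmx A -> psdmx (c *: A).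
Proof.
move=> c0 [hA pA]; split=> [|v]; first by rewrite trmxCZ hA geC0_conj.
by rewrite -scalemxAr -scalemxAl mxE mulr_ge0.
Qed.

Lemma psd_conj m n (X : 'M[C]_(m, n)) (A : 'M[C]_n) :
  psdmx A -> psdmx (X *m A *m X^t*).
Proof.
move=> [hA pA]; split=> [|v]; first by rewrite !trmxCM trmxCK hA mulmxA.
by have := pA (v *m X); rewrite trmxCM !mulmxA.
Qed.

Lemma psd_spectral n (A : 'M[C]_n) : psdmx A ->
  exists (W : 'M[C]_n) (s : 'rV[C]_n),
    [/\ W^t* *m W = 1%:M, forall j, 0 <= s 0 j & A = W *m diag_mx s *m W^t*].
Proof.
move=> [hA pA]; have nA : A \is normalmx by apply/normalmxP; rewrite hA.
have /orthomx_spectralP := nA.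
set P := spectralmx A; set s := spectral_diag A => AE.
have uP : P \is unitarymx := spectral_unitarymx A.
rewrite (invmx_unitary uP) in AE.
have PP : P *m P^t* = 1%:M by apply/unitarymxP.
exists (P^t*), s; rewrite trmxCK; split=> // j.
have := pA (row j P); rewrite AE !mulmxA -row_mul PP.
have -> : row j 1%:M *m diag_mx s *m P *m (row j P)^t* = (s 0 j)%:M.
  have -> : (row j P)^t* = P^t* *m (row j (1%:M : 'M[C]_n))^t*.
    by rewrite -[X in row j X](mul1mx P) row_mul trmxCM.
  rewrite mulmxA -(mulmxA _ P) PP mulmx1.
  apply/matrixP => a b; rewrite !ord1 mul_mx_diag mxE (bigD1 j) //= big1 => [|k nk].
    by rewrite !mxE ?ord1 !eqxx conjC1 mulr1 mul1r addr0.
  by rewrite !mxE eq_sym (negbTE nk) mul0r mul0r.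
by rewrite mxE eqxx mulr1n.
Qed.

Lemma unitary_det1 n (W M : 'M[C]_n) : W^t* *m W = 1%:M ->
  \det (W *m M *m W^t*) = \det M.
Proof.
move=> WW; rewrite !det_mulmx mulrAC -det_mulmx (mulmx1C WW).
by rewrite det1 mul1r.
Qed.

(** Each eigenvalue lies between 0 and the trace. *)
Lemma psd_det1D n (A : 'M[C]_n) : psdmx A ->
  1 <= \det (1%:M + A) <= (1 + \tr A) ^+ n.
Proof.
move=> /psd_spectral [W [s [WW s0 ->]]].
have -> : 1%:M + W *m diag_mx s *m W^t* = W *m diag_mx (const_mx 1 + s) *m W^t*.
  by rewrite linearD /= diag_const_mx mulmxDr mulmxDl mulmx1 (mulmx1C WW).
rewrite unitary_det1 // det_diag -mulmxA mxtrace_mulC -mulmxA WW mulmx1.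
rewrite mxtrace_diag; apply/andP; split.
  elim/big_ind : _ => // [x y x1 y1|i _]; last by rewrite !mxE lerDl.
  by rewrite -[1]mulr1; apply: ler_pM.
rewrite -[n in _ ^+ n]card_ord -prodr_const; apply: ler_prod => i _.
rewrite !mxE addr_ge0 //= lerD2l (bigD1 i) //= lerDl.
by apply: sumr_ge0 => j _.
Qed.

Lemma diag_gram n (s : 'rV[C]_n) : (forall j, 0 <= s 0 j) ->
  diag_mx s = diag_mx (map_mx sqrtC s) *m (diag_mx (map_mx sqrtC s))^t*.
Proof.
move=> s0; rewrite tr_diag_mx map_diag_mx mulmx_diag; congr diag_mx.
apply/rowP => j; rewrite !mxE /= geC0_conj ?sqrtC_ge0 //.
by rewrite -expr2 sqrtCK.
Qed.

Lemma psd_sqrt n (A : 'M[C]_n) : psdmx A -> exists Y : 'M[C]_n, A = Y *m Y^t*.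
Proof.
move=> /psd_spectral [W [s [WW s0 ->]]].
exists (W *m diag_mx (map_mx sqrtC s)).
by rewrite diag_gram // trmxCM !mulmxA.
Qed.

Lemma psd_det_ge0 n (A : 'M[C]_n) : psdmx A -> 0 <= \det A.
Proof. by move=> /psd_sqrt [Y ->]; rewrite det_mulmx det_trmxC -normCK exprn_ge0. Qed.

(** For invertible [A = Y Y^H] the sum factors as [Y (1 + Y^-1 B Y^-H) Y^H], and the determinant in
    the middle is at least 1. *)
Lemma psd_det_le n (A B : 'M[C]_n) : psdmx A -> psdmx B ->
  \det A <= \det (A + B).
Proof.
move=> pA pB; have [dA0|dA0] := eqVneq (\det A) 0.
  by rewrite dA0; apply/psd_det_ge0/psdD.
have [Y AE] := psd_sqrt pA.
have uY : Y \in unitmx.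
  rewrite unitmxE unitfE; apply: contra_neq dA0 => Y0.
  by rewrite AE det_mulmx Y0 mul0r.
have -> : A + B = Y *m (1%:M + invmx Y *m B *m (invmx Y)^t*) *m Y^t*.
  rewrite mulmxDr mulmxDl mulmx1 -AE !mulmxA mulmxV // mul1mx trmxCV -mulmxA.
  by rewrite mulVmx ?mulmx1 // unitmxE det_trmxC unitfE conjC_eq0 -unitfE -unitmxE.
rewrite !det_mulmx mulrAC -det_mulmx -AE.
rewrite -[leLHS]mulr1 ler_wpM2l ?psd_det_ge0 //.
by have /andP[] := psd_det1D (psd_conj (invmx Y) pB).
Qed.

Lemma psd_block_ul m n (A : 'M[C]_m) B D (E : 'M[C]_n) :
  psdmx (block_mx A B D E) -> psdmx A.
Proof.
move=> pZ; have := psd_conj (row_mx 1%:M 0) pZ.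
rewrite mul_row_block !mul1mx !mul0mx !addr0.
rewrite tr_row_mx map_col_mx mul_row_col trmxC1 mulmx1 trmx0.
by rewrite map_mx0 mulmx0 addr0.
Qed.

Lemma psd_block_dr m n (A : 'M[C]_m) B D (E : 'M[C]_n) :
  psdmx (block_mx A B D E) -> psdmx E.
Proof.
move=> pZ; have := psd_conj (row_mx 0 1%:M) pZ.
rewrite mul_row_block !mul1mx !mul0mx !add0r.
rewrite tr_row_mx map_col_mx mul_row_col trmxC1 mulmx1 trmx0.
by rewrite map_mx0 mulmx0 add0r.
Qed.

(** Block elimination: [L] has determinant 1 and turns the matrix into diag([A], [S]) with the Schur
    complement [S]. Since [E - S = B^H A^-1 B] is positive semidefinite, the determinant of [S] is
    at most that of [E]. *)
Lemma fischer m n (A : 'M[C]_m) B (E : 'M[C]_n) : A \in unitmx ->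
  psdmx (block_mx A B (B^t*) E) ->
  \det (block_mx A B (B^t*) E) <= \det A * \det E.
Proof.
move=> uA pZ; have pA := psd_block_ul pZ; have [hA _] := pA.
pose L : 'M[C]_(m + n) := block_mx 1%:M 0 (- (B^t* *m invmx A)) 1%:M.
pose S := E - B^t* *m invmx A *m B.
have LZ : L *m block_mx A B (B^t*) E *m L^t* = block_mx A 0 0 S.
  rewrite /L tr_block_mx map_block_mx !mulmx_block !mul1mx !mul0mx.
  rewrite !trmxC1 !trmx0 !map_mx0 !mulmx0 !mulmx1 !addr0.
  have -> : (- (B^t* *m invmx A))^t* = - (invmx A *m B).
    rewrite -scaleN1r trmxCZ trmxCM trmxCK trmxCV hA rmorphN1 scaleN1r //.
  rewrite !mulNmx -!mulmxA mulVmx // mulmx1 !addNr mul0mx add0r.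
  rewrite mulmxN (mulmxA A) mulmxV // mul1mx addNr mulmxA /S.
  by rewrite [in RHS]addrC.
have dL : \det L = 1 by rewrite det_lblock !det1 mul1r.
have := congr1 determinant LZ.
rewrite !det_mulmx det_trmxC dL rmorph1 mul1r mulr1 => ->.
have pS : psdmx S by apply: (@psd_block_dr m n A 0 0); rewrite -LZ; apply: psd_conj.
rewrite det_lblock ler_wpM2l ?psd_det_ge0 //.
have -> : \det E = \det (S + B^t* *m (invmx A *m A *m (invmx A)^t*) *m B^t*^t*).
  by rewrite mulVmx // mul1mx trmxCV hA trmxCK addrNK.
by apply: psd_det_le => //; do 2! apply: psd_conj.
Qed.

End PSD.

(** * Frobenius norms, eigenvalues of the interference, and the determinant in the rate *)

Section Frobenius.
Local Open Scope sesquilinear_scope.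
Variable C : numClosedFieldType.

Definition fro2 m n (A : 'M[C]_(m, n)) : C := \tr (A *m A^t*).

Lemma fro2E m n (A : 'M[C]_(m, n)) : fro2 A = \sum_i \sum_j `|A i j| ^+ 2.
Proof. exact: gram_trE. Qed.

Lemma fro2_ge0 m n (A : 'M[C]_(m, n)) : 0 <= fro2 A.
Proof. by rewrite fro2E; do 2! apply: sumr_ge0 => ? _; rewrite exprn_ge0. Qed.

Lemma fro2_eq0 m n (A : 'M[C]_(m, n)) : fro2 A = 0 -> A = 0.
Proof.
rewrite fro2E => /eqP; rewrite psumr_eq0 => [|i _]; last first.
  by apply: sumr_ge0 => ? _; rewrite exprn_ge0.
move=> /allP /= h; apply/matrixP => i j; rewrite mxE.
have /eqP/eqP := h i (mem_index_enum _).
rewrite psumr_eq0 => [/allP /= h'|? _]; last by rewrite exprn_ge0.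
by have := h' j (mem_index_enum _); rewrite expf_eq0 normr_eq0 => /eqP.
Qed.

Lemma fro2_trC m n (A : 'M[C]_(m, n)) : fro2 (A^t*) = fro2 A.
Proof. by rewrite /fro2 trmxCK mxtrace_mulC. Qed.

Lemma fro2_trE m n (A : 'M[C]_(m, n)) : fro2 A = \tr (A^t* *m A).
Proof. exact: mxtrace_mulC. Qed.

Lemma fro2_entry m n (A : 'M[C]_(m, n)) i j : `|A i j| ^+ 2 <= fro2 A.
Proof.
rewrite fro2E (bigD1 i) //= (bigD1 j) //= -addrA lerDl addr_ge0 //.
  by apply: sumr_ge0 => ? _; rewrite exprn_ge0.
by do 2! apply: sumr_ge0 => ? _; rewrite exprn_ge0.
Qed.

Lemma psd_tr_ge0 n (A : 'M[C]_n) : psdmx A -> 0 <= \tr A.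
Proof. by move=> /psd_sqrt [Y ->]; apply: fro2_ge0. Qed.

(** Every eigenvalue is at most the trace. Conjugated by another matrix and traced, this gives the
    submultiplicativity [fro2M]. *)
Lemma psd_trB n (A : 'M[C]_n) : psdmx A -> psdmx ((\tr A)%:M - A).
Proof.
move=> /psd_spectral [W [s [WW s0 ->]]].
have -> : \tr (W *m diag_mx s *m W^t*) = \sum_i s 0 i.
  by rewrite -mulmxA mxtrace_mulC -mulmxA WW mulmx1 mxtrace_diag.
set t := \sum_i _.
have -> : t%:M - W *m diag_mx s *m W^t* = W *m diag_mx (const_mx t - s) *m W^t*.
  rewrite linearB /= diag_const_mx mulmxBr mulmxBl mul_mx_scalar -scalemxAl.
  by rewrite (mulmx1C WW) scalemx1.
apply: psd_conj; rewrite diag_gram; first exact: psd_gram.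
move=> j; rewrite !mxE subr_ge0 /t (bigD1 j) //= lerDl.
exact: sumr_ge0.
Qed.

Lemma fro2M m n p (A : 'M[C]_(m, n)) (B : 'M[C]_(n, p)) :
  fro2 (A *m B) <= fro2 A * fro2 B.
Proof.
have := psd_tr_ge0 (psd_conj A (psd_trB (psd_gram B))).
rewrite mulmxBr mulmxBl linearB /= subr_ge0 /fro2 trmxCM !mulmxA => /le_trans; apply.
by rewrite mul_mx_scalar -scalemxAl linearZ /= mulrC.
Qed.

Lemma row_diag_mul m n (s : 'rV[C]_m) (X : 'M[C]_(m, n)) j :
  row j (diag_mx s *m X) = s 0 j *: row j X.
Proof. by apply/rowP => i; rewrite mul_diag_mx !mxE. Qed.

(** A positive semidefinite matrix has no negative eigenvalue. *)
Lemma row_psd_eq n (A : 'M[C]_n) (v : 'rV[C]_n) (c : C) :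
  psdmx A -> 0 < c -> v *m A + c *: v = 0 -> v = 0.
Proof.
move=> [_ pA] c0 vE; have := congr1 (fun u => (u *m v^t*) 0 0) vE.
rewrite mulmxDl -scalemxAl mul0mx mxE [(0 : 'M[C]_1) _ _]mxE [(c *: (_ *m _)) _ _]mxE.
move=> /eqP; rewrite paddr_eq0 ?pA //; last first.
  by rewrite mulr_ge0 ?(ltW c0) // row_gramE sumr_ge0 // => ? _; rewrite exprn_ge0.
case/andP=> _; rewrite mulf_eq0 (gt_eqF c0) /= -trace_mx11 => /eqP.
exact: fro2_eq0.
Qed.

(** The decomposition that defines the postfilter does not relate [W] to [V]. Multiplying [A] by its
    adjoint removes [V]: [A^2 = W diag(s)^2 W^H], so the defect [X = W^H A - diag(s) W^H] satisfies
    [X A = - diag(s) X]. Row [j] of [X] would be an eigenvector of [A] for [- s 0 j], hence it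
    vanishes; if [s 0 j = 0], it is killed by [A] and lies in the row space of [A], so it is
    orthogonal to itself. *)
Lemma svd_psd n (A W V : 'M[C]_n) (s : 'rV[C]_n) : psdmx A ->
  W^t* *m W = 1%:M -> V^t* *m V = 1%:M -> (forall j, 0 <= s 0 j) ->
  A = W *m diag_mx s *m V^t* -> W^t* *m A = diag_mx s *m W^t*.
Proof.
move=> pA WW VV s0 AE; have [hA _] := pA.
have hD : (diag_mx s)^t* = diag_mx s.
  rewrite tr_diag_mx map_diag_mx; congr diag_mx; apply/rowP => j.
  by rewrite !mxE /= geC0_conj.
have AA : A *m A = W *m diag_mx s *m diag_mx s *m W^t*.
  rewrite -{2}hA {1}AE AE !trmxCM trmxCK hD -!mulmxA (mulmxA (V^t*)) VV.
  by rewrite mul1mx.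
pose X := W^t* *m A - diag_mx s *m W^t*.
have XE : X *m A + diag_mx s *m X = 0.
  rewrite /X mulmxBl mulmxBr -!mulmxA AA !mulmxA WW mul1mx.
  by rewrite addrA addrNK subrr.
suff X0 : X = 0 by apply/eqP; rewrite -subr_eq0 -/X X0.
apply/row_matrixP => j; rewrite row0.
have XEj : row j X *m A + s 0 j *: row j X = 0.
  rewrite -row_mul; have -> : s 0 j *: row j X = row j (diag_mx s *m X).
    by rewrite row_diag_mul.
  by rewrite -linearD XE linear0.
have [sj0|] := eqVneq (s 0 j) 0; last first.
  move=> sj0; apply: (row_psd_eq pA _ XEj).
  by rewrite lt_neqAle eq_sym sj0 s0.
have XjE : row j X = row j (W^t*) *m A.
  by rewrite /X linearB /= row_diag_mul sj0 scale0r subr0 row_mul.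
move: XEj; rewrite sj0 scale0r addr0 => XjA.
apply: fro2_eq0; rewrite /fro2 {2}XjE trmxCM hA mulmxA XjA mul0mx.
by rewrite linear0.
Qed.

(* A vector in the span of the k.+1 leading eigenvectors that is orthogonal
   to the k columns of H bounds the (k.+1)-th eigenvalue. *)
Lemma eigen_minmax n k p (H Q : 'M[C]_(n, k)) (F : 'M[C]_(n, p)) (W : 'M[C]_n)
    (s : 'rV[C]_n) (f : 'I_k.+1 -> 'I_n) (c : C) : injective f ->
  W^t* *m W = 1%:M ->
  W^t* *m (H *m H^t* + F *m F^t*) = diag_mx s *m W^t* ->
  (forall i, c <= s 0 (f i)) -> 0 <= c ->
  (Q^T <= H^T)%MS ->
  c <= fro2 ((1%:M - Q *m Q^t*) *m F).
Proof.
move=> finj WW WE sf c0 QH.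
pose B := (colsub f W)^t*.
have BB : B *m B^t* = 1%:M.
  rewrite /B trmxCK; apply/matrixP => i j; rewrite !mxE.
  have := congr1 (fun M : 'M[C]_n => M (f i) (f j)) WW; rewrite !mxE.
  rewrite (inj_eq finj) => <-; apply: eq_bigr => l _; by rewrite !mxE.
have BE : B *m (H *m H^t* + F *m F^t*) = diag_mx (colsub f s) *m B.
  apply/row_matrixP => i; rewrite row_mul row_diag_mul mxE.
  have -> : row i B = row (f i) (W^t*) by apply/rowP => j; rewrite !mxE.
  by rewrite -row_mul WE row_diag_mul.
have : kermx (B *m H) != 0.
  rewrite -mxrank_eq0 mxrank_ker subn_eq0 -ltnNge ltnS.
  exact: rank_leq_col.
case/rowV0Pn => b /sub_kermxP bBH b0.
pose v := b *m B.
have vH : v *m H = 0 by rewrite /v -mulmxA.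
have vQ : v *m Q = 0.
  apply: trmx_inj; rewrite trmx_mul trmx0.
  have /submxP[T ->] := QH.
  by rewrite -mulmxA -trmx_mul vH trmx0 mulmx0.
have vv : fro2 v = fro2 b.
  by rewrite /fro2 /v trmxCM mulmxA -(mulmxA b) BB mulmx1.
have b_gt0 : 0 < fro2 b.
  by rewrite lt_neqAle fro2_ge0 andbT eq_sym; apply: contra_neq b0 => /fro2_eq0.
have vF : fro2 (v *m F) = \sum_i s 0 (f i) * `|b 0 i| ^+ 2.
  have : v *m (H *m H^t* + F *m F^t*) *m v^t* = b *m diag_mx (colsub f s) *m b^t*.
    by rewrite /v -(mulmxA b) BE trmxCM !mulmxA -(mulmxA _ B) BB mulmx1.
  rewrite mulmxDr mulmxA vH mul0mx add0r mulmxA -mulmxA -trmxCM.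
  rewrite /fro2 => ->; rewrite trace_mx11 mul_mx_diag mxE.
  by apply: eq_bigr => i _; rewrite !mxE normCK mulrAC mulrC.
have h1 : c * fro2 b <= fro2 (v *m F).
  rewrite vF fro2E big_ord1 mulr_sumr; apply: ler_sum => i _.
  by rewrite ler_wpM2r // exprn_ge0.
have h2 : fro2 (v *m F) <= fro2 b * fro2 ((1%:M - Q *m Q^t*) *m F).
  rewrite -vv; have {1}-> : v *m F = v *m ((1%:M - Q *m Q^t*) *m F).
    by rewrite mulmxA mulmxBr mulmx1 mulmxA vQ mul0mx subr0.
  exact: fro2M.
rewrite -(ler_pM2l b_gt0); apply: le_trans h2; by rewrite mulrC.
Qed.

(* The sum of the eigenvalues of the leading block is at most the trace, so
   Fischer's inequality bounds the trailing block from below. *)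
Lemma fischer_trailing d (Y W : 'M[C]_(d + d)) : psdmx Y ->
  W^t* *m W = 1%:M ->
  \det (1%:M + Y) <=
    (1 + \tr Y) ^+ d * \det (1%:M + (rsubmx W)^t* *m Y *m rsubmx W).
Proof.
move=> pY WW; set V := lsubmx W; set U := rsubmx W.
have WE : W = row_mx V U by rewrite hsubmxK.
have pYW := psd_conj (W^t*) pY; rewrite trmxCK in pYW.
have YE : W^t* *m Y *m W = block_mx (V^t* *m Y *m V) (V^t* *m Y *m U)
    (U^t* *m Y *m V) (U^t* *m Y *m U).
  by rewrite WE tr_row_mx map_col_mx mul_col_mx mul_col_row.
rewrite -(unitary_det1 (W := W^t*)) ?trmxCK ?(mulmx1C WW) //.
rewrite mulmxDr mulmxDl mulmx1 WW YE scalar_mx_block add_block_mx !add0r.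
have [hY _] := pY.
have hVU : U^t* *m Y *m V = (V^t* *m Y *m U)^t*.
  by rewrite !trmxCM trmxCK hY mulmxA.
have pZ : psdmx (block_mx (1%:M + V^t* *m Y *m V) (V^t* *m Y *m U)
    (U^t* *m Y *m V) (1%:M + U^t* *m Y *m U)).
  have := psdD (psd1 C (d + d)) pYW.
  by rewrite YE scalar_mx_block add_block_mx !add0r.
have pV : psdmx (V^t* *m Y *m V) by have := psd_conj (V^t*) pY; rewrite trmxCK.
have pU : psdmx (U^t* *m Y *m U) by have := psd_conj (U^t*) pY; rewrite trmxCK.
have /andP[dV1 dV2] := psd_det1D pV; have /andP[dU1 _] := psd_det1D pU.
rewrite hVU in pZ *; apply: le_trans (fischer _ pZ) _.
  by rewrite unitmxE unitfE gt_eqF // (lt_le_trans _ dV1).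
rewrite ler_wpM2r ?(le_trans _ dU1) //; apply: le_trans dV2 _.
apply: lerXn2r; rewrite ?nnegrE ?addr_ge0 ?psd_tr_ge0 // lerD2l.
have -> : \tr Y = \tr (V^t* *m Y *m V) + \tr (U^t* *m Y *m U).
  have := congr1 mxtrace YE; rewrite mxtrace_block => <-.
  by rewrite mxtrace_mulC mulmxA (mulmx1C WW) mul1mx.
by rewrite lerDl psd_tr_ge0.
Qed.

Section RateBound.
Variables (d : nat) (Hp Hq H : 'M[C]_(d + d, d)) (W : 'M[C]_(d + d)).
Variables (s : 'rV[C]_(d + d)) (g : C).
Hypotheses (g0 : 0 < g) (WW : W^t* *m W = 1%:M).
Hypothesis WE :
  W^t* *m (Hp *m Hp^t* + Hq *m Hq^t*) = diag_mx s *m W^t*.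
Hypothesis s0 : forall j, 0 <= s 0 j.
Let U := rsubmx W.
Let S := U^t* *m H *m H^t* *m U.
Let Itf := U^t* *m Hp *m Hp^t* *m U + U^t* *m Hq *m Hq^t* *m U.

Let ItfE : Itf = U^t* *m (Hp *m Hp^t* + Hq *m Hq^t*) *m U.
Proof. by rewrite mulmxDr mulmxDl !mulmxA. Qed.

Lemma interference_diag : Itf = diag_mx (rsubmx s).
Proof.
have UU : U^t* *m U = 1%:M.
  have := WW; rewrite -[in LHS](hsubmxK W) tr_row_mx map_col_mx mul_col_row.
  by rewrite scalar_mx_block => /eq_block_mx[].
have UE : U^t* *m (Hp *m Hp^t* + Hq *m Hq^t*) = diag_mx (rsubmx s) *m U^t*.
  apply/row_matrixP => i; rewrite row_mul row_diag_mul mxE.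
  have -> : row i (U^t*) = row (rshift d i) (W^t*) by apply/rowP => j; rewrite !mxE.
  by rewrite -row_mul WE row_diag_mul.
by rewrite ItfE UE -mulmxA UU mulmx1.
Qed.

Lemma det_interference :
  \det (1%:M + g *: Itf) = \prod_(i < d) (1 + g * s 0 (rshift d i)).
Proof.
rewrite interference_diag -[1%:M]diag_const_mx -linearZ -linearD /= det_diag.
by apply: eq_bigr => i _; rewrite !mxE.
Qed.

Lemma det_interference_gt0 : 0 < \det (1%:M + g *: Itf).
Proof.
by rewrite det_interference prodr_gt0 // => i _; rewrite ltr_wpDr // mulr_ge0 // ltW.
Qed.

Let psdI : psdmx Itf.
Proof.
by rewrite ItfE -[U in _ *m U]trmxCK; apply/psd_conj/psdD; apply: psd_gram.
Qed.

Let psdS : psdmx S.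
Proof.
have := psd_conj (U^t*) (psd_gram H); rewrite trmxCK !mulmxA.
by rewrite /S.
Qed.

Lemma det_rateE : \det (1%:M + g *: S *m invmx (1%:M + g *: Itf)) =
  \det (1%:M + g *: Itf + g *: S) / \det (1%:M + g *: Itf).
Proof.
have uI : 1%:M + g *: Itf \in unitmx.
  by rewrite unitmxE unitfE gt_eqF // det_interference_gt0.
rewrite -det_inv -det_mulmx [in RHS]mulmxDl mulmxV //.
Qed.

Lemma det_rate_ge1 : 1 <= \det (1%:M + g *: S *m invmx (1%:M + g *: Itf)).
Proof.
rewrite det_rateE ler_pdivlMr ?det_interference_gt0 // mul1r.
by apply: psd_det_le; [apply: psdD (psd1 _ _) _ |]; apply: psdZ; rewrite ?ltW.
Qed.

(** [Y] is [g] times the covariance of interference and signal. [1%:M + Y] dominates [g] times the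
    Gram matrix of the square matrix [Hp H], which gives the left side. [fischer_trailing] removes
    the [d] leading directions at the price [(1 + g * T) ^+ d] and leaves the numerator in
    [det_rateE]; the denominator there is at most [(1 + g * c) ^+ d]. *)
Lemma det_rate_ge (c T : C) : (forall i, s 0 (rshift d i) <= c) ->
  fro2 Hp + fro2 Hq + fro2 H <= T ->
  g ^+ (d + d) * `|\det (row_mx Hp H)| ^+ 2 <=
  ((1 + g * T) * (1 + g * c)) ^+ d *
    \det (1%:M + g *: S *m invmx (1%:M + g *: Itf)).
Proof.
move=> sc TE.
pose Y := g *: (Hp *m Hp^t* + Hq *m Hq^t* + H *m H^t*).
have pY : psdmx Y by apply: psdZ; [exact: ltW|apply: psdD; [apply: psdD|]; exact: psd_gram].
have h1 : g ^+ (d + d) * `|\det (row_mx Hp H)| ^+ 2 <= \det (1%:M + Y).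
  have -> : g ^+ (d + d) * `|\det (row_mx Hp H)| ^+ 2 =
     \det (g *: (row_mx Hp H *m (row_mx Hp H)^t*)).
    by rewrite detZ det_mulmx det_trmxC normCK.
  have -> : 1%:M + Y = g *: (row_mx Hp H *m (row_mx Hp H)^t*) +
      (1%:M + g *: (Hq *m Hq^t*)).
    rewrite tr_row_mx map_col_mx mul_row_col /Y !scalerDr addrC.
    by rewrite -!addrA; congr (_ + _); rewrite addrC -addrA.
  apply: psd_det_le; first by apply: psdZ; [exact: ltW|exact: psd_gram].
  by apply: psdD (psd1 _ _) _; apply: psdZ; [exact: ltW|exact: psd_gram].
apply: le_trans h1 _; apply: le_trans (fischer_trailing pY WW) _.
have -> : 1%:M + (rsubmx W)^t* *m Y *m rsubmx W = 1%:M + g *: Itf + g *: S.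
  rewrite -addrA -scalerDr /Y -scalemxAr -scalemxAl -/U !mulmxDr !mulmxDl.
  by rewrite !mulmxA.
have dN : 0 <= \det (1%:M + g *: Itf + g *: S).
  by apply/psd_det_ge0/psdD; [apply: psdD (psd1 _ _) _|]; apply: psdZ; rewrite ?ltW.
have trY : 0 <= \tr Y by exact: psd_tr_ge0.
rewrite exprMn -mulrA; apply: ler_pM => //; first by rewrite exprn_ge0 ?addr_ge0.
  have T0 : 0 <= T by apply: le_trans TE; rewrite !addr_ge0 ?fro2_ge0.
  apply: lerXn2r; rewrite ?nnegrE ?addr_ge0 ?mulr_ge0 ?(ltW g0) // lerD2l.
  by rewrite /Y linearZ /= !linearD /= ler_wpM2l ?(ltW g0).
rewrite det_rateE mulrA ler_pdivlMr ?det_interference_gt0 // mulrC ler_wpM2r //.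
rewrite det_interference -[d in _ ^+ d]card_ord -prodr_const; apply: ler_prod => i _.
by rewrite addr_ge0 ?mulr_ge0 ?(ltW g0) //= lerD2l ler_wpM2l ?(ltW g0).
Qed.
End RateBound.
End Frobenius.

(** * The channel matrices *)

Section Channel.
Local Open Scope sesquilinear_scope.
Local Open Scope complex_scope.
Variable R : realType.
Local Notation C := R[i].

Lemma ge0_RRe (z : C) : 0 <= z -> z = (complex.Re z)%:C.
Proof. by case: z => a b; rewrite lecE /= => /andP[/eqP -> _]. Qed.

Lemma normc_normE (z : C) : `|z| = (ComplexField.Normc.normc z)%:C.
Proof. by []. Qed.

Lemma normc_ge0 (z : C) : 0 <= ComplexField.Normc.normc z.
Proof. by case: z => a b; rewrite /= sqrtr_ge0. Qed.

Lemma frob_sqr m n (A : 'M[C]_(m, n)) : (frob A ^+ 2)%:C = fro2 A.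
Proof.
rewrite /frob sqr_sqrtr; last first.
  by do 2! apply: sumr_ge0 => ? _; rewrite sqr_ge0.
rewrite fro2E rmorph_sum; apply: eq_bigr => r _.
by rewrite rmorph_sum; apply: eq_bigr => c _; rewrite rmorphXn.
Qed.

(** Both projections have trace [n], so either side equals [n - tr (P Q)], the sum of the squared
    sines of the principal angles. The right side is the leakage of [B] out of the span of [A]. *)
Lemma chordal_sqr m n (A B : 'M[C]_(m, n)) :
  A^t* *m A = 1%:M -> B^t* *m B = 1%:M ->
  (chordal A B ^+ 2)%:C = fro2 ((1%:M - A *m A^t*) *m B).
Proof.
move=> AA BB; rewrite /chordal exprMn exprVn sqr_sqrtr // rmorphM /= frob_sqr.
rewrite -[ctr A]/(A^t*) -[ctr B]/(B^t*).
set P := A *m A^t*; set Q := B *m B^t*.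
have PP : P *m P = P by rewrite /P mulmxA -(mulmxA A) AA mulmx1.
have QQ : Q *m Q = Q by rewrite /Q mulmxA -(mulmxA B) BB mulmx1.
have hP : P^t* = P by rewrite /P trmxCM trmxCK.
have hQ : Q^t* = Q by rewrite /Q trmxCM trmxCK.
have trP : \tr P = n%:R by rewrite /P mxtrace_mulC AA mxtrace1.
have trQ : \tr Q = n%:R by rewrite /Q mxtrace_mulC BB mxtrace1.
have hB (X Y : 'M[C]_m) : (X - Y)^t* = X^t* - Y^t* by rewrite linearB map_mxB.
have -> : fro2 (P - Q) = (n%:R - \tr (P *m Q)) *+ 2.
  rewrite /fro2 hB hP hQ.
  have -> : (P - Q) *m (P - Q) = P - P *m Q - (Q *m P - Q).
    by rewrite mulmxBl !mulmxBr PP QQ.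
  rewrite !linearB /= trP trQ (mxtrace_mulC Q P).
  by rewrite opprK [- _ + _]addrC mulr2n.
have -> : fro2 ((1%:M - P) *m B) = n%:R - \tr (P *m Q).
  rewrite /fro2 trmxCM hB trmxC1 hP mxtrace_mulC -mulmxA (mulmxA (1%:M - P)).
  have -> : (1%:M - P) *m (1%:M - P) = 1%:M - P.
    by rewrite mulmxBl mul1mx mulmxBr mulmx1 PP subrr subr0.
  rewrite mxtrace_mulC -mulmxA -/Q mulmxBl mul1mx linearB /= trQ //.
have -> : ((2^-1 : R)%:C = 2^-1 :> C) by rewrite fmorphV (rmorph_nat (real_complex R)).
by rewrite -[(_ - _) *+ 2]mulr_natl mulrA mulVf ?mul1r // pnatr_eq0.
Qed.

Lemma orth_basisP m n (A : 'M[C]_(m, n)) : \rank A = n ->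
  (orth_basis A)^t* *m orth_basis A = 1%:M /\ ((orth_basis A)^T == A^T)%MS.
Proof.
move=> rA; have rAT : row_free A^T by rewrite /row_free mxrank_tr rA.
have nm : (n <= m)%N by rewrite -rA rank_leq_row.
apply: (@xgetPex _ 0 [set Q : 'M[C]_(m, n) |
           Q^t* *m Q = 1%:M /\ (Q^T == A^T)%MS]).
(* [schmidt] orthonormalises rows, hence the two transpositions. *)
exists (schmidt A^T)^T => /=; rewrite trmxK; split.
  have /unitarymxP SS := schmidt_unitarymx A^T nm.
  apply: trmx_inj; rewrite trmx_mul !trmxK trmx1.
  by rewrite map_trmx.
by apply/eqmxP/eqmx_schmidt_free.
Qed.

(** The number of rows is a variable [N] because [NR d] is [2 * d], whereas block decompositions
    need [d + d]: case analysis on an equality [d + d = N] passes from one to the other. *)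
Definition postfilterN (N d : nat) (Rm : 'M[C]_N) : 'M[C]_(N, d) :=
  xget 0 [set U : 'M[C]_(N, d) |
    exists (W V : 'M[C]_N) (s : 'rV[R]_N),
      [/\ ctr W *m W = 1%:M /\ ctr V *m V = 1%:M,
          (forall j, 0 <= s 0 j),
          (forall j j' : 'I_N, (j <= j')%N -> s 0 j' <= s 0 j),
          Rm = W *m diag_mx (map_mx (real_complex R) s) *m ctr V &
          (forall r c (j : 'I_N), val j = (d + val c)%N -> U r c = W r j)]].

Definition rateN (N d : nat) (P : R) (Hp Hq H : 'M[C]_(N, d)) : R :=
  let U := postfilterN d (Hp *m ctr Hp + Hq *m ctr Hq) in
  let g := real_complex R (P / d%:R) in
  let S := ctr U *m H *m ctr H *m U in
  let Itf := ctr U *m Hp *m ctr Hp *m U + ctr U *m Hq *m ctr Hq *m U in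
  log2 (complex.Re (\det (1%:M + g *: S *m invmx (1%:M + g *: Itf)))).

(** The spectral theorem orders the eigenvalues arbitrarily, but the postfilter asks for a
    nonincreasing order. *)
Lemma sorting_perm n (s : 'rV[R]_n) : exists f : 'I_n -> 'I_n, injective f /\
  forall j j' : 'I_n, (j <= j')%N -> s 0 (f j') <= s 0 (f j).
Proof.
pose l := sort (fun i j => s 0 j <= s 0 i) (enum 'I_n).
have tot : total (fun i j => s 0 j <= s 0 i) by move=> i j; rewrite le_total.
have szl : size l = n by rewrite size_sort size_enum_ord.
have ul : uniq l by rewrite sort_uniq enum_uniq.
have sl : sorted (fun i j => s 0 j <= s 0 i) l by apply: sort_sorted.
case: n s l tot szl ul sl => [|n] s l tot szl ul sl.
  by exists id; split=> // -[].
exists (fun i => nth ord0 l i); split=> [i j /eqP|j j' jj'].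
  by rewrite nth_uniq ?szl ?ltn_ord // => /eqP/val_inj.
apply: (sorted_leq_nth _ _ ord0 sl); rewrite ?inE ?szl ?ltn_ord //.
by move=> x y z /= xy yz; apply: le_trans yz xy.
Qed.

Lemma unitary_colsub n (W : 'M[C]_n) (f : 'I_n -> 'I_n) : injective f ->
  W^t* *m W = 1%:M -> (colsub f W)^t* *m colsub f W = 1%:M.
Proof.
move=> finj WW; apply/matrixP => i j; rewrite !mxE.
have := congr1 (fun M : 'M[C]_n => M (f i) (f j)) WW; rewrite !mxE.
by rewrite (inj_eq finj) => <-; apply: eq_bigr => l _; rewrite !mxE.
Qed.

(** The postfilter is an arbitrary admissible choice; whichever it is, it is the trailing half of a
    unitary [W] whose columns are eigenvectors by [svd_psd]. An admissible choice exists: sort a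
    spectral decomposition and take [V = W]. *)
Lemma postfilterP d (A : 'M[C]_(d + d)) : psdmx A ->
  exists (W : 'M[C]_(d + d)) (s : 'rV[R]_(d + d)),
  [/\ W^t* *m W = 1%:M, (forall j, 0 <= s 0 j),
      (forall j j' : 'I_(d + d), (j <= j')%N -> s 0 j' <= s 0 j),
      W^t* *m A = diag_mx (map_mx (real_complex R) s) *m W^t* &
      postfilterN d A = rsubmx W].
Proof.
move=> pA; rewrite /postfilterN; set F := (X in xget 0 X).
have [] : F (xget 0 F).
  apply: xgetPex; have [W [s [WW s0 AE]]] := psd_spectral pA.
  have [f [finj sf]] := sorting_perm (map_mx (@complex.Re R) s).
  exists (rsubmx (colsub f W)), (colsub f W), (colsub f W),
    (colsub f (map_mx (@complex.Re R) s)).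
  have UU := unitary_colsub finj WW.
  split=> //.
  - by move=> j; rewrite !mxE; have := s0 (f j); rewrite lecE => /andP[].
  - by move=> j j' /sf; rewrite !mxE.
  - have -> : map_mx (real_complex R) (colsub f (map_mx (@complex.Re R) s)) = colsub f s.
      by apply/rowP => j; rewrite !mxE -ge0_RRe.
    have AW : A *m colsub f W = colsub f W *m diag_mx (colsub f s).
      have AW : (A *m W = W *m diag_mx s).
        rewrite AE -[LHS]mulmxA.
        by rewrite WW mulmx1.
      apply/matrixP => i j; rewrite mul_mx_diag.
      have := congr1 (fun M : 'M[C]_(d + d) => M i (f j)) AW; rewrite mul_mx_diag !mxE => <-.
      by apply: eq_bigr => l _; rewrite !mxE.
    by rewrite -AW -mulmxA (mulmx1C UU) mulmx1.
  - move=> r c j jE; rewrite !mxE; congr (W r (f _)); apply: val_inj.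
    by rewrite jE.
move=> W [V [s [[WW VV] s0 smon AE UE]]]; exists W, s; split=> //.
- apply: (svd_psd pA WW VV) => // j; rewrite mxE lecR; exact: s0.
- by apply/matrixP => r c; rewrite (UE r c (rshift d c)) // mxE.
Qed.

Section RateN.
Variables (d : nat) (Hp Hq H : 'M[C]_(d + d, d)) (P : R).
Hypotheses (d0 : (0 < d)%N) (P0 : 0 < P).

Let g0 : 0 < (P / d%:R)%:C :> C.
Proof. by rewrite ltcR divr_gt0 // ltr0n. Qed.

Lemma rateN_ge0 : 0 <= rateN P Hp Hq H.
Proof.
rewrite /rateN; have pR := psdD (psd_gram Hp) (psd_gram Hq).
have [W [s [WW s0 smon WE ->]]] := postfilterP pR.
have s0' j : 0 <= map_mx (real_complex R) s 0 j by rewrite mxE lecR.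
have := det_rate_ge1 H g0 WW WE s0'.
rewrite lecE /= => /andP[_ h].
by rewrite /log2 divr_ge0 ?ln_ge0 ?ler1n.
Qed.

(* [c] bounds the trailing eigenvalues of the interference covariance. *)
Lemma rateN_ge (c T dt : R) : 0 < dt ->
  \rank Hp = d -> \rank Hq = d ->
  chordal (orth_basis Hp) (orth_basis Hq) ^+ 2 * frob Hq ^+ 2 <= c ->
  frob Hp ^+ 2 + frob Hq ^+ 2 + frob H ^+ 2 <= T ->
  dt <= ComplexField.Normc.normc (\det (row_mx Hp H)) ^+ 2 ->
  (log2 ((P / d%:R) ^+ (d + d) * dt) -
    log2 (((1 + P / d%:R * T) * (1 + P / d%:R * c)) ^+ d)) <= rateN P Hp Hq H.
Proof.
move=> dt0 rp rq Dc HT Hdt; rewrite /rateN.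
have pR := psdD (psd_gram Hp) (psd_gram Hq).
have [W [s [WW s0 smon WE ->]]] := postfilterP pR.
have s0' j : 0 <= map_mx (real_complex R) s 0 j by rewrite mxE lecR.
have [Qp1 Qp2] := orth_basisP rp; have [Qq1 Qq2] := orth_basisP rq.
have dlt : (d < d + d)%N by rewrite -addn1 leq_add2l.
have sc i : map_mx (real_complex R) s 0 (rshift d i) <= c%:C.
  pose s' := s 0 (Ordinal dlt).
  apply: le_trans (_ : s'%:C <= _).
    by rewrite mxE lecR; apply: smon => /=; rewrite leq_addr.
  (* As [Hp] has [d] columns, [eigen_minmax] applies to the [d.+1] leading indices. It bounds the
     eigenvalue of index [d] (counted from 0), the largest trailing one, by the leakage of [Hq] out
     of the span of [Hp]. *)
  pose f := widen_ord dlt : 'I_d.+1 -> 'I_(d + d).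
  have finj : injective f by move=> x y /(congr1 val) /= /val_inj.
  have h := eigen_minmax finj WW WE (c := s'%:C) (Q := orth_basis Hp).
  apply: le_trans (h _ _ _) _.
  - by move=> j; rewrite mxE lecR; apply: smon; rewrite /= -ltnS.
  - by rewrite lecR; apply: s0.
  - by case/andP: Qp2.
  apply: le_trans (_ : (chordal (orth_basis Hp) (orth_basis Hq) ^+ 2 * frob Hq ^+ 2)%:C <= _);
    last by rewrite lecR.
  rewrite rmorphM /= chordal_sqr // frob_sqr.
  have [Y YE] : exists Y, Hq = orth_basis Hq *m Y.
    case/andP: Qq2 => _ /submxP[Y /(congr1 trmx)]; rewrite trmx_mul !trmxK => YE.
    by exists Y^T.
  have -> : fro2 Hq = fro2 Y.
    rewrite YE -fro2_trC -[RHS]fro2_trC /fro2 !trmxCK trmxCM.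
    by rewrite -mulmxA (mulmxA _ _ Y) Qq1 mul1mx.
  by rewrite {1}YE mulmxA fro2M.
have := det_rate_ge (H := H) g0 WW WE s0' sc (T := T%:C).
rewrite -!frob_sqr -!rmorphD lecR /= => /(_ HT).
set Z := \det (1%:M + _) => hZ.
have Z1 : 1 <= Z := det_rate_ge1 H g0 WW WE s0'.
have ZE := ge0_RRe (le_trans ler01 Z1).
have Z1' : 1 <= complex.Re Z by move: Z1; rewrite lecE => /andP[].
move: hZ; rewrite normc_normE ZE -(rmorph1 (real_complex R)) -!rmorphM -!rmorphD.
rewrite -rmorphM -!rmorphXn -!rmorphM lecR => hZ.
have g0' : 0 < P / d%:R by move: g0; rewrite ltcR.
have T0 : 0 <= T by apply: le_trans HT; rewrite !addr_ge0 ?sqr_ge0.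
have c0 : 0 <= c by apply: le_trans Dc; rewrite mulr_ge0 ?sqr_ge0.
set a := (_ ^+ d) in hZ *.
have a0 : 0 < a.
  by rewrite exprn_gt0 // mulr_gt0 // ltr_wpDr // mulr_ge0 // ltW.
rewrite lerBlDr /log2 -mulrDl ler_pM2r ?invr_gt0 ?ln_gt0 ?ltr1n //.
have z0 : 0 < complex.Re Z by apply: lt_le_trans Z1'.
have n0 : 0 < (P / d%:R) ^+ (d + d) * dt by rewrite mulr_gt0 // exprn_gt0.
rewrite -lnM ?posrE // ler_ln ?posrE //; last by rewrite mulr_gt0.
rewrite [X in _ <= X]mulrC; apply: le_trans hZ.
by rewrite ler_wpM2l // exprn_ge0 // ltW.
Qed.

End RateN.

(** [Hp *m Y] is the orthogonal projection of [Hq] onto the column space of [Hp]. The coefficients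
    of [Hq] in its own orthonormal basis have the same Frobenius norm as [Hq]. *)
Lemma residual_bound N d (Hp Hq : 'M[C]_(N, d)) : \rank Hp = d -> \rank Hq = d ->
  exists Y : 'M[C]_d, (frob (Hq - Hp *m Y)) ^+ 2 <=
    chordal (orth_basis Hp) (orth_basis Hq) ^+ 2 * frob Hq ^+ 2.
Proof.
move=> rp rq.
have [Qp1 /andP[Qp2 _]] := orth_basisP rp; have [Qq1 /andP[_ Qq2]] := orth_basisP rq.
set Q := orth_basis Hp in Qp1 Qp2 *; set Q' := orth_basis Hq in Qq1 Qq2 *.
have [T TE] : exists T, Q = Hp *m T.
  by case/submxP: Qp2 => T /(congr1 trmx); rewrite trmx_mul !trmxK; exists T^T.
have [Y YE] : exists Y, Hq = Q' *m Y.
  by case/submxP: Qq2 => Y /(congr1 trmx); rewrite trmx_mul !trmxK; exists Y^T.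
exists (T *m (Q^t* *m Hq)); rewrite -lecR [X in _ <= X]rmorphM /= !frob_sqr chordal_sqr //.
have -> : fro2 Hq = fro2 Y.
  rewrite YE -fro2_trC -[RHS]fro2_trC /fro2 !trmxCK trmxCM.
  by rewrite -mulmxA (mulmxA _ _ Y) Qq1 mul1mx.
rewrite mulmxA -TE mulmxA -[X in X - _]mul1mx -mulmxBl.
by rewrite {1}YE mulmxA fro2M.
Qed.

Lemma normc_le_frob m n (A : 'M[C]_(m, n)) i j (nu : R) : 0 <= nu ->
  frob A ^+ 2 <= nu ^+ 2 -> ComplexField.Normc.normc (A i j) <= nu.
Proof.
move=> nu0; rewrite -lecR frob_sqr => h.
have := le_trans (fro2_entry A i j) h.
rewrite normc_normE -rmorphXn lecR.
by rewrite ler_pXn2r ?nnegrE // normc_ge0.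
Qed.

(* Cramer's rule: the coordinates of a row in terms of the rows of a maximal
   minor are ratios of minors. *)
Lemma maxminor_coord N d (A : 'M[C]_(N, d)) (f : {ffun 'I_d -> 'I_N}) :
  (forall h : {ffun 'I_d -> 'I_N}, `|\det (rowsub h A)| <= `|\det (rowsub f A)|) ->
  rowsub f A \in unitmx ->
  forall r j, `|(row r A *m invmx (rowsub f A)) 0 j| <= 1.
Proof.
move=> fmax uf r j; rewrite /invmx uf -scalemxAr mxE normrM normfV.
rewrite mulrC ler_pdivrMr ?normr_gt0 -?unitfE -?unitmxE // mul1r.
pose h : {ffun 'I_d -> 'I_N} := [ffun k => if k == j then r else f k].
apply: le_trans (fmax h); rewrite (expand_det_row _ j) mxE.
have cof k : cofactor (rowsub h A) j k = cofactor (rowsub f A) j k.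
  rewrite /cofactor; have -> // : row' j (col' k (rowsub h A)) = row' j (col' k (rowsub f A)).
  apply/matrixP => a b; rewrite !mxE ffunE.
  by rewrite eq_sym (negbTE (neq_lift _ _)).
have -> // : \sum_k row r A 0 k * (\adj (rowsub f A)) k j =
    \sum_k rowsub h A j k * cofactor (rowsub h A) j k.
by apply: eq_bigr => k _; rewrite cof [row r A 0 k]mxE [rowsub h A j k]mxE ffunE eqxx [in LHS]mxE.
Qed.

(** Write [Hq = Hp *m Y + F] with all entries of [F] at most [nu]. Reconstruction from the rows [f]
    is exact on [Hp *m Y], so the error is one entry of [F] minus a combination of [d] others, whose
    coefficients are at most 1 by [maxminor_coord]. A maximal minor thus makes the constant [d.+1]
    independent of the conditioning of [Hp]. *)
Lemma closeness N d (Hp Hq : 'M[C]_(N, d)) (f : {ffun 'I_d -> 'I_N}) (nu : R) :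
  0 <= nu ->
  \rank Hp = d -> \rank Hq = d ->
  (forall h : {ffun 'I_d -> 'I_N}, `|\det (rowsub h Hp)| <= `|\det (rowsub f Hp)|) ->
  rowsub f Hp \in unitmx ->
  chordal (orth_basis Hp) (orth_basis Hq) ^+ 2 * frob Hq ^+ 2 <= nu ^+ 2 ->
  forall r c, ComplexField.Normc.normc
    (Hq r c - (row r Hp *m invmx (rowsub f Hp) *m rowsub f Hq) 0 c) <= (d.+1)%:R * nu.
Proof.
move=> nu0 rp rq fmax uf Dnu r c.
have [Y /le_trans/(_ Dnu) YE] := residual_bound rp rq.
set F := Hq - Hp *m Y in YE.
have HqE : Hq = Hp *m Y + F by rewrite /F addrC subrK.
have Fnu i j : `|F i j| <= nu%:C by rewrite normc_normE lecR normc_le_frob.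
have -> : Hq r c - (row r Hp *m invmx (rowsub f Hp) *m rowsub f Hq) 0 c =
    F r c - (row r Hp *m invmx (rowsub f Hp) *m rowsub f F) 0 c.
  have -> : rowsub f Hq = rowsub f Hp *m Y + rowsub f F.
    rewrite mul_rowsub_mx {1}HqE; by apply/matrixP => i j; rewrite !mxE.
  rewrite mulmxDr mulmxA mulmxKV // [X in _ - X]mxE {1}HqE [X in X - _]mxE.
  by rewrite -row_mul [X in _ - (X + _)]mxE opprD addrACA subrr add0r.
rewrite -lecR -normc_normE; apply: le_trans (ler_normB _ _) _.
rewrite -[d.+1]addn1 natrD mulrDl mul1r [X in _ <= X%:C]addrC rmorphD /= lerD ?Fnu // mxE.
apply: le_trans (ler_norm_sum _ _ _) _.
apply: le_trans (_ : \sum_(i < d) nu%:C <= _).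
  apply: ler_sum => i _; rewrite normrM -[leRHS]mul1r; apply: ler_pM => //.
    exact: maxminor_coord.
  by rewrite mxE Fnu.
by rewrite sumr_const card_ord rmorphM /= (rmorph_nat (real_complex R)) mulr_natl.
Qed.

Lemma fro2_proj_le m n p (Q : 'M[C]_(m, n)) (F : 'M[C]_(m, p)) : Q^t* *m Q = 1%:M ->
  fro2 ((1%:M - Q *m Q^t*) *m F) <= fro2 F.
Proof.
move=> QQ; set P := Q *m Q^t*.
have PP : P *m P = P by rewrite /P mulmxA -(mulmxA Q) QQ mulmx1.
have hP : P^t* = P by rewrite /P trmxCM trmxCK.
clearbody P; have hB (X Y : 'M[C]_m) : (X - Y)^t* = X^t* - Y^t* by rewrite linearB map_mxB.
have -> : fro2 F = fro2 ((1%:M - P) *m F) + fro2 (P *m F).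
  rewrite !fro2_trE !trmxCM hB trmxC1 hP -!mulmxA.
  rewrite (mulmxA P) PP (mulmxA (1%:M - P)).
  have -> : (1%:M - P) *m (1%:M - P) = 1%:M - P.
    by rewrite mulmxBl mul1mx mulmxBr mulmx1 PP subrr subr0.
  by rewrite -linearD /= -mulmxDr -mulmxDl subrK mul1mx.
by rewrite lerDl fro2_ge0.
Qed.

Lemma rank_usub d (H : 'M[C]_(d + d, d)) : usubmx H \in unitmx -> \rank H = d.
Proof.
move=> u; apply/eqP; rewrite eqn_leq rank_leq_col /=.
have {1}<- : \rank (usubmx H) = d by rewrite mxrank_unit.
by apply: mxrankS; rewrite -[X in (_ <= X)%MS]vsubmxK -addsmxE addsmxSl.
Qed.

(* Column spaces in graph coordinates: H = [A; B] spans the graph of B A^-1. *)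
Lemma chordal_graph d (Hp Hq : 'M[C]_(d + d, d)) :
  usubmx Hp \in unitmx -> usubmx Hq \in unitmx ->
  chordal (orth_basis Hp) (orth_basis Hq) ^+ 2 <=
  d%:R * frob (dsubmx Hq *m invmx (usubmx Hq) - dsubmx Hp *m invmx (usubmx Hp)) ^+ 2.
Proof.
move=> up uq; have rp := rank_usub up; have rq := rank_usub uq.
have [Qp1 /andP[_ Qp2]] := orth_basisP rp; have [Qq1 /andP[Qq2 _]] := orth_basisP rq.
set Q := orth_basis Hp in Qp1 Qp2 *; set Q' := orth_basis Hq in Qq1 Qq2 *.
have [T TE] : exists T, Hp = Q *m T.
  by case/submxP: Qp2 => T /(congr1 trmx); rewrite trmx_mul !trmxK; exists T^T.
have [Y YE] : exists Y, Q' = Hq *m Y.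
  by case/submxP: Qq2 => Y /(congr1 trmx); rewrite trmx_mul !trmxK; exists Y^T.
set Wp := dsubmx Hp *m _; set Wq := dsubmx Hq *m _.
rewrite -lecR [X in _ <= X]rmorphM (rmorph_nat (real_complex R)) /= frob_sqr chordal_sqr //.
pose Z := usubmx Hq *m Y.
have HqE : Hq = col_mx 1%:M Wq *m usubmx Hq.
  by rewrite mul_col_mx mul1mx mulmxKV // vsubmxK.
have HpE : Hp = col_mx 1%:M Wp *m usubmx Hp.
  by rewrite mul_col_mx mul1mx mulmxKV // vsubmxK.
have Q'E : Q' = col_mx 1%:M Wq *m Z by rewrite YE {1}HqE -mulmxA.
have kerp : (1%:M - Q *m Q^t*) *m col_mx 1%:M Wp = 0.
  have -> : col_mx 1%:M Wp = Hp *m invmx (usubmx Hp) by rewrite {1}HpE mulmxK.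
  rewrite {1}TE mulmxBl mul1mx !mulmxA -(mulmxA Q _ Q) Qp1 mulmx1.
  by rewrite subrr.
have -> : (1%:M - Q *m Q^t*) *m Q' =
    (1%:M - Q *m Q^t*) *m (col_mx 0 (Wq - Wp) *m Z).
  rewrite Q'E mulmxA [RHS]mulmxA; congr (_ *m Z).
  rewrite -[LHS]subr0 -kerp -mulmxBr; congr (_ *m _).
  by rewrite opp_col_mx add_col_mx subrr.
apply: le_trans (fro2_proj_le _ Qp1) _; apply: le_trans (fro2M _ _) _.
have -> : fro2 (col_mx (0 : 'M[C]_d) (Wq - Wp)) = fro2 (Wq - Wp).
  rewrite /fro2 tr_col_mx map_row_mx mul_col_row mxtrace_block.
  by rewrite !mul0mx mxtrace0 add0r.
rewrite mulrC ler_wpM2r ?fro2_ge0 //.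
(* [Z] is the upper block of the orthonormal [Q'], so [fro2 Z] is at most [d]: this is the factor in
   the statement. *)
have <- : fro2 Q' = d%:R by rewrite -fro2_trC /fro2 trmxCK Qq1 mxtrace1.
rewrite Q'E mul_col_mx mul1mx [leRHS]/fro2 tr_col_mx map_row_mx mul_col_row.
by rewrite mxtrace_block lerDl fro2_ge0.
Qed.

Lemma rank_row_mx d (A B : 'M[C]_(d + d, d)) : \det (row_mx A B) != 0 ->
  \rank A = d /\ \rank B = d.
Proof.
move=> dn0; have u : row_mx A B \in unitmx by rewrite unitmxE unitfE.
have r : \rank (row_mx A B)^T = (d + d)%N by rewrite mxrank_tr mxrank_unit.
have := mxrank_adds_leqif A^T B^T.
have -> : \rank (A^T + B^T)%MS = (d + d)%N.
  by rewrite addsmxE -tr_row_mx r.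
case=> h _; rewrite !mxrank_tr in h.
have ha := rank_leq_col A; have hb := rank_leq_col B.
move: h ha hb; move: (\rank A) (\rank B) => a b h ha hb.
split; apply/eqP; rewrite eqn_leq ?ha ?hb /=.
  by rewrite -(leq_add2r d) (leq_trans h) // leq_add2l.
by rewrite -(leq_add2l d) (leq_trans h) // leq_add2r.
Qed.

Lemma exists_maxminor N d (A : 'M[C]_(N, d)) : \rank A = d ->
  exists2 f : {ffun 'I_d -> 'I_N}, rowsub f A \in unitmx &
  forall h : {ffun 'I_d -> 'I_N}, `|\det (rowsub h A)| <= `|\det (rowsub f A)|.
Proof.
move=> rA; have Af : row_full A by rewrite /row_full rA.
pose F (h : {ffun 'I_d -> 'I_N}) := ComplexField.Normc.normc (\det (rowsub h A)).
have [f _ fmax] := Order.TotalTheory.arg_maxP F (erefl : xpredT (fullrankfun Af)).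
have fmax' (h : {ffun 'I_d -> 'I_N}) : `|\det (rowsub h A)| <= `|\det (rowsub f A)|.
  by rewrite !normc_normE lecR; exact: fmax h isT.
exists f => //; rewrite unitmxE unitfE -normr_gt0.
apply: lt_le_trans (fmax' (fullrankfun Af)).
by rewrite normr_gt0 -unitfE -unitmxE fullrowsub_unit.
Qed.

End Channel.

(** * Sigma-algebras generated by coordinates *)

Section Cylinders.
Variables (R : realType) (J : eqType).

(** Events are sets of coordinate functions instead of subsets of the sample space, so that the
    generated sigma-algebra [csig s] records on which coordinates an event depends. Independence can
    then be read off from disjoint index sets. *)
Definition cyl (s : set J) : set (set (J -> R)) :=
  [set E | exists (l : seq J) (B : J -> set R),
    [/\ forall a, a \in l -> s a, forall a, measurable (B a) &
        E = [set w | forall a, a \in l -> B a (w a)]]].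

Lemma cyl_setI s : setI_closed (cyl s).
Proof.
move=> E1 E2 [l1 [B1 [s1 m1 ->]]] [l2 [B2 [s2 m2 ->]]].
exists (l1 ++ l2), (fun a => (if a \in l1 then B1 a else setT) `&`
  (if a \in l2 then B2 a else setT)); split.
- by move=> a; rewrite mem_cat => /orP[/s1|/s2].
- by move=> a; apply: measurableI; case: ifP.
- apply/seteqP; split=> w /=.
    by move=> [w1 w2] a _; split; case: ifP => // al; apply: w1 || apply: w2.
  move=> h; split=> a al.
    by have := h a; rewrite mem_cat al => /(_ isT)[].
  by have := h a; rewrite mem_cat al orbT => /(_ isT)[].
Qed.

Lemma sub_cyl (s s' : set J) : s `<=` s' -> cyl s `<=` cyl s'.
Proof.
by move=> ss E [l [B [ls mB ->]]]; exists l, B; split=> // a /ls /ss.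
Qed.

Definition csig (s : set J) : set (set (J -> R)) := <<s cyl s >>.

Lemma sub_csig (s s' : set J) : s `<=` s' -> csig s `<=` csig s'.
Proof. move=> ss; apply: smallest_sub; first exact: smallest_sigma_algebra.
by apply: subset_trans (sub_cyl ss) _; exact: sub_sigma_algebra. Qed.

Notation cT s := (g_sigma_algebraType (cyl s)).

Definition cmeas (s : set J) (f : (J -> R) -> R) : Prop :=
  @measurable_fun _ _ (cT s) R setT f.

Lemma csigT s : csig s setT.
Proof. exact: (@measurableT _ (cT s)). Qed.

Lemma csig0 s : csig s set0.
Proof. exact: (@measurable0 _ (cT s)). Qed.

Lemma csigC s E : csig s E -> csig s (~` E).
Proof. exact: (@measurableC _ (cT s)). Qed.

Lemma csigI s E F : csig s E -> csig s F -> csig s (E `&` F).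
Proof. exact: (@measurableI _ (cT s)). Qed.

Lemma csigU s E F : csig s E -> csig s F -> csig s (E `|` F).
Proof. exact: (@measurableU _ (cT s)). Qed.

Lemma csig_bigcup s (F : nat -> set (J -> R)) : (forall n, csig s (F n)) ->
  csig s (\bigcup_n F n).
Proof. move=> h; exact: (@bigcupT_measurable _ (cT s) _ h). Qed.

Lemma csig_bigsetU s (K : Type) (r : seq K) (P : pred K) F : (forall k, csig s (F k)) ->
  csig s (\big[setU/set0]_(k <- r | P k) F k).
Proof.
move=> h; elim/big_ind : _ => //; [exact: csig0|by move=> A B; exact: csigU].
Qed.

Lemma csig_all s (K : eqType) (r : seq K) (P : K -> (J -> R) -> Prop) :
  (forall a, csig s [set w | P a w]) ->
  csig s [set w | forall a, a \in r -> P a w].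
Proof.
move=> h; elim: r => [|a r IH].
  by have := @csigT s; congr csig; apply/seteqP; split.
have := csigI (h a) IH; congr csig; apply/seteqP; split=> w /=.
  by move=> [wa wr] b; rewrite inE => /orP[/eqP ->|/wr].
by move=> wr; split=> [|b br]; apply: wr; rewrite inE ?eqxx // br orbT.
Qed.

Lemma cmeas_preimage s f (B : set R) : cmeas s f -> measurable B ->
  csig s [set w | B (f w)].
Proof. by move=> mf mB; have := mf measurableT B mB; rewrite setTI. Qed.

Lemma cmeas_coord (s : set J) a : s a -> cmeas s (fun w => w a).
Proof.
move=> sa _ B mB; rewrite setTI; apply: sub_sigma_algebra.
exists [:: a], (fun=> B); split=> //.
  by move=> b; rewrite inE => /eqP ->.
apply/seteqP; split=> w /=; first by move=> wB b; rewrite inE => /eqP ->.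
by apply; rewrite inE.
Qed.

Lemma sub_cmeas (s s' : set J) f : s `<=` s' -> cmeas s f -> cmeas s' f.
Proof. by move=> ss mf _ B mB; apply: (sub_csig ss); exact: mf. Qed.

Lemma cmeas_cst s c : cmeas s (fun=> c).
Proof. exact: measurable_cst. Qed.

Lemma cmeasD s f g : cmeas s f -> cmeas s g -> cmeas s (fun w => f w + g w).
Proof. exact: measurable_funD. Qed.

Lemma cmeasB s f g : cmeas s f -> cmeas s g -> cmeas s (fun w => f w - g w).
Proof. exact: measurable_funB. Qed.

Lemma cmeasM s f g : cmeas s f -> cmeas s g -> cmeas s (fun w => f w * g w).
Proof. exact: measurable_funM. Qed.

Lemma cmeasN s f : cmeas s f -> cmeas s (fun w => - f w).
Proof. by move=> mf; apply: measurableT_comp. Qed.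

(* The library has no measurability lemma for inversion; x^-1 = x (x^2)^-1
   reduces it to a real power of a nonnegative number. *)
Lemma cmeasV s f : cmeas s f -> cmeas s (fun w => (f w)^-1).
Proof.
move=> mf; have -> : (fun w => (f w)^-1) = (fun w => f w * powR (f w ^+ 2) (-1)).
  apply/funext => w; rewrite powR_inv1 ?sqr_ge0 //.
  have [->|f0] := eqVneq (f w) 0; first by rewrite invr0 mul0r.
  by rewrite expr2 invfM mulrA mulfV // mul1r.
apply: cmeasM => //.
have mg : cmeas s (fun w => f w ^+ 2) := measurable_funX 2 mf.
exact: (measurableT_comp (measurable_powR (-1)) mg).
Qed.

End Cylinders.

Lemma csig_lift (R : realType) (J I : eqType) (io : J -> I) (s : set I) (E : set (J -> R)) :
  range io `<=` s -> csig setT E -> csig s [set w : I -> R | E (fun x => w (io x))].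
Proof.
move=> rs; pose f (w : I -> R) x := w (io x).
have : forall E : set (J -> R), csig setT E -> csig s (f @^-1` E).
  apply: smallest_sub; first split.
  - by rewrite /= preimage_set0; exact: csig0.
  - by move=> A /= mA; rewrite setTD preimage_setC; exact: csigC.
  - by move=> F mF /=; rewrite preimage_bigcup; exact: csig_bigcup.
  move=> _ [l [B [_ mB ->]]]; rewrite /f /preimage /=.
  apply: (@csig_all R I s J l (fun a w => B a (w (io a)))) => a.
  have m : cmeas s (fun w : I -> R => w (io a)) by apply: cmeas_coord; apply: rs; exists a.
  exact: (cmeas_preimage m (mB a)).
exact.
Qed.

(** * Independence and equality of laws for events on coordinates *)

Section Pull.
Variables (R : realType) (dT : measure_display) (T : measurableType dT).
Variables (Pr : probability T R) (I : eqType) (X : I -> T -> R).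
Hypothesis indX : mutually_independent Pr X.

Definition pull (J : Type) (io : J -> I) (E : set (J -> R)) : set T :=
  [set t | E (fun j => X (io j) t)].

Lemma measurable_pull (J : eqType) (io : J -> I) s (E : set (J -> R)) : csig s E ->
  measurable (pull io E).
Proof.
have [mX _] := indX; pose f t j := X (io j) t.
have : forall E, csig s E -> measurable (f @^-1` E).
  apply: smallest_sub; first split.
  - by rewrite /= preimage_set0; exact: measurable0.
  - by move=> A /= mA; rewrite setTD preimage_setC; exact: measurableC.
  - by move=> F mF /=; rewrite preimage_bigcup; exact: bigcupT_measurable.
  move=> _ [l [B [ls mB ->]]] /=.
  have -> : f @^-1` [set w | forall a, a \in l -> B a (w a)] =
      \big[setI/setT]_(a <- l) (X (io a) @^-1` B a).
    elim: l {ls} => [|a l IH]; first by rewrite big_nil; apply/seteqP; split.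
    rewrite big_cons -IH; apply/seteqP; split=> t /=.
      by move=> h; split=> [|b bl]; apply: h; rewrite inE ?eqxx // bl orbT.
    by move=> [ta tl] b; rewrite inE => /orP[/eqP ->|/tl].
  elim/big_ind : _ => //; first exact: measurableI.
  by move=> a _; rewrite -[X in measurable X]setTI; exact: mX.
exact.
Qed.

Lemma Pr_pull_cyl (J : eqType) (io : J -> I) (l : seq J) (B : J -> set R) :
  injective io -> uniq l -> (forall a, measurable (B a)) ->
  Pr (pull io [set w | forall a, a \in l -> B a (w a)]) =
  (\prod_(a <- l) fine (Pr (X (io a) @^-1` B a)))%:E.
Proof.
move=> injio ul mB; have [mX iX] := indX.
(* The quantifier transports [B] along the injection [io] and gives the whole line outside its
   range. *)
pose B' b : set R := [set x | forall a, io a = b -> B a x].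
have B'E a : B' (io a) = B a.
  by apply/seteqP; split=> x /=; [exact|move=> xB a' /injio ->].
have mB' b : measurable (B' b).
  have [[a <-]|nb] := pselect (exists a, io a = b); first by rewrite B'E.
  have -> : B' b = setT by apply/seteqP; split=> // x _ a ab; case: nb; exists a.
  exact: measurableT.
have := iX (map io l) B'; rewrite map_inj_uniq // => /(_ ul mB').
rewrite big_map; under eq_bigr do rewrite B'E.
move=> <-; congr (Pr _); apply/seteqP; split=> t /= h a.
  by move=> /mapP[b bl ->]; rewrite B'E; exact: h.
by move=> al; have := h (io a); rewrite B'E; apply; exact: map_f.
Qed.

Lemma cyl_uniq (J : eqType) (s : set J) E : @cyl R J s E ->
  exists (l : seq J) (B : J -> set R),
    [/\ uniq l, forall a, a \in l -> s a, forall a, measurable (B a) &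
        E = [set w | forall a, a \in l -> B a (w a)]].
Proof.
move=> [l [B [ls mB ->]]]; exists (undup l), B; split=> //.
- exact: undup_uniq.
- by move=> a; rewrite mem_undup; exact: ls.
- by apply/seteqP; split=> w /= h a; have := h a; rewrite mem_undup.
Qed.

Lemma Pr_bigcup (F : nat -> set T) : (forall n, measurable (F n)) ->
  trivIset setT F -> Pr (\bigcup_n F n) = (\sum_(0 <= n <oo) Pr (F n))%E.
Proof.
move=> mF tF; rewrite measure_bigcup //.
by apply: eq_eseriesl => n; rewrite in_setT.
Qed.

(** Dynkin's pi-lambda theorem; cylinders are stable under intersection. *)
Lemma csig_ind (J : eqType) (s : set J) (P : set (J -> R) -> Prop) :
  P setT -> (forall E, cyl s E -> P E) ->
  (forall E, csig s E -> P E -> P (~` E)) ->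
  (forall F : nat -> set (J -> R), (forall n, csig s (F n)) -> trivIset setT F ->
    (forall n, P (F n)) -> P (\bigcup_n F n)) ->
  forall E, csig s E -> P E.
Proof.
move=> PT Pc PC PU E sE.
exact: (@dynkin_induction _ (g_sigma_algebraType (cyl s)) (cyl s) P erefl (@cyl_setI R J s)
  PT Pc PC PU E sE).
Qed.

(** For fixed [A] the events satisfying the product formula form a Dynkin system. [indep_csig] uses
    this once for each of the two factors. *)
Lemma indep_aux (A : set T) (s : set I) : measurable A ->
  (forall E, cyl s E -> Pr (A `&` pull id E) = (Pr A * Pr (pull id E))%E) ->
  forall E, csig s E -> Pr (A `&` pull id E) = (Pr A * Pr (pull id E))%E.
Proof.
move=> mA cE; apply: csig_ind => //.
- by rewrite /pull /= setIT probability_setT mule1.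
- move=> E sE PE; have mE := measurable_pull id sE.
  have -> : A `&` pull id (~` E) = A `\` pull id E by [].
  rewrite measureD //; last by rewrite ltey_eq fin_num_measure.
  rewrite [X in (_ - X)%E](_ : _ = (Pr A * Pr (pull id E))%E); last exact: PE.
  rewrite -[pull id (~` E)]/(~` pull id E) probability_setC //.
  by rewrite muleBr ?mule1 ?fin_num_measure // fin_num_adde_defl.
- move=> F sF tF PF; have mF n := measurable_pull id (sF n).
  have tF' : trivIset setT (fun n => pull id (F n)).
    by move=> i j _ _ [t [Fi Fj]]; apply: tF => //; exists (fun a => X a t).
  have -> : pull id (\bigcup_n F n) = \bigcup_n pull id (F n) by [].
  rewrite setI_bigcupr !Pr_bigcup //; last 2 first.
  + by move=> n; exact: measurableI.
  + by apply: trivIset_setIl.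
  rewrite -[Pr A]fineK ?fin_num_measure // -nneseriesZl //.
  by apply: eq_eseriesr => n _; rewrite PF fineK ?fin_num_measure.
Qed.

Lemma indep_csig (s1 s2 : set I) E1 E2 : s1 `&` s2 `<=` set0 ->
  csig s1 E1 -> csig s2 E2 ->
  Pr (pull id (E1 `&` E2)) = (Pr (pull id E1) * Pr (pull id E2))%E.
Proof.
move=> s12 sE1 sE2; rewrite -[pull id (E1 `&` E2)]/(pull id E1 `&` pull id E2).
apply: (indep_aux _ _ sE2); first exact: measurable_pull sE1.
move=> {E2 sE2} E2 cE2; rewrite setIC muleC.
have mE2 : measurable (pull id E2) by apply: measurable_pull; apply: sub_sigma_algebra cE2.
apply: (indep_aux mE2 _ sE1) => {E1 sE1} E1 cE1.
have [l1 [B1 [u1 ls1 mB1 E1E]]] := cyl_uniq cE1.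
have [l2 [B2 [u2 ls2 mB2 E2E]]] := cyl_uniq cE2.
pose B a := if a \in l1 then B1 a else B2 a.
have d12 a : a \in l2 -> a \in l1 = false.
  by move=> al2; apply/negP => al1; apply: (s12 a); split; [exact: ls1|exact: ls2].
have -> : pull id E2 `&` pull id E1 = pull id [set w | forall a, a \in l1 ++ l2 -> B a (w a)].
  rewrite E1E E2E; apply/seteqP; split=> t /=.
    move=> [t2 t1] a; rewrite mem_cat /B; case: ifP => [al1 _|_ /= al2]; first exact: t1.
    exact: t2.
  move=> h; split=> a al.
    by have := h a; rewrite mem_cat al orbT /B d12 //; apply.
  by have := h a; rewrite mem_cat al /B al; apply.
rewrite Pr_pull_cyl //; last 2 first.
- rewrite cat_uniq u1 u2 andbT /=; apply/hasPn => a /d12 /negbT //.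
- by move=> a; rewrite /B; case: ifP.
rewrite E1E E2E !Pr_pull_cyl // -EFinM mulrC big_cat /=; congr (_ * _)%:E.
  by rewrite big_seq [in RHS]big_seq; apply: eq_bigr => a al; rewrite /B al.
by rewrite big_seq [in RHS]big_seq; apply: eq_bigr => a al; rewrite /B d12.
Qed.

Hypothesis sameX : forall a b (B : set R), measurable B ->
  Pr (X a @^-1` B) = Pr (X b @^-1` B).

(** On cylinders both sides are products of the same marginals. This compares the channel matrices
    of different users and transmitters. *)
Lemma same_law (J : eqType) (io io' : J -> I) E : injective io -> injective io' ->
  csig setT E -> Pr (pull io E) = Pr (pull io' E).
Proof.
move=> inj inj'; apply: (csig_ind (P := fun E => Pr (pull io E) = Pr (pull io' E))) => {E}.
- by [].
- move=> E /cyl_uniq[l [B [ul _ mB ->]]]; rewrite !Pr_pull_cyl //.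
  by congr (_%:E); apply: eq_bigr => a _; rewrite (sameX _ (io' a)).
- move=> E sE PE; rewrite -![pull _ (~` E)]/(~` pull _ E).
  by rewrite !probability_setC ?PE //; apply: measurable_pull sE.
- move=> F sF tF PF.
  have tF' k : trivIset setT (fun n => pull k (F n)).
    by move=> i j _ _ [t [Fi Fj]]; apply: tF => //; exists (fun a => X (k a) t).
  rewrite -![pull _ (\bigcup_n F n)]/(\bigcup_n pull _ (F n)) !Pr_bigcup //;
    try by move=> n; apply: measurable_pull (sF n).
  by apply: eq_eseriesr => n _; rewrite PF.
Qed.

End Pull.

Section Prob.
Variables (R : realType) (dT : measure_display) (T : measurableType dT).
Variables (Pr : probability T R) (I : eqType) (X : I -> T -> R).
Hypothesis indX : mutually_independent Pr X.

Definition pr (E : set (I -> R)) : R := fine (Pr (pull X id E)).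

Lemma PrE s E : csig s E -> Pr (pull X id E) = (pr E)%:E.
Proof.
by move=> sE; rewrite fineK // fin_num_measure //; apply: (measurable_pull indX _ sE).
Qed.

Lemma pr_ge0 E : 0 <= pr E.
Proof. by rewrite fine_ge0. Qed.

Lemma pr_le s E F : csig s E -> csig s F -> E `<=` F -> pr E <= pr F.
Proof.
move=> sE sF EF; rewrite -lee_fin -(PrE sE) -(PrE sF).
apply: le_measure; rewrite ?inE; [exact: (measurable_pull indX _ sE)|exact: (measurable_pull indX _ sF)|].
by move=> t; exact: EF.
Qed.

Lemma pr_setT : pr setT = 1.
Proof.
apply: EFin_inj; rewrite -(PrE (@csigT R I setT)).
by rewrite -[pull X id setT]/(@setT T) probability_setT.
Qed.

Lemma pr_set0 : pr set0 = 0.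
Proof. by rewrite /pr -[pull X id set0]/(@set0 T) measure0. Qed.

Lemma pr_setC s E : csig s E -> pr (~` E) = 1 - pr E.
Proof.
move=> sE; apply: EFin_inj; rewrite -(PrE (csigC sE)) -[pull X id _]/(~` pull X id E).
by rewrite probability_setC ?(PrE sE) //; exact: (measurable_pull indX _ sE).
Qed.

Lemma pr_le1 s E : csig s E -> pr E <= 1.
Proof. by move=> sE; rewrite -pr_setT; apply: (pr_le sE (@csigT R I s)). Qed.

Lemma pr_setU s E F : csig s E -> csig s F -> pr (E `|` F) <= pr E + pr F.
Proof.
move=> sE sF; rewrite -lee_fin EFinD -(PrE sE) -(PrE sF) -(PrE (csigU sE sF)).
by apply: measureU2; [exact: (measurable_pull indX _ sE)|exact: (measurable_pull indX _ sF)].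
Qed.

Lemma pr_bigsetU s (K : Type) (r : seq K) (P : pred K) F : (forall k, csig s (F k)) ->
  pr (\big[setU/set0]_(k <- r | P k) F k) <= \sum_(k <- r | P k) pr (F k).
Proof.
move=> sF; elim: r => [|k r IH]; first by rewrite !big_nil pr_set0.
rewrite !big_cons; case: ifP => // _; apply: le_trans (_ : _ <= pr (F k) + _) _.
  by apply: pr_setU => //; exact: csig_bigsetU.
by rewrite lerD2l.
Qed.

Lemma pr_setU_disj s E F : csig s E -> csig s F -> E `&` F `<=` set0 ->
  pr (E `|` F) = pr E + pr F.
Proof.
move=> sE sF EF; apply: EFin_inj.
rewrite EFinD -(PrE sE) -(PrE sF) -(PrE (csigU sE sF)).
rewrite -[pull X id _]/(pull X id E `|` pull X id F) measureU //.
- exact: (measurable_pull indX _ sE).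
- exact: (measurable_pull indX _ sF).
- by apply/seteqP; split=> // t [tE tF]; apply: (EF (fun a => X a t)).
Qed.

Lemma pr_bigsetU_disj s (K : choiceType) (r : seq K) (F : K -> set (I -> R)) : uniq r ->
  (forall k, csig s (F k)) -> (forall k k' w, F k w -> F k' w -> k = k') ->
  pr (\big[setU/set0]_(k <- r) F k) = \sum_(k <- r) pr (F k).
Proof.
move=> ur sF dF; elim: r ur => [|k r IH]; first by rewrite !big_nil pr_set0.
rewrite /= !big_cons => /andP[kr ur]; rewrite -IH //.
apply: (@pr_setU_disj s) => //; first exact: csig_bigsetU.
move=> w [wk]; rewrite -bigcup_seq => -[k' /= k'r wk'].
by move: kr; rewrite (dF _ _ _ wk wk') k'r.
Qed.

Lemma pr_bigcup0 s (F : nat -> set (I -> R)) : (forall n, csig s (F n)) ->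
  (forall n, pr (F n) = 0) -> pr (\bigcup_n F n) = 0.
Proof.
move=> sF F0; apply/eqP; rewrite eq_le pr_ge0 andbT -lee_fin.
rewrite -(PrE (csig_bigcup sF)) -[pull X id _]/(\bigcup_n pull X id (F n)).
have mF n := measurable_pull indX id (sF n).
apply: le_trans (measure_sigma_subadditive _ mF (bigcupT_measurable _ mF) _) _ => //.
by rewrite eseries0 // => n _ _; rewrite [LHS](PrE (sF n)) F0.
Qed.

Lemma pr_indep s1 s2 E F : s1 `&` s2 `<=` set0 -> csig s1 E -> csig s2 F ->
  pr (E `&` F) = pr E * pr F.
Proof.
move=> s12 sE sF; apply: EFin_inj.
have sE' := sub_csig (@subsetT _ s1) sE; have sF' := sub_csig (@subsetT _ s2) sF.
by rewrite EFinM -(PrE sE) -(PrE sF) -(PrE (csigI sE' sF')); exact: (indep_csig indX s12 sE sF).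
Qed.

Lemma pr_partition s E (F : nat -> set (I -> R)) : csig s E ->
  (forall n, csig s (F n)) -> trivIset setT F -> \bigcup_n F n = setT ->
  ((pr E)%:E = \sum_(0 <= n <oo) (pr (E `&` F n))%:E)%E.
Proof.
move=> sE sF tF UF; have sEF n := csigI sE (sF n).
rewrite -(PrE sE) -[E in LHS]setIT -UF setI_bigcupr.
rewrite -[pull X id _]/(\bigcup_n pull X id (E `&` F n)) Pr_bigcup.
- by apply: eq_eseriesr => n _; rewrite (PrE (sEF n)).
- by move=> n; exact: (measurable_pull indX _ (sEF n)).
- move=> i j _ _ [t [[_ Fi] [_ Fj]]]; apply: tF => //.
  by exists (fun a => X a t).
Qed.

Hypothesis densX : forall a (u v : R), u <= v ->
  (Pr (X a @^-1` `[u, v]%classic) <= (v - u)%:E)%E.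

Lemma csig_near s a (phi : (I -> R) -> R) (eta : R) : cmeas s phi ->
  csig (s `|` [set a]) [set w | `|w a - phi w| <= eta].
Proof.
move=> mphi; have m1 : cmeas (s `|` [set a]) (fun w => w a - phi w).
  apply: cmeasB; first by apply: cmeas_coord; right.
  by apply: sub_cmeas mphi; left.
have mB : measurable [set x : R | `|x| <= eta].
  have -> : [set x : R | `|x| <= eta] = `[- eta, eta]%classic.
    by apply/seteqP; split=> x; rewrite /= in_itv /= ler_norml.
  exact: measurable_itv.
exact: (cmeas_preimage m1 mB).
Qed.

(* Discretizing [phi] on the cells [z eta, (z+1) eta) decouples the coordinate
   [a] from [phi] and [E] without any product measure. *)
Lemma peel s a (phi : (I -> R) -> R) (eta : R) E : ~ s a -> cmeas s phi ->
  csig s E -> 0 < eta ->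
  pr ([set w | `|w a - phi w| <= eta] `&` E) <= 3%:R * eta * pr E.
Proof.
move=> sa mphi sE eta0.
pose z w : int := Num.floor (phi w / eta).
pose F n := [set w | pickle (z w) = n].
(* The integers are enumerated by [pickle]; if [n] is not a code, [A n] is everything and [F n] is
   empty. Otherwise [A n] confines [w a] to the cell of [phi w] enlarged by [eta] on both sides. Its
   length [3 * eta], with [densX], is the origin of the constant 3. *)
pose A n := [set w : I -> R | forall k : int, pickle k = n ->
  `[(k%:~R - 1) * eta, (k%:~R + 2) * eta]%classic (w a)].
have sF n : csig s (F n).
  have [[k <-]|nk] := pselect (exists k : int, pickle k = n); last first.
    have -> : F n = set0 by apply/seteqP; split=> // w wF; apply: nk; exists (z w).
    exact: csig0.
  have -> : F (pickle k) = [set w | `[k%:~R * eta, (k%:~R + 1) * eta[%classic (phi w)].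
    apply/seteqP; split=> w; rewrite /F /z /= in_itv /=.
      move=> /(pcan_inj pickleK) <-.
      rewrite -ler_pdivlMr // -ltr_pdivrMr //.
      by rewrite floor_le //= -[1]/(1%:~R) -intrD floorD1_gt.
    rewrite -ler_pdivlMr // -ltr_pdivrMr // => h.
    by congr pickle; apply: floor_def; rewrite intrD.
  by apply: cmeas_preimage mphi _; exact: measurable_itv.
have tF : trivIset setT F by move=> i j _ _ [w [<- <-]].
have UF : \bigcup_n F n = setT by apply/seteqP; split=> // w _; exists (pickle (z w)).
have sA n : csig [set a] (A n).
  have [[k <-]|nk] := pselect (exists k : int, pickle k = n); last first.
    have -> : A n = setT by apply/seteqP; split=> // w _ k kn; case: nk; exists k.
    exact: csigT.
  have -> : A (pickle k) = [set w | `[(k%:~R - 1) * eta, (k%:~R + 2) * eta]%classic (w a)].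
    by apply/seteqP; split=> w /= h; [exact: h|move=> k' /(pcan_inj pickleK) ->].
  by apply: cmeas_preimage; [exact: cmeas_coord|exact: measurable_itv].
have s'F n : csig (s `|` [set a]) (F n) by apply: sub_csig (sF n); left.
have s'A n : csig (s `|` [set a]) (A n) by apply: sub_csig (sA n); right.
have s'E : csig (s `|` [set a]) E by apply: sub_csig sE; left.
have s'N : csig (s `|` [set a]) [set w | `|w a - phi w| <= eta] by exact: csig_near.
rewrite -lee_fin (pr_partition (csigI s'N s'E) s'F tF UF).
rewrite EFinM (pr_partition s'E s'F tF UF) -nneseriesZl; last first.
  by move=> n _; rewrite lee_fin pr_ge0.
apply: lee_nneseries => n _; first by rewrite lee_fin pr_ge0.
have [[k kn]|nk] := pselect (exists k : int, pickle k = n); last first.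
  have -> : F n = set0 by apply/seteqP; split=> // w wF; apply: nk; exists (z w).
  by rewrite !setI0 pr_set0 mule0.
rewrite -EFinM lee_fin.
apply: le_trans (_ : pr (A n `&` (E `&` F n)) <= _).
  have inc : [set w | `|w a - phi w| <= eta] `&` E `&` F n `<=` A n `&` (E `&` F n).
    move=> w [[/= wa Ew] Fw]; split; last by split.
    move=> k' k'n; rewrite /= in_itv /=.
    have zk : z w = k' by apply: (pcan_inj pickleK); rewrite Fw k'n.
    have := floor_le (phi w / eta); have := floorD1_gt (phi w / eta).
    rewrite -/(z w) zk intrD ler_pdivlMr // ltr_pdivrMr // => h1 h2.
    move: wa; rewrite ler_norml => /andP[h3 h4]; apply/andP; split.
      by rewrite mulrBl mul1r; lra.
    by move: h1; rewrite !mulrDl mul1r; lra.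
  exact: (@pr_le (s `|` [set a]) _ _ (csigI (csigI s'N s'E) (s'F n))
    (csigI (s'A n) (csigI s'E (s'F n))) inc).
rewrite (pr_indep _ (sA n) (csigI sE (sF n))); last by move=> b [/= -> ].
apply: ler_wpM2r; first exact: pr_ge0.
rewrite -lee_fin -(PrE (sA n)).
have -> : pull X id (A n) = X a @^-1` `[(k%:~R - 1) * eta, (k%:~R + 2) * eta]%classic.
  apply/seteqP; split=> t /= h; first exact: h.
  by move=> k'; rewrite -kn => /(pcan_inj pickleK) ->.
apply: le_trans (densX _ _) _; last by rewrite lee_fin; lra.
by rewrite ler_wpM2r ?ltW //; lra.
Qed.

End Prob.

(** * Small balls *)

Section ComplexMeasurable.
Variables (R : realType) (I : eqType) (s : set I).
Local Notation C := R[i].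
Implicit Types f g : (I -> R) -> C.

Definition ccmeas f : Prop :=
  cmeas s (fun w => complex.Re (f w)) /\ cmeas s (fun w => complex.Im (f w)).

Lemma ccmeas_cst c : ccmeas (fun=> c).
Proof. by split; exact: cmeas_cst. Qed.

Lemma ccmeas_ext f g : f =1 g -> ccmeas f -> ccmeas g.
Proof. by move=> /funext ->. Qed.

Lemma ccmeasD f g : ccmeas f -> ccmeas g -> ccmeas (fun w => f w + g w).
Proof.
move=> [f1 f2] [g1 g2]; split.
  by have := cmeasD f1 g1; congr cmeas; apply/funext => w; case: (f w) (g w) => a b [].
by have := cmeasD f2 g2; congr cmeas; apply/funext => w; case: (f w) (g w) => a b [].
Qed.

Lemma ccmeasM f g : ccmeas f -> ccmeas g -> ccmeas (fun w => f w * g w).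
Proof.
move=> [f1 f2] [g1 g2]; split.
  have := cmeasB (cmeasM f1 g1) (cmeasM f2 g2).
  by congr cmeas; apply/funext => w; case: (f w) (g w) => a b [].
have := cmeasD (cmeasM f1 g2) (cmeasM f2 g1).
by congr cmeas; apply/funext => w; case: (f w) (g w) => a b [].
Qed.

Lemma ccmeasV f : ccmeas f -> ccmeas (fun w => (f w)^-1).
Proof.
move=> [f1 f2].
have m := cmeasV (cmeasD (cmeasM f1 f1) (cmeasM f2 f2)).
split.
  have := cmeasM f1 m; congr cmeas; apply/funext => w; case: (f w) => a b /=.
  by rewrite -!expr2.
have := cmeasN (cmeasM f2 m); congr cmeas; apply/funext => w; case: (f w) => a b /=.
by rewrite -!expr2 ?mulNr.
Qed.

Lemma ccmeas_sum (K : Type) (r : seq K) (P : pred K) (F : K -> (I -> R) -> C) :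
  (forall k, ccmeas (F k)) -> ccmeas (fun w => \sum_(k <- r | P k) F k w).
Proof.
move=> mF; elim: r => [|k r IH].
  by apply: ccmeas_ext (ccmeas_cst 0) => w; rewrite big_nil.
have [Pk|Pk] := boolP (P k).
  by apply: ccmeas_ext (ccmeasD (mF k) IH) => w; rewrite big_cons Pk.
by apply: ccmeas_ext IH => w; rewrite big_cons (negbTE Pk).
Qed.

Lemma ccmeas_prod (K : Type) (r : seq K) (P : pred K) (F : K -> (I -> R) -> C) :
  (forall k, ccmeas (F k)) -> ccmeas (fun w => \prod_(k <- r | P k) F k w).
Proof.
move=> mF; elim: r => [|k r IH].
  by apply: ccmeas_ext (ccmeas_cst 1) => w; rewrite big_nil.
have [Pk|Pk] := boolP (P k).
  by apply: ccmeas_ext (ccmeasM (mF k) IH) => w; rewrite big_cons Pk.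
by apply: ccmeas_ext IH => w; rewrite big_cons (negbTE Pk).
Qed.

Definition mxmeas m n (A : (I -> R) -> 'M[C]_(m, n)) : Prop :=
  forall i j, ccmeas (fun w => A w i j).

Lemma mxmeas_det n (A : (I -> R) -> 'M[C]_n) : mxmeas A -> ccmeas (fun w => \det (A w)).
Proof.
move=> mA; apply: ccmeas_sum => p; apply: ccmeasM; first exact: ccmeas_cst.
by apply: ccmeas_prod => k; exact: mA.
Qed.

Lemma mxmeas_adj n (A : (I -> R) -> 'M[C]_n) : mxmeas A -> mxmeas (fun w => \adj (A w)).
Proof.
move=> mA i j; apply: (ccmeas_ext (f := fun w => (-1) ^+ (j + i) *
    \det (row' j (col' i (A w))))); first by move=> w; rewrite mxE.
apply: ccmeasM; first exact: ccmeas_cst.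
apply: mxmeas_det => a b; apply: ccmeas_ext (mA (lift j a) (lift i b)) => w.
by rewrite !mxE.
Qed.

Lemma mxmeasM m n p (A : (I -> R) -> 'M[C]_(m, n)) (B : (I -> R) -> 'M[C]_(n, p)) :
  mxmeas A -> mxmeas B -> mxmeas (fun w => A w *m B w).
Proof.
move=> mA mB i j; apply: (ccmeas_ext (f := fun w => \sum_k A w i k * B w k j)).
  by move=> w; rewrite mxE.
by apply: ccmeas_sum => k; exact: ccmeasM.
Qed.

(** Unlike [invmx], which returns a singular matrix unchanged, this is a single formula in the
    entries, so measurability needs no case distinction. On singular matrices it is 0. *)
Definition cramer n (A : 'M[C]_n) : 'M[C]_n := (\det A)^-1 *: \adj A.

Lemma cramerE n (A : 'M[C]_n) : A \in unitmx -> cramer A = invmx A.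
Proof. by move=> uA; rewrite /invmx uA. Qed.

Lemma mxmeas_cramer n (A : (I -> R) -> 'M[C]_n) : mxmeas A ->
  mxmeas (fun w => cramer (A w)).
Proof.
move=> mA i j; apply: (ccmeas_ext (f := fun w => (\det (A w))^-1 * (\adj (A w)) i j)).
  by move=> w; rewrite [RHS]mxE.
apply: ccmeasM; last exact: mxmeas_adj.
by apply: ccmeasV; exact: mxmeas_det.
Qed.

Lemma normc_sqrE (z : C) :
  ComplexField.Normc.normc z ^+ 2 = complex.Re z ^+ 2 + complex.Im z ^+ 2.
Proof. by case: z => a b; rewrite /= sqr_sqrtr // addr_ge0 ?sqr_ge0. Qed.

Lemma csig_normc_lt f (c : R) : ccmeas f ->
  csig s [set w | ComplexField.Normc.normc (f w) < c].
Proof.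
move=> [f1 f2]; have [c0|c0] := leP c 0.
  have -> : [set w | ComplexField.Normc.normc (f w) < c] = set0.
    apply/seteqP; split=> // w /= h; have := normc_ge0 (f w).
    by rewrite leNgt (lt_le_trans h c0).
  exact: csig0.
have := cmeas_preimage (cmeasD (cmeasM f1 f1) (cmeasM f2 f2))
  (measurable_itv `]-oo, (c ^+ 2)[).
congr csig; apply/seteqP; split=> w /=; rewrite in_itv /= -!expr2 -normc_sqrE.
  by rewrite ltr_pXn2r ?nnegrE ?normc_ge0 // ltW.
by rewrite ltr_pXn2r ?nnegrE ?normc_ge0 // ltW.
Qed.

Lemma csig_eq0 f : ccmeas f -> csig s [set w | f w = 0].
Proof.
move=> mf; have -> : [set w | f w = 0] =
    \bigcap_n [set w | ComplexField.Normc.normc (f w) < n.+1%:R^-1].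
  apply/seteqP; split=> w /= h.
    by move=> n _ /=; rewrite h ComplexField.Normc.normc0 invr_gt0.
  apply: ComplexField.Normc.eq0_normc; apply/eqP; rewrite eq_le normc_ge0 andbT leNgt.
  apply/negP => c0; have [n nc] := ltr_add_invr c0.
  have /= := h n Logic.I; rewrite add0r in nc; move=> /(lt_trans nc).
  by rewrite ltxx.
apply: (@bigcapT_measurable _ (g_sigma_algebraType (cyl s))) => n.
exact: csig_normc_lt.
Qed.

End ComplexMeasurable.

Lemma Re_le_normc (R : realType) (z : R[i]) : `|complex.Re z| <= ComplexField.Normc.normc z.
Proof.
rewrite -(@ler_pXn2r _ 2) ?nnegrE ?normc_ge0 // normc_sqrE.
by rewrite real_normK ?num_real // lerDl sqr_ge0.
Qed.

Lemma Im_le_normc (R : realType) (z : R[i]) : `|complex.Im z| <= ComplexField.Normc.normc z.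
Proof.
rewrite -(@ler_pXn2r _ 2) ?nnegrE ?normc_ge0 // normc_sqrE.
by rewrite real_normK ?num_real // lerDr sqr_ge0.
Qed.

Section SmallBall.
Variables (R : realType) (dT : measure_display) (T : measurableType dT).
Variables (Pr : probability T R) (I : eqType) (X : I -> T -> R).
Hypothesis indX : mutually_independent Pr X.
Hypothesis densX : forall a (u v : R), u <= v ->
  (Pr (X a @^-1` `[u, v]%classic) <= (v - u)%:E)%E.
Local Notation C := R[i].
Local Notation pr := (pr Pr X).
Local Notation normc := ComplexField.Normc.normc.

Definition cmx m n (re im : 'I_m -> 'I_n -> I) (w : I -> R) : 'M[C]_(m, n) :=
  \matrix_(i, j) Complex (w (re i j)) (w (im i j)).

Lemma mxmeas_cmx (s : set I) m n (re im : 'I_m -> 'I_n -> I) :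
  (forall i j, s (re i j)) -> (forall i j, s (im i j)) -> mxmeas s (cmx re im).
Proof.
move=> sre sim i j; apply: (ccmeas_ext (f := fun w => Complex (w (re i j)) (w (im i j)))).
  by move=> w; rewrite mxE.
by split; exact: cmeas_coord.
Qed.

(** Expansion along the first row makes the determinant affine in the real coordinate [a], with
    slope the minor [mi]. If the modulus of [mi] is at least [q = tau ^+ (2 ^ n)], a determinant
    below [q ^+ 2] confines [a] to within [q] of [phi], which costs [3 q <= 3 tau] by [peel];
    otherwise induction applies. Hence the exponent doubles with [n] and the costs add up to
    [3 * n]. *)
Lemma det_small_ball n (re im : 'I_n -> 'I_n -> I) (tau : R) :
  (forall i j i' j', re i j = re i' j' -> i = i' /\ j = j') ->
  (forall i j i' j', re i j <> im i' j') -> 0 < tau <= 1 ->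
  pr [set w | normc (\det (cmx re im w)) < tau ^+ (2 ^ n)] <= (3 * n)%:R * tau.
Proof.
move=> injre reim /andP[tau0 tau1]; elim: n re im injre reim => [|n IH] re im injre reim.
  rewrite muln0 mul0r expn0 expr1.
  have -> : [set w | normc (\det (cmx re im w)) < tau] = set0.
    apply/seteqP; split=> // w /=; rewrite det_mx00 ComplexField.Normc.normc1.
    by rewrite ltNge tau1.
  by rewrite pr_set0.
set a := re ord0 ord0; pose s := [set b | b <> a].
pose re' i j := re (lift ord0 i) (lift ord0 j).
pose im' i j := im (lift ord0 i) (lift ord0 j).
pose mi w := \det (cmx re' im' w).
pose rest w := Complex 0 (w (im ord0 ord0)) * mi w +
  \sum_(j < n) cmx re im w ord0 (lift ord0 j) * cofactor (cmx re im w) ord0 (lift ord0 j).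
have sre i j : (i, j) != (ord0, ord0) -> s (re i j).
  by move=> ij /= /injre [? ?]; case/eqP: ij; congr pair.
have sim i j : s (im i j) by move=> /= /esym /reim.
have mmi : ccmeas s mi.
  by apply: mxmeas_det; apply: mxmeas_cmx => i j; [exact: sre|exact: sim].
have mrest : ccmeas s rest.
  apply: ccmeasD.
    apply: ccmeasM => //; split; [exact: cmeas_cst|exact: cmeas_coord].
  apply: ccmeas_sum => j; apply: ccmeasM.
    apply: (ccmeas_ext (f := fun w => Complex (w (re ord0 (lift ord0 j))) (w (im ord0 (lift ord0 j))))).
      by move=> w; rewrite mxE.
    by split; apply: cmeas_coord; [exact: sre|exact: sim].
  apply: ccmeasM; first exact: ccmeas_cst.
  apply: mxmeas_det => i k.
  apply: (ccmeas_ext (f := fun w => Complex (w (re (lift ord0 i) (lift (lift ord0 j) k)))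
    (w (im (lift ord0 i) (lift (lift ord0 j) k))))); first by move=> w; rewrite !mxE.
  by split; apply: cmeas_coord; [exact: sre|exact: sim].
have detE w : \det (cmx re im w) = (w a)%:C%C * mi w + rest w.
  rewrite (expand_det_row _ ord0) big_ord_recl /rest addrA; congr (_ + _).
  rewrite -mulrDl mxE; congr (_ * _); first by apply/eqP; rewrite eq_complex /= addr0 add0r !eqxx.
  rewrite /cofactor addn0 expr0 mul1r; congr (\det _).
  by apply/matrixP => i j; rewrite !mxE.
pose phi w := - complex.Re (rest w / mi w).
have mphi : cmeas s phi by apply: cmeasN; have [] := ccmeasM mrest (ccmeasV mmi).
pose q : R := tau ^+ (2 ^ n).
have q0 : 0 < q by rewrite exprn_gt0.
have qtau : q <= tau.
  by rewrite /q -[leRHS]expr1 ler_wiXn2l // ?expn_gt0 // ltW.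
have inc : [set w | normc (\det (cmx re im w)) < tau ^+ (2 ^ n.+1)] `<=`
    [set w | normc (mi w) < q] `|` ([set w | `|w a - phi w| <= q] `&` setT).
  move=> w /= dw; have [mq|mq] := ltP (normc (mi w)) q; [by left|right; split=> //].
  have m0 : mi w != 0.
    by apply: contraTneq mq => ->; rewrite ComplexField.Normc.normc0 -ltNge.
  have -> : w a - phi w = complex.Re (\det (cmx re im w) / mi w).
    rewrite detE mulrDl mulfK // /phi opprK.
    by case: (rest w / mi w) => x y.
  apply: le_trans (Re_le_normc _) _.
  rewrite ComplexField.Normc.normcM ComplexField.Normc.normcV ler_pdivrMr ?(lt_le_trans q0) //.
  apply: ltW; apply: lt_le_trans dw _.
  by rewrite expnSr exprM expr2 ler_wpM2l // ltW.
have mT A B : A `<=` B -> @csig R I A `<=` csig B by exact: sub_csig.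
have c1 : csig setT [set w | normc (\det (cmx re im w)) < tau ^+ (2 ^ n.+1)].
  by apply: csig_normc_lt; apply: mxmeas_det; exact: mxmeas_cmx.
have c2 : csig setT [set w | normc (mi w) < q].
  by apply: (mT _ _ (@subsetT _ s)); exact: csig_normc_lt.
have c3 : csig setT ([set w | `|w a - phi w| <= q] `&` setT).
  apply: csigI; last exact: csigT.
  by apply: (mT _ _ (@subsetT _ (s `|` [set a]))); exact: csig_near.
apply: le_trans (@pr_le _ _ _ _ _ _ indX setT _ _ c1 (csigU c2 c3) inc) _.
apply: le_trans (pr_setU indX c2 c3) _.
have h1 := IH re' im' (fun i j i' j' h => _) (fun i j i' j' => reim _ _ _ _).
rewrite mulnS natrD mulrDl addrC; apply: lerD.
  have sa : ~ s a by apply.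
  apply: le_trans (peel indX densX sa mphi (@csigT R I s) q0) _.
    by rewrite (pr_setT indX) mulr1 ler_wpM2l.
apply: IH => [i j i' j' /injre [/lift_inj -> /lift_inj ->] //|i j i' j'].
exact: reim.
Qed.

Lemma pr_det_eq0 n (re im : 'I_n -> 'I_n -> I) :
  (forall i j i' j', re i j = re i' j' -> i = i' /\ j = j') ->
  (forall i j i' j', re i j <> im i' j') ->
  pr [set w | \det (cmx re im w) = 0] = 0.
Proof.
move=> injre reim; apply/eqP; rewrite eq_le pr_ge0 andbT; apply/ler_addgt0Pl => e e0.
rewrite addr0; pose N : R := (3 * n).+1%:R.
pose tau := Num.min 1 (e / N).
have tau0 : 0 < tau by rewrite lt_min ltr01 divr_gt0.
have tau1 : tau <= 1 by rewrite ge_min lexx.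
have md : ccmeas setT (fun w => \det (cmx re im w)).
  by apply: mxmeas_det; exact: mxmeas_cmx.
apply: le_trans (_ : pr [set w | normc (\det (cmx re im w)) < tau ^+ (2 ^ n)] <= _).
  have inc : [set w | \det (cmx re im w) = 0] `<=`
      [set w | normc (\det (cmx re im w)) < tau ^+ (2 ^ n)].
    by move=> w /= ->; rewrite ComplexField.Normc.normc0 exprn_gt0.
  exact: (@pr_le _ _ _ _ _ _ indX setT _ _ (csig_eq0 md) (csig_normc_lt _ md) inc).
apply: le_trans (det_small_ball injre reim _) _; first by rewrite tau0 tau1.
apply: le_trans (_ : N * tau <= _); first by rewrite ler_pM2r // ler_nat.
by rewrite mulrC -ler_pdivlMr // ge_min lexx orbT.
Qed.

Lemma peel_seq (s : set I) (l : seq I) (phi : I -> (I -> R) -> R) (eta : R) E :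
  uniq l -> (forall a, a \in l -> ~ s a) -> (forall a, cmeas s (phi a)) ->
  csig s E -> 0 < eta ->
  pr ([set w | forall a, a \in l -> `|w a - phi a w| <= eta] `&` E) <=
  (3%:R * eta) ^+ size l * pr E.
Proof.
move=> ul ls mphi sE eta0.
(* Measurability is carried through the induction: the event obtained so far depends on [s] and on
   the coordinates already treated, never on the next one, as [peel] requires. *)
suff [] : pr ([set w | forall a, a \in l -> `|w a - phi a w| <= eta] `&` E) <=
    (3%:R * eta) ^+ size l * pr E /\
    csig (s `|` [set` l]) ([set w | forall a, a \in l -> `|w a - phi a w| <= eta] `&` E).
  by [].
elim: l ul ls => [_ _|a l IH /= /andP[al ul] ls].
  rewrite expr0 mul1r; split.
    have -> : [set w : I -> R | forall a, a \in [::] -> `|w a - phi a w| <= eta] = setT.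
      by apply/seteqP; split.
    by rewrite setTI.
  apply: csigI; last by apply: sub_csig sE; left.
  have -> : [set w : I -> R | forall a, a \in [::] -> `|w a - phi a w| <= eta] = setT.
    by apply/seteqP; split.
  exact: csigT.
have [b bl|IH1 IH2] := IH ul; first by apply: ls; rewrite inE bl orbT.
have -> : [set w | forall b, b \in a :: l -> `|w b - phi b w| <= eta] `&` E =
    [set w | `|w a - phi a w| <= eta] `&`
    ([set w | forall b, b \in l -> `|w b - phi b w| <= eta] `&` E).
  rewrite setIA; congr (_ `&` _); apply/seteqP; split=> w /=.
    by move=> h; split=> [|b bl]; apply: h; rewrite inE ?eqxx // bl orbT.
  by move=> [h1 h2] b; rewrite inE => /orP[/eqP ->|/h2].
have na : ~ (s `|` [set` l]) a.
  by move=> [|/=]; [apply: ls; rewrite inE eqxx|rewrite (negbTE al)].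
have mphi' : cmeas (s `|` [set` l]) (phi a) by apply: sub_cmeas (mphi a); left.
split.
  apply: le_trans (peel indX densX na mphi' IH2 eta0) _.
  by rewrite /= exprS -(mulrA (3%:R * eta)) ler_wpM2l // mulr_ge0 // ltW.
apply: csigI.
  have := @csig_near R I s a (phi a) eta (mphi a).
  by apply: sub_csig => b [|/= ->]; [left|right; rewrite /= inE eqxx].
apply: sub_csig IH2 => b [|/= bl]; [by left|right].
by rewrite /= inE bl orbT.
Qed.

End SmallBall.

(** * Density and tail bounds for the Gaussian law of variance 1/2 *)

Section Normal.
Variable R : realType.
Local Notation sg := (Num.sqrt (2^-1 : R)).

Let sg0 : sg != 0.
Proof. by rewrite gt_eqF // sqrtr_gt0. Qed.

Let peakE : normal_peak sg = (Num.sqrt pi)^-1.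
Proof.
rewrite /normal_peak sqr_sqrtr //; congr (Num.sqrt _)^-1.
by rewrite mulr2n -mulrDl -mulr2n -[2^-1 *+ 2]mulr_natr mulVf ?mul1r.
Qed.

(** The density peaks at [(Num.sqrt pi)^-1], which is at most 1. *)
Lemma normal_prob_itv_le (u v : R) : u <= v ->
  (normal_prob 0 sg `[u, v]%classic <= (v - u)%:E)%E.
Proof.
move=> uv; rewrite /normal_prob.
apply: (@le_trans _ _ (\int[lebesgue_measure]_(x in `[u, v]) (1 : R)%:E)%E).
  apply: ge0_le_integral => //=.
  - by move=> x _; rewrite lee_fin normal_pdf_ge0.
  - by apply/measurable_EFinP/measurable_funTS; exact: measurable_normal_pdf.
  move=> x _; rewrite lee_fin; apply: le_trans (normal_pdf_ub 0 x sg0) _.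
  rewrite peakE invf_le1 ?sqrtr_gt0 ?pi_gt0 // -[leLHS]sqrtr1 ler_wsqrtr //.
  by apply: le_trans (pi_ge2 R); rewrite ler1n.
rewrite integral_cst //= lebesgue_measure_itv /= lte_fin mul1e.
by case: ifP => _; rewrite -?EFinD lee_fin ?subr_ge0.
Qed.

Lemma measurable_tail (y : R) : measurable [set x : R | y < `|x|].
Proof.
have -> : [set x : R | y < `|x|] = ~` `[- y, y]%classic.
  apply/seteqP; split=> x; rewrite /= in_itv /= -ler_norml; first by rewrite ltNge => /negP.
  by move=> /negP; rewrite -ltNge.
by apply: measurableC; exact: measurable_itv.
Qed.

(* For |x| > y the density is at most 2 exp(-y^2/2) times the one of variance 1. *)
Lemma normal_prob_tail (y : R) : 0 <= y ->
  (normal_prob 0 sg [set x : R | (y < `|x|)%R] <= (2 * expR (- (y ^+ 2 / 2)))%:E)%E.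
Proof.
move=> y0; rewrite /normal_prob.
have mD := measurable_tail y.
have m1 : measurable_fun [set: R] (normal_pdf 0 (1 : R)) := measurable_normal_pdf _ _.
pose c : R := 2 * expR (- (y ^+ 2 / 2)).
apply: (@le_trans _ _ (\int[lebesgue_measure]_(x in [set x : R | (y < `|x|)%R])
    (c%:E * (normal_pdf 0 1 x)%:E))%E).
  apply: ge0_le_integral => //=.
  - by move=> x _; rewrite lee_fin normal_pdf_ge0.
  - by apply/measurable_EFinP/measurable_funTS; exact: measurable_normal_pdf.
  - apply/measurable_EFinP/measurable_funTS.
    by apply: measurable_funM => //; exact: measurable_cst.
  move=> x xy; rewrite -EFinM lee_fin !normal_pdfE // ?oner_eq0 // peakE.
  rewrite /normal_fun subr0 /c sqr_sqrtr // -[2^-1 *+ 2]mulr_natr mulVf // divr1.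
  have -> : normal_peak (1 : R) = (Num.sqrt 2)^-1 * (Num.sqrt pi)^-1.
    rewrite /normal_peak expr1n mul1r -mulr_natl sqrtrM // invfM //.
  have h2 : 1 <= 2 * (Num.sqrt 2)^-1 :> R.
    rewrite ler_pdivlMr ?sqrtr_gt0 // mul1r -[leRHS]ger0_norm // -sqrtr_sqr ler_wsqrtr //.
    by rewrite expr2 ler_peMl // ler1n.
  rewrite mulrCA mulrA [X in _ <= X](_ : _ = (2 * (Num.sqrt 2)^-1) *
     ((Num.sqrt pi)^-1 * (expR (- (y ^+ 2 / 2)) * expR (- x ^+ 2 / (1 ^+ 2 *+ 2))))); last by ring.
  rewrite -expRD -[leLHS]mul1r; apply: ler_pM => //.
  rewrite ler_wpM2l ?invr_ge0 // ler_expR expr1n.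
  have : y ^+ 2 <= x ^+ 2 by rewrite -[x ^+ 2]real_normK ?num_real // ler_pXn2r ?nnegrE // ltW.
  by rewrite -[1 *+ 2]/(2 : R); lra.
apply: le_trans (_ : (c%:E * \int[lebesgue_measure]_x (normal_pdf 0 1 x)%:E <= _)%E).
  rewrite -ge0_integralZl_EFin //; last 3 first.
  - by move=> x _; rewrite lee_fin normal_pdf_ge0.
  - exact/measurable_EFinP.
  - by rewrite mulr_ge0 // expR_ge0.
  apply: ge0_subset_integral => //=.
  - apply/measurable_EFinP; apply: measurable_funM => //; exact: measurable_cst.
  - by move=> x _; rewrite -EFinM lee_fin !mulr_ge0 ?expR_ge0 ?normal_pdf_ge0.
by rewrite integral_normal_pdf mule1.
Qed.

End Normal.

(** * Events for one user *)

Lemma NRE d : (d + d)%N = NR d.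
Proof. by rewrite /NR mul2n addnn. Qed.

Lemma cellpqP (i : 'I_3) : [/\ cellp i != i, cellq i != i & cellp i != cellq i].
Proof.
by case: i => [[|[|[|]]]] // lt; split; apply/eqP => /(congr1 val) /=; rewrite !inordK.
Qed.

Section Halves.
Variables (R : realType) (d : nat).
Local Notation C := R[i].
Local Notation normc := ComplexField.Normc.normc.

(** The equality of dimensions is a variable, so that case analysis on it turns [up] into the
    identity ([up_id]). *)
Definition up N (e : (d + d)%N = N) n (A : 'M[C]_(N, n)) : 'M[C]_(d + d, n) :=
  rowsub (cast_ord e) A.

Lemma up_id n (A : 'M[C]_(d + d, n)) : up erefl A = A.
Proof. by apply/matrixP => a b; rewrite mxE cast_ord_id. Qed.

Lemma rateN_up_ge0 N (e : (d + d)%N = N) (P : R) (Hp Hq H : 'M[C]_(N, d)) :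
  (0 < d)%N -> 0 < P -> 0 <= rateN P Hp Hq H.
Proof. by case: N / e Hp Hq H => Hp Hq H d0 P0; exact: rateN_ge0. Qed.

Lemma rateN_up_ge N (e : (d + d)%N = N) (P c T dt : R) (Hp Hq H : 'M[C]_(N, d)) :
  (0 < d)%N -> 0 < P -> 0 < dt -> \rank Hp = d -> \rank Hq = d ->
  chordal (orth_basis Hp) (orth_basis Hq) ^+ 2 * frob Hq ^+ 2 <= c ->
  frob Hp ^+ 2 + frob Hq ^+ 2 + frob H ^+ 2 <= T ->
  dt <= normc (\det (row_mx (up e Hp) (up e H))) ^+ 2 ->
  (log2 ((P / d%:R) ^+ (d + d) * dt) -
    log2 (((1 + P / d%:R * T) * (1 + P / d%:R * c)) ^+ d)) <= rateN P Hp Hq H.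
Proof.
case: N / e Hp Hq H => Hp Hq H d0 P0 dt0 rp rq Dc HT; rewrite !up_id => Hdt.
exact: rateN_ge.
Qed.

Lemma rank_up N (e : (d + d)%N = N) (A B : 'M[C]_(N, d)) :
  \det (row_mx (up e A) (up e B)) != 0 -> \rank A = d.
Proof. by case: N / e A B => A B; rewrite !up_id => /rank_row_mx[]. Qed.

Definition graph (A : 'M[C]_(d + d, d)) : 'M[C]_d := dsubmx A *m cramer (usubmx A).

Lemma chordal_up N (e : (d + d)%N = N) (Hp Hq : 'M[C]_(N, d)) :
  \det (usubmx (up e Hp)) != 0 -> \det (usubmx (up e Hq)) != 0 ->
  chordal (orth_basis Hp) (orth_basis Hq) ^+ 2 <=
  d%:R * frob (graph (up e Hq) - graph (up e Hp)) ^+ 2.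
Proof.
case: N / e Hp Hq => Hp Hq; rewrite !up_id /graph -!unitfE -!unitmxE => up uq.
by rewrite (cramerE up) (cramerE uq); exact: chordal_graph.
Qed.

Lemma frob_sqr_le m n (A : 'M[C]_(m, n)) (z : R) :
  (forall i j, `|complex.Re (A i j)| <= z /\ `|complex.Im (A i j)| <= z) ->
  frob A ^+ 2 <= (m * n * 2)%:R * z ^+ 2.
Proof.
move=> h; rewrite /frob sqr_sqrtr; last first.
  by do 2! apply: sumr_ge0 => ? _; rewrite sqr_ge0.
apply: le_trans (_ : \sum_(i < m) \sum_(j < n) (2 * z ^+ 2) <= _); last first.
  have -> : (m * n * 2)%:R = (n * m)%:R * 2 :> R by rewrite -natrM [(n * m)%N]mulnC.
  by rewrite !sumr_const !card_ord -mulrnA -mulrA (mulr_natl _ (n * m)).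
apply: ler_sum => i _; apply: ler_sum => j _; rewrite normc_sqrE mulr2n mulrDl mul1r.
have [h1 h2] := h i j; have z0 : 0 <= z by apply: le_trans h1.
by apply: lerD; rewrite -[_ ^+ 2]real_normK ?num_real // ler_pXn2r ?nnegrE.
Qed.

Lemma unit_rowsub_inj N (A : 'M[C]_(N, d)) (f : 'I_d -> 'I_N) :
  rowsub f A \in unitmx -> injective f.
Proof.
rewrite unitmxE unitfE => dn0 a b fab; apply/eqP; apply: contra_neqT dn0 => ab.
by apply: (determinant_alternate ab) => c; rewrite !mxE fab.
Qed.

End Halves.

Section UserEvents.
Variables (R : realType) (d : nat).
Hypothesis d0 : (0 < d)%N.
Local Notation C := R[i].
Local Notation normc := ComplexField.Normc.normc.
Local Notation I := (chan_idx d).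
Local Notation Omega := (I -> R).

(** With these variables the definitions of the model apply to a point [w] of the coordinate space,
    and events about channels become subsets of [Omega]. *)
Definition coord (a : I) (w : Omega) : R := w a.

Variables (k : nat) (i : 'I_3).
Local Notation H j w := (chan coord k i j w).
Local Notation p := (cellp i).
Local Notation q := (cellq i).

Definition catdet (j j' : 'I_3) (w : Omega) : C :=
  \det (row_mx (up (NRE d) (H j w)) (up (NRE d) (H j' w))).

(* Coordinates of the least-change reconstruction of the rows of H_q from
   those selected by [f], with the coefficients read off from H_p. *)
Definition recon (f : {ffun 'I_d -> 'I_(NR d)}) (a : I) (w : Omega) : R :=
  let: (_, r, c, b) := a in
  let z := (row r (H p w) *m cramer (rowsub f (H p w)) *m rowsub f (H q w)) 0 c in
  if b then complex.Im z else complex.Re z.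

Definition free_entries (f : {ffun 'I_d -> 'I_(NR d)}) : seq I :=
  [seq (k, i, q, x.1.1, x.1.2, x.2) |
     x : 'I_(NR d) * 'I_d * bool in [pred x | x.1.1 \notin codom f]].

Definition close_event (f : {ffun 'I_d -> 'I_(NR d)}) (eta : R) : set Omega :=
  [set w | forall a, a \in free_entries f -> `|w a - recon f a w| <= eta].

Definition user_entries : seq I :=
  [seq (k, i, x.1.1.1, x.1.1.2, x.1.2, x.2) | x : 'I_3 * 'I_(NR d) * 'I_d * bool].

Definition large_event (y : R) : set Omega :=
  \big[setU/set0]_(a <- user_entries) [set w | y < `|w a| ].

(** The two null events secure full rank of [H_p] and [H_q]. The union over [f] is there because the
    position of the maximal minor of [H_p] is random; it has at most (2d)^d terms. The exponent of
    [tau] is the one of [det_small_ball] for size 2d. *)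
Definition bad_event (y tau eta : R) : set Omega :=
  large_event y `|` ([set w | catdet p i w = 0] `|` ([set w | catdet q i w = 0] `|`
  \big[setU/set0]_(f : {ffun 'I_d -> 'I_(NR d)} | injectiveb f)
    (close_event f eta `&` [set w | normc (catdet p i w) < tau ^+ (2 ^ (d + d))]))).

(** The bound of [rateN_ge] when [M] bounds each of the three squared norms: their sum is at most
    [3 M], the interference left after the postfilter at most [x M]. *)
Definition rate_bound (P M tau x : R) : R :=
  log2 ((P / d%:R) ^+ (d + d) * (tau ^+ (2 ^ (d + d))) ^+ 2) -
  log2 (((1 + P / d%:R * (3%:R * M)) * (1 + P / d%:R * (x * M))) ^+ d).

Lemma frob_user (y : R) j w : ~ large_event y w ->
  frob (H j w) ^+ 2 <= (NR d * d * 2)%:R * y ^+ 2.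
Proof.
move=> nl; have ly a : a \in user_entries -> `|w a| <= y.
  move=> al; rewrite leNgt; apply/negP => ya; apply: nl.
  rewrite /large_event -bigcup_seq; by exists a.
apply: frob_sqr_le => r c; rewrite !mxE /=; split; apply: ly.
  by rewrite /user_entries; apply/codomP; exists (j, r, c, false).
by apply/codomP; exists (j, r, c, true).
Qed.

Lemma rate_user_ge (P y tau eta x : R) w : 0 < P -> 0 < tau -> 0 < x ->
  let M := (NR d * d * 2)%:R * y ^+ 2 in
  0 <= y -> d.+1%:R * Num.sqrt (x * M) <= eta ->
  metricD coord i k w < x -> ~ bad_event y tau eta w ->
  rate_bound P M tau x <= rate coord P i k w.
Proof.
move=> P0 tau0 x0 M y0 etaE Dx nb.
have M0 : 0 <= M by rewrite mulr_ge0 // sqr_ge0.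
have nl : ~ large_event y w by move=> h; apply: nb; left.
have np : catdet p i w != 0 by apply/eqP => h; apply: nb; right; left.
have nq : catdet q i w != 0 by apply/eqP => h; apply: nb; right; right; left.
have fM j : frob (H j w) ^+ 2 <= M by exact: frob_user.
have rp := rank_up np; have rq := rank_up nq.
have DM : chordal (orth_basis (H p w)) (orth_basis (H q w)) ^+ 2 * frob (H q w) ^+ 2 <= x * M.
  by apply: ler_pM; rewrite ?sqr_ge0 ?fM // ltW.
apply: (rateN_up_ge (e := NRE d)) => //.
- by rewrite !exprn_gt0.
- have -> : 3%:R * M = M + M + M by ring.
  by rewrite !lerD ?fM.
rewrite -/(catdet p i w) ler_pXn2r ?nnegrE ?normc_ge0 ?exprn_ge0 ?(ltW tau0) //.
(* Only the determinant can still fail. A report confines the rows of [H_q] outside a maximal minor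
   [f] of [H_p], so a small determinant would put [w] into the last part of [bad_event]. *)
rewrite leNgt; apply/negP => small; apply: nb; right; right; right.
have [f uf fmax] := exists_maxminor rp.
have injf := unit_rowsub_inj uf.
have cl : close_event f eta w.
  move=> a /mapP[[[r c] b]]; rewrite mem_enum inE /= => rf ->.
  have nu0 : 0 <= Num.sqrt (x * M) by exact: sqrtr_ge0.
  have xM0 : 0 <= x * M by rewrite mulr_ge0 // ltW.
  rewrite -[X in _ <= X](sqr_sqrtr xM0) in DM.
  have := closeness nu0 rp rq fmax uf DM r c; rewrite -(cramerE uf). set z := (_ *m _) 0 c => h.
  have {h} : normc (H q w r c - z) <= eta by exact: le_trans etaE.
  case: b; rewrite mxE /coord.
    by move=> /(le_trans (Im_le_normc _)); rewrite /recon -/z; case: z => ? ?.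
  by move=> /(le_trans (Re_le_normc _)); rewrite /recon -/z; case: z => ? ?.
rewrite (bigD1 f) /=; last exact/injectiveP.
by left; split.
Qed.

End UserEvents.

(** * Probability of the exceptional event *)

Section ChannelEvents.
Variables (R : realType) (dT : measure_display) (T : measurableType dT).
Variables (Pr : probability T R) (d : nat) (X : chan_idx d -> T -> R).
Hypotheses (d0 : (0 < d)%N) (iidX : iid_CN Pr X).
Local Notation C := R[i].
Local Notation I := (chan_idx d).
Local Notation pr := (pr Pr X).
Local Notation normc := ComplexField.Normc.normc.

Let indX : mutually_independent Pr X. Proof. by case: iidX. Qed.

Lemma iid_CN_dens a (u v : R) : u <= v ->
  (Pr (X a @^-1` `[u, v]%classic) <= (v - u)%:E)%E.
Proof. by move=> uv; case: iidX => _ ->; [exact: normal_prob_itv_le|exact: measurable_itv]. Qed.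

Lemma csig_tail (s : set I) a (y : R) : s a -> csig s [set w : I -> R | y < `|w a|].
Proof.
move=> sa; have m : cmeas s (fun w : I -> R => w a) by exact: cmeas_coord.
exact: (cmeas_preimage m (measurable_tail y)).
Qed.

Lemma pr_tail a (y : R) : 0 <= y ->
  pr [set w : I -> R | y < `|w a|] <= 2 * expR (- (y ^+ 2 / 2)).
Proof.
move=> y0; rewrite -lee_fin -(PrE indX (csig_tail (s := setT) y Logic.I)).
case: iidX => _ /(_ a _ (measurable_tail y)) h.
by rewrite [leLHS]h; exact: normal_prob_tail.
Qed.

Variables (k : nat) (i : 'I_3).
Local Notation p := (cellp i).
Local Notation q := (cellq i).

Lemma card_user_entries : size (user_entries d k i) = (3 * (NR d) * d * 2)%N.
Proof. by rewrite size_map -cardE !card_prod !card_ord card_bool. Qed.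

Lemma csig_large y : csig setT (large_event (R := R) k i y : set (I -> R)).
Proof. by apply: csig_bigsetU => a; exact: csig_tail. Qed.

Lemma pr_large y : 0 <= y ->
  pr (large_event k i y) <= (3 * (NR d) * d * 2)%:R * (2 * expR (- (y ^+ 2 / 2))).
Proof.
move=> y0; apply: le_trans (pr_bigsetU (s := setT) indX _ _ _) _.
  by move=> a; exact: csig_tail.
apply: le_trans (_ : \sum_(a <- user_entries d k i) (2 * expR (- (y ^+ 2 / 2))) <= _).
  by apply: ler_sum => a _; exact: pr_tail.
by rewrite big_const_seq count_predT card_user_entries iter_addr_0 (mulr_natl _ (3 * NR d * d * 2)).
Qed.

Definition cat_idx (j j' : 'I_3) (b : bool) (r c : 'I_(d + d)) : I :=
  match fintype.split c with
  | inl c' => (k, i, j, cast_ord (NRE d) r, c', b)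
  | inr c' => (k, i, j', cast_ord (NRE d) r, c', b)
  end.

Lemma cat_idx_inj j j' b r c r' c' : j != j' ->
  cat_idx j j' b r c = cat_idx j j' b r' c' -> r = r' /\ c = c'.
Proof.
move=> jj'; rewrite /cat_idx -{2}[c]splitK -{2}[c']splitK.
case: (fintype.split c) => a; case: (fintype.split c') => a' [].
- by move=> /val_inj -> ->.
- by move=> e; rewrite e eqxx in jj'.
- by move=> e; rewrite e eqxx in jj'.
- by move=> /val_inj -> ->.
Qed.

Lemma cat_idx_neq j j' r c r' c' : cat_idx j j' false r c <> cat_idx j j' true r' c'.
Proof.
by rewrite /cat_idx; case: (fintype.split c) => a; case: (fintype.split c') => a'.
Qed.

Lemma catdetE (j j' : 'I_3) : @catdet R d k i j j' =
  (fun w => \det (cmx (cat_idx j j' false) (cat_idx j j' true) w)).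
Proof.
apply/funext => w; congr (\det _); apply/matrixP => r c; rewrite !mxE /cat_idx.
by case: (fintype.split c) => c'; rewrite !mxE.
Qed.

Lemma ccmeas_catdet (s : set I) j j' :
  (forall r c b, s (k, i, j, r, c, b)) -> (forall r c b, s (k, i, j', r, c, b)) ->
  ccmeas s (@catdet R d k i j j').
Proof.
move=> sj sj'; rewrite catdetE; apply: mxmeas_det.
by apply: mxmeas_cmx => r c; rewrite /cat_idx; case: fintype.split.
Qed.

Lemma pr_catdet_small j j' (tau : R) : j != j' -> 0 < tau <= 1 ->
  pr [set w | normc (catdet k i j j' w) < tau ^+ (2 ^ (d + d))] <= (3 * (d + d))%:R * tau.
Proof.
move=> jj' tau01; rewrite catdetE.
apply: (det_small_ball indX iid_CN_dens) tau01 => r c r' c'; last exact: cat_idx_neq.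
exact: cat_idx_inj.
Qed.

Lemma pr_catdet0 j j' : j != j' -> pr [set w | catdet k i j j' w = 0] = 0.
Proof.
move=> jj'; rewrite catdetE; apply: (pr_det_eq0 indX iid_CN_dens) => r c r' c'.
  exact: cat_idx_inj.
exact: cat_idx_neq.
Qed.

Lemma csig_catdet (s : set I) j j' (t : R) :
  (forall r c b, s (k, i, j, r, c, b)) -> (forall r c b, s (k, i, j', r, c, b)) ->
  csig s [set w : I -> R | normc (catdet k i j j' w) < t].
Proof. by move=> sj sj'; apply: csig_normc_lt; exact: ccmeas_catdet. Qed.

Lemma catdet0_set (j j' : 'I_3) : csig setT [set w : I -> R | catdet k i j j' w = 0].
Proof. by apply: csig_eq0; exact: ccmeas_catdet. Qed.

Definition recon_base (f : {ffun 'I_d -> 'I_(NR d)}) : set I :=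
  [set a | a \notin free_entries k i f].

Lemma mem_free_entries (f : {ffun 'I_d -> 'I_(NR d)}) j r c b :
  ((k, i, j, r, c, b) \in free_entries k i f) = (j == q) && (r \notin codom f).
Proof.
apply/idP/idP.
  by move=> /mapP[[[r' c'] b']]; rewrite mem_enum inE /= => rf [-> -> _ _]; rewrite eqxx.
case/andP=> /eqP -> rf; apply/mapP; exists (r, c, b) => //.
by rewrite mem_enum inE.
Qed.

Lemma size_free_entries (f : {ffun 'I_d -> 'I_(NR d)}) : injectiveb f ->
  size (free_entries k i f) = (d * d * 2)%N.
Proof.
move=> /injectiveP injf; rewrite size_map -cardE.
have -> : #|[pred x : 'I_(NR d) * 'I_d * bool | x.1.1 \notin codom f]| =
    #|[predX [predX [pred r | r \notin codom f] & (predT : pred 'I_d)] & (predT : pred bool)]|.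
  by apply: eq_card => -[[r c] b]; rewrite !inE /= !andbT.
have e1 : #|(predT : pred 'I_d)| = d by rewrite -[RHS]card_ord; exact: eq_card.
have e2 : #|(predT : pred bool)| = 2%N by rewrite -[RHS]card_bool; exact: eq_card.
rewrite !cardX e1 e2; congr (_ * _ * _)%N.
have := cardC (mem (codom f)); rewrite card_codom // !card_ord -[in RHS](NRE d) => /eqP.
rewrite eqn_add2l => /eqP h; rewrite -[RHS]h; by apply: eq_card => r; rewrite !inE.
Qed.

Lemma uniq_free_entries (f : {ffun 'I_d -> 'I_(NR d)}) : uniq (free_entries k i f).
Proof.
rewrite map_inj_uniq ?enum_uniq // => -[[r c] b] [[r' c'] b'] /= [-> -> ->] //.
Qed.

Lemma mxmeas_chan (s : set I) j : (forall r c b, s (k, i, j, r, c, b)) ->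
  mxmeas s (chan (@coord R d) k i j).
Proof.
move=> sj r c.
apply: (ccmeas_ext (f := fun w => Complex (w (k, i, j, r, c, false)) (w (k, i, j, r, c, true)))).
  by move=> w; rewrite mxE.
by split; exact: cmeas_coord.
Qed.

Lemma recon_base_other (f : {ffun 'I_d -> 'I_(NR d)}) j r c b : j != q ->
  recon_base f (k, i, j, r, c, b).
Proof. by move=> jq; rewrite /recon_base /= mem_free_entries (negbTE jq). Qed.

Lemma cmeas_recon (f : {ffun 'I_d -> 'I_(NR d)}) a :
  cmeas (recon_base f) (recon k i f a : (I -> R) -> R).
Proof.
have [_ _ pq] := cellpqP i.
case: a => [[[[[k' i'] j'] r] c] b].
have mp : mxmeas (recon_base f) (chan (@coord R d) k i p).
  by apply: mxmeas_chan => r' c' b'; exact: recon_base_other.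
have mz : mxmeas (recon_base f) (fun w => row r (chan (@coord R d) k i p w) *m
   cramer (rowsub f (chan (@coord R d) k i p w)) *m rowsub f (chan (@coord R d) k i q w)).
  apply: mxmeasM; first apply: mxmeasM.
  - move=> r' c'; apply: ccmeas_ext (mp r c') => w; by rewrite [RHS]mxE.
  - apply: mxmeas_cramer => r' c'; apply: ccmeas_ext (mp (f r') c') => w; by rewrite [RHS]mxE.
  - move=> r' c'; apply: (ccmeas_ext (f := fun w => Complex (w (k, i, q, f r', c', false))
      (w (k, i, q, f r', c', true)))); first by move=> w; rewrite !mxE.
    by split; apply: cmeas_coord; rewrite /recon_base /= mem_free_entries codom_f andbF.
by have [m1 m2] := mz 0 c; case: b.
Qed.

Lemma csig_close (f : {ffun 'I_d -> 'I_(NR d)}) (eta : R) :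
  csig setT (close_event k i f eta).
Proof.
apply: csig_all => a; have := @csig_near R I _ a _ eta (@cmeas_recon f a).
by apply: sub_csig.
Qed.

(** The determinant of [H_p H_ii] does not involve [H_q], so its smallness is an event on
    [recon_base f], and [peel_seq] splits off the [2 d^2] free coordinates in front of it. For [eta]
    of order sqrt(x M) they contribute a factor of order (x M)^(d^2). *)
Lemma pr_close (f : {ffun 'I_d -> 'I_(NR d)}) (eta tau : R) : injectiveb f ->
  0 < eta -> 0 < tau <= 1 ->
  pr (close_event k i f eta `&` [set w | normc (catdet k i p i w) < tau ^+ (2 ^ (d + d))]) <=
  (3%:R * eta) ^+ (d * d * 2) * ((3 * (d + d))%:R * tau).
Proof.
move=> injf eta0 tau01; have [pi qi pq] := cellpqP i.
have sE : csig (recon_base f) [set w : I -> R | normc (catdet k i p i w) < tau ^+ (2 ^ (d + d))].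
  by apply: csig_catdet => r c b; apply: recon_base_other => //; rewrite eq_sym.
have h := @peel_seq _ _ _ _ _ _ indX iid_CN_dens (recon_base f) (free_entries k i f)
  (recon k i f) eta _ (uniq_free_entries f) _ (@cmeas_recon f) sE eta0.
apply: le_trans (h _) _; first by move=> a af; rewrite /recon_base /= af.
rewrite size_free_entries // ler_wpM2l ?exprn_ge0 ?mulr_ge0 ?(ltW eta0) //.
exact: pr_catdet_small.
Qed.

Lemma csig_bad (y tau eta : R) : csig setT (bad_event k i y tau eta : set (I -> R)).
Proof.
apply: csigU; first exact: csig_large.
apply: csigU; first exact: catdet0_set.
apply: csigU; first exact: catdet0_set.
apply: csig_bigsetU => f; apply: csigI; first exact: csig_close.
exact: csig_catdet.
Qed.

Lemma pr_bad (y tau eta : R) : 0 <= y -> 0 < eta -> 0 < tau <= 1 ->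
  pr (bad_event k i y tau eta : set (I -> R)) <=
  (3 * (NR d) * d * 2)%:R * (2 * expR (- (y ^+ 2 / 2))) +
  (NR d ^ d)%:R * ((3%:R * eta) ^+ (d * d * 2) * ((3 * (d + d))%:R * tau)).
Proof.
move=> y0 eta0 tau01; have [pi qi pq] := cellpqP i.
have c1 := csig_large y; have c2 := catdet0_set p i; have c3 := catdet0_set q i.
have c4 (f : {ffun 'I_d -> 'I_(NR d)}) : csig setT (close_event k i f eta `&`
    [set w | normc (catdet k i p i w) < tau ^+ (2 ^ (d + d))]).
  by apply: csigI; [exact: (@csig_close f eta)|exact: csig_catdet].
have c4' : csig setT (\big[setU/set0]_(f : {ffun 'I_d -> 'I_(NR d)} | injectiveb f)
    (close_event k i f eta `&` [set w | normc (catdet k i p i w) < tau ^+ (2 ^ (d + d))])).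
  by apply: csig_bigsetU.
apply: le_trans (pr_setU indX c1 (csigU c2 (csigU c3 c4'))) _.
apply: lerD; first exact: pr_large.
apply: le_trans (pr_setU indX c2 (csigU c3 c4')) _; rewrite pr_catdet0 // add0r.
apply: le_trans (pr_setU indX c3 c4') _; rewrite pr_catdet0 // add0r.
apply: le_trans (pr_bigsetU _ _ _ c4) _; first exact: indX.
have K0 : 0 <= (3%:R * eta) ^+ (d * d * 2) * ((3 * (d + d))%:R * tau).
  by case/andP: tau01 => t0 _; rewrite mulr_ge0 ?exprn_ge0 ?mulr_ge0 // ltW.
apply: le_trans (_ : \sum_(f : {ffun 'I_d -> 'I_(NR d)} | injectiveb f)
   ((3%:R * eta) ^+ (d * d * 2) * ((3 * (d + d))%:R * tau)) <= _).
  by apply: ler_sum => f injf; exact: pr_close.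
rewrite sumr_const -[X in X <= _]mulr_natl ler_wpM2r // ler_nat.
by apply: leq_trans (max_card _) _; rewrite card_ffun !card_ord.
Qed.

End ChannelEvents.

(** * Lower bound for the probability that the two interfering spaces are close *)

Lemma sumr_sqr_ge (R : realFieldType) (K : finType) (P : K -> R) (v : R) : 0 <= v ->
  (0 < #|K|)%N -> v <= \sum_k P k -> v ^+ 2 / #|K|%:R <= \sum_k P k ^+ 2.
Proof.
move=> v0 K0 vP; set M : R := #|K|%:R; have M0 : 0 < M by rewrite ltr0n.
have : 0 <= \sum_k (P k - v / M) ^+ 2 by apply: sumr_ge0 => k _; rewrite sqr_ge0.
have -> : \sum_k (P k - v / M) ^+ 2 =
    \sum_k P k ^+ 2 - (2 * (v / M)) * \sum_k P k + v ^+ 2 / M.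
  have -> : v ^+ 2 / M = \sum_(k : K) (v / M) ^+ 2.
    by rewrite sumr_const -[RHS]mulr_natl -/M; field; rewrite gt_eqF.
  rewrite mulr_sumr -sumrB -big_split /=; apply: eq_bigr => k _; ring.
have : 2 * (v / M) * v <= 2 * (v / M) * \sum_k P k.
  by rewrite ler_wpM2l // mulr_ge0 // divr_ge0 // ltW.
have -> : 2 * (v / M) * v = 2 * (v ^+ 2 / M) by ring.
lra.
Qed.

Lemma same_interval (R : realFieldType) (z h L u v : R) :
  z <= u + L -> u + L < z + h -> z <= v + L -> v + L < z + h -> `|v - u| <= h.
Proof. by move=> *; rewrite ler_norml; apply/andP; split; lra. Qed.

Section SmallDistance.
Variables (R : realType) (dT : measure_display) (T : measurableType dT).
Variables (Pr : probability T R) (d : nat) (X : chan_idx d -> T -> R).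
Hypotheses (d0 : (0 < d)%N) (iidX : iid_CN Pr X).
Local Notation C := R[i].
Local Notation I := (chan_idx d).
Local Notation pr := (pr Pr X).
Local Notation J := ('I_(d + d) * 'I_d * bool)%type.

Let indX : mutually_independent Pr X. Proof. by case: iidX. Qed.

Definition entry_idx (k : nat) (i j : 'I_3) (x : J) : I :=
  (k, i, j, cast_ord (NRE d) x.1.1, x.1.2, x.2).

Lemma entry_idx_inj k i j : injective (entry_idx k i j).
Proof. by move=> [[r c] b] [[r' c'] b'] [] /= /val_inj -> -> ->. Qed.

Definition Hmx (v : J -> R) : 'M[C]_(d + d, d) :=
  cmx (fun r c => (r, c, false)) (fun r c => (r, c, true)) v.

Lemma HmxE k i j (w : I -> R) :
  Hmx (fun x => w (entry_idx k i j x)) = up (NRE d) (chan (@coord R d) k i j w).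
Proof. by apply/matrixP => r c; rewrite !mxE. Qed.

Definition gcoord (x : 'I_d * 'I_d * bool) (v : J -> R) : R :=
  let z := graph (Hmx v) x.1.1 x.1.2 in if x.2 then complex.Im z else complex.Re z.

Lemma mxmeas_Hmx : mxmeas setT Hmx.
Proof. exact: mxmeas_cmx. Qed.

Lemma mxmeas_usub : mxmeas setT (fun v => usubmx (Hmx v)).
Proof.
move=> r c; apply: ccmeas_ext (mxmeas_Hmx (lshift d r) c) => v.
by rewrite [RHS]mxE.
Qed.

Lemma cmeas_gcoord x : cmeas setT (gcoord x).
Proof.
have mg : mxmeas setT (fun v => graph (Hmx v)).
  apply: mxmeasM; last by apply: mxmeas_cramer; exact: mxmeas_usub.
  move=> r c; apply: ccmeas_ext (mxmeas_Hmx (rshift d r) c) => v.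
  by rewrite [RHS]mxE.
by have [m1 m2] := mg x.1.1 x.1.2; rewrite /gcoord; case: x.2.
Qed.

Definition regular : set (J -> R) := [set v | \det (usubmx (Hmx v)) != 0].

Lemma csig_regular : csig setT regular.
Proof.
have -> : regular = ~` [set v | \det (usubmx (Hmx v)) = 0].
  by apply/seteqP; split=> v /= /eqP.
by apply: csigC; apply: csig_eq0; apply: mxmeas_det; exact: mxmeas_usub.
Qed.

Definition lift_ev k i j (E : set (J -> R)) : set (I -> R) :=
  [set w | E (fun x => w (entry_idx k i j x))].

Definition block_idx k i j : set I := [set a | exists r c b, a = (k, i, j, r, c, b)].

Lemma csig_lift_ev k i j E : csig setT E -> csig (block_idx k i j) (lift_ev k i j E).
Proof.
apply: csig_lift => a [x _ <-].
by exists (cast_ord (NRE d) x.1.1), x.1.2, x.2.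
Qed.

Lemma csigT_lift_ev k i j E : csig setT E -> csig setT (lift_ev k i j E).
Proof. by move=> sE; have := @csig_lift_ev k i j E sE; apply: sub_csig. Qed.

Lemma pr_lift_ev k i j k' i' j' E : csig setT E ->
  pr (lift_ev k i j E) = pr (lift_ev k' i' j' E).
Proof.
move=> sE; rewrite /pr /=; congr fine.
rewrite -[pull X id (lift_ev k i j E)]/(pull X (entry_idx k i j) E).
rewrite -[pull X id (lift_ev k' i' j' E)]/(pull X (entry_idx k' i' j') E).
apply: same_law sE => //; try exact: entry_idx_inj.
by move=> a b B mB; case: iidX => _ h; rewrite !h.
Qed.

Lemma pr_lift_pair k i E : csig setT E ->
  pr (lift_ev k i (cellp i) E `&` lift_ev k i (cellq i) E) =
  pr (lift_ev 0 ord0 ord0 E) ^+ 2.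
Proof.
move=> sE; have [_ _ pq] := cellpqP i.
have dpq : block_idx k i (cellp i) `&` block_idx k i (cellq i) `<=` set0.
  by move=> a [[r [c' [b ->]]] [r' [c'' [b' [e]]]]]; rewrite e eqxx in pq.
rewrite (pr_indep indX dpq (@csig_lift_ev k i (cellp i) _ sE) (@csig_lift_ev k i (cellq i) _ sE)).
rewrite (pr_lift_ev k i (cellp i) 0 ord0 ord0 sE) (pr_lift_ev k i (cellq i) 0 ord0 ord0 sE).
exact: erefl.
Qed.

Lemma pr_regular k i j : pr (lift_ev k i j regular) = 1.
Proof.
pose re (r c : 'I_d) : I := entry_idx k i j (lshift d r, c, false).
pose im (r c : 'I_d) : I := entry_idx k i j (lshift d r, c, true).
have -> : lift_ev k i j regular = ~` [set w : I -> R | \det (cmx re im w) = 0].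
  have E w : \det (usubmx (Hmx (fun x => w (entry_idx k i j x)))) = \det (cmx re im w).
    by congr (\det _); apply/matrixP => r c; rewrite !mxE.
  by apply/seteqP; split=> w; rewrite /lift_ev /regular /= E => /eqP.
have sE : csig setT [set w : I -> R | \det (cmx re im w) = 0].
  have md : ccmeas setT (fun w : I -> R => \det (cmx re im w)).
    by apply: mxmeas_det; exact: mxmeas_cmx.
  exact: (csig_eq0 md).
rewrite (pr_setC indX sE) (pr_det_eq0 indX (iid_CN_dens iidX)) ?subr0 // => r c r' c'.
by move=> /entry_idx_inj [] /= /val_inj -> ->.
Qed.

(** Truncation leaves finitely many grid cells; the size [L] affects constants only. *)
Definition graph_box (L : R) : set (J -> R) :=
  regular `&` [set v | forall x, x \in index_enum ('I_d * 'I_d * bool)%type ->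
     - L <= gcoord x v < L].

Lemma csig_itv x (a b : R) : csig setT [set v | a <= gcoord x v < b].
Proof. exact: (cmeas_preimage (cmeas_gcoord x) (measurable_itv `[a, b[)). Qed.

Lemma csig_graph_box L : csig setT (graph_box L).
Proof.
apply: csigI; first exact: csig_regular.
by apply: csig_all => x; exact: csig_itv.
Qed.

(** The boxes with [L = n + 1] exhaust [regular], an event of probability 1, so they cannot all be
    null. *)
Lemma exists_box k i j : exists2 L : R, 0 < L & 0 < pr (lift_ev k i j (graph_box L)).
Proof.
apply/not_exists2P => h.
have h0 n : pr (lift_ev k i j (graph_box n.+1%:R)) = 0.
  have [|h1] := h n.+1%:R; first by rewrite ltr0Sn.
  by apply/eqP; rewrite eq_le pr_ge0 andbT leNgt; apply/negP.
have sb n : csig setT (lift_ev k i j (graph_box n.+1%:R)).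
  by apply: csigT_lift_ev; exact: csig_graph_box.
have := pr_bigcup0 indX sb h0.
have -> : \bigcup_n lift_ev k i j (graph_box n.+1%:R) = lift_ev k i j regular.
  apply/seteqP; split=> w /=; first by move=> [n _ []].
  move=> rw; pose b := \sum_x `|gcoord x (fun x => w (entry_idx k i j x))|.
  exists (Num.trunc b) => //; split=> // x _.
  set gx := gcoord x _; have gb : `|gx| <= b.
    by rewrite /b (bigD1 x) //= lerDl sumr_ge0.
  have /andP[_ bt] := truncn_itv (le_trans (normr_ge0 _) gb).
  have /andP[] : - (Num.trunc b).+1%:R < gx < (Num.trunc b).+1%:R.
    by rewrite -ltr_norml (le_lt_trans gb).
  by move=> /ltW -> ->.
by rewrite pr_regular => /eqP; rewrite oner_eq0.
Qed.

Section Cells.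
Variables (L : R) (m : nat).
Hypotheses (L0 : 0 < L) (m0 : (0 < m)%N).
Local Notation h := (2 * L / m%:R).
Local Notation K := {ffun 'I_d * 'I_d * bool -> 'I_m}.

Definition cell (c : K) : set (J -> R) :=
  graph_box L `&` [set v | forall x, x \in index_enum ('I_d * 'I_d * bool)%type ->
     (c x)%:R * h <= gcoord x v + L < (c x).+1%:R * h].

Let h0 : 0 < h. Proof. by rewrite divr_gt0 ?mulr_gt0 ?ltr0n. Qed.

Lemma csig_cell c : csig setT (cell c).
Proof.
apply: csigI; first exact: csig_graph_box.
apply: csig_all => x.
have := csig_itv x ((c x)%:R * h - L) ((c x).+1%:R * h - L).
congr csig; apply/seteqP; split=> v /=; by rewrite lerBlDr ltrBrDr.
Qed.

Lemma cell_disj c c' v : cell c v -> cell c' v -> c = c'.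
Proof.
move=> [_ cv] [_ cv']; apply/ffunP => x; apply/val_inj => /=.
have /andP[a1 a2] := cv x (mem_index_enum _).
have /andP[b1 b2] := cv' x (mem_index_enum _).
have := le_lt_trans a1 b2; have := le_lt_trans b1 a2.
rewrite !ltr_pM2r // !ltr_nat !ltnS => u1 u2.
by apply/eqP; rewrite eqn_leq u1 u2.
Qed.

Lemma cell_cover v : graph_box L v -> exists c, cell c v.
Proof.
move=> bv; pose n x := Num.trunc ((gcoord x v + L) / h).
have gv x : - L <= gcoord x v < L by apply: bv.2; exact: mem_index_enum.
have g0 x : 0 <= (gcoord x v + L) / h.
  by have /andP[g1 _] := gv x; rewrite divr_ge0 ?(ltW h0) // -lerBlDr sub0r.
have nm x : (n x < m)%N.
  rewrite truncn_lt_nat // ltr_pdivrMr //.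
  have -> : m%:R * h = L + L by field; rewrite pnatr_eq0 -lt0n.
  by have /andP[_ g1] := gv x; rewrite ltrD2r.
exists [ffun x => Ordinal (nm x)]; split=> // x _; rewrite ffunE /=.
by have := truncn_itv (g0 x); rewrite ler_pdivlMr // ltr_pdivrMr.
Qed.

Definition same_cell k i : set (I -> R) :=
  \big[setU/set0]_(c : K)
    (lift_ev k i (cellp i) (cell c) `&` lift_ev k i (cellq i) (cell c)).

Lemma csig_same_cell (s : set I) k i : (forall j r c b, s (k, i, j, r, c, b)) ->
  csig s (same_cell k i).
Proof.
move=> sk; apply: csig_bigsetU => c.
apply: csigI.
  have := @csig_lift_ev k i (cellp i) _ (csig_cell c).
  by apply: sub_csig => _ [r [c' [b ->]]].
have := @csig_lift_ev k i (cellq i) _ (csig_cell c).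
by apply: sub_csig => _ [r [c' [b ->]]].
Qed.

Lemma metricD_same_cell k i w : same_cell k i w ->
  metricD (@coord R d) i k w <= 2 * d%:R ^+ 3 * h ^+ 2.
Proof.
rewrite /same_cell -bigcup_seq => -[c _ [[[rp _] cp] [[rq _] cq]]].
move: rp rq; rewrite /regular /= !HmxE => rp rq.
apply: le_trans (chordal_up rp rq) _.
(* There are [2 d^2] real coordinates, each off by at most [h]; the remaining [d] comes from
   [chordal_up]. *)
have -> : 2 * d%:R ^+ 3 * h ^+ 2 = d%:R * ((d * d * 2)%:R * h ^+ 2) by rewrite !natrM; ring.
rewrite ler_wpM2l //; apply: frob_sqr_le => r s.
have near b : `|gcoord (r, s, b) (fun x => w (entry_idx k i (cellq i) x)) -
    gcoord (r, s, b) (fun x => w (entry_idx k i (cellp i) x))| <= h.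
  have /andP[a1 a2] := cp (r, s, b) (mem_index_enum _).
  have /andP[b1 b2] := cq (r, s, b) (mem_index_enum _).
  move: a2 b2; rewrite -natr1 mulrDl mul1r=> a2 b2.
  exact: same_interval a1 a2 b1 b2.
have n1 := near true; have n2 := near false.
rewrite /gcoord /= !HmxE in n1 n2.
set Gq := graph (up _ (chan _ k i (cellq i) w)) in n1 n2 *.
set Gp := graph (up _ (chan _ k i (cellp i) w)) in n1 n2 *.
move: Gp Gq n1 n2 => Gp Gq n1 n2; rewrite !mxE.
by move: n1 n2; case: (Gp r s) => a b; case: (Gq r s) => a' b'.
Qed.

Lemma pr_same_cell k i : 
  pr (lift_ev 0 ord0 ord0 (graph_box L)) ^+ 2 / (m ^ (d * d * 2))%:R <= pr (same_cell k i).
Proof.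
have [_ _ pq] := cellpqP i.
have sc c j : csig setT (lift_ev k i j (cell c)) by apply: csigT_lift_ev; exact: csig_cell.
rewrite /same_cell (pr_bigsetU_disj (s := setT) indX); last 3 first.
- exact: index_enum_uniq.
- by move=> c; apply: csigI.
- by move=> c c' w [cw _] [cw' _]; exact: cell_disj cw cw'.
have -> : \sum_(c : K) pr (lift_ev k i (cellp i) (cell c) `&` lift_ev k i (cellq i) (cell c)) =
    \sum_(c : K) pr (lift_ev 0 ord0 ord0 (cell c)) ^+ 2.
  apply: eq_bigr => c _.
  exact: pr_lift_pair (csig_cell c).
have -> : (m ^ (d * d * 2))%N = #|K| by rewrite card_ffun !card_prod !card_ord card_bool.
apply: sumr_sqr_ge; first exact: pr_ge0.
  by rewrite card_ffun card_ord expn_gt0 m0.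
have sc0 c : csig setT (lift_ev 0 ord0 ord0 (cell c)).
  by apply: csigT_lift_ev; exact: csig_cell.
apply: le_trans (pr_bigsetU indX _ _ sc0).
have inc : lift_ev 0 ord0 ord0 (graph_box L) `<=`
    \big[setU/set0]_(c : K) lift_ev 0 ord0 ord0 (cell c).
  by move=> w /cell_cover[c cw]; rewrite -bigcup_seq; exists c => //=; exact: mem_index_enum.
apply: (@pr_le _ _ _ _ _ _ indX setT _ _ _ _ inc).
  by apply: csigT_lift_ev; exact: csig_graph_box.
exact: csig_bigsetU.
Qed.

End Cells.

(** [E] depends on the coordinates of user [k] only, so that different users give independent
    events. *)
Lemma small_distance : exists2 c0 : R, 0 < c0 & forall (x : R) k i, 0 < x <= 1 ->
  exists E : set (I -> R),
    [/\ forall s : set I, (forall j r c b, s (k, i, j, r, c, b)) -> csig s E,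
        forall w, E w -> metricD (@coord R d) i k w < x &
        c0 * x ^+ (d * d) <= pr E].
Proof.
have [L L0] := exists_box 0 ord0 ord0; set v := pr _ => v0.
pose a0 := 2 * d%:R ^+ 3 * (2 * L) ^+ 2.
have d0' : 0 < d%:R :> R by rewrite ltr0n.
have a00 : 0 < a0 by rewrite !mulr_gt0 ?exprn_gt0 ?mulr_gt0.
pose a := Num.sqrt a0 + 1.
have a_gt0 : 0 < a by rewrite ltr_wpDl ?sqrtr_ge0.
exists (v ^+ 2 / (a ^+ 2) ^+ (d * d)); first by rewrite divr_gt0 ?exprn_gt0.
(* With [m] intervals per axis, two spaces in one cell have distance at most [a0 / m^2], and [m] is
   just large enough to make this less than [x]. Conversely [m^2 <= a^2 / x], where the 1 in [a]
   absorbs the rounding because [x <= 1]. So there are at most (a^2 / x)^(d^2) cells. *)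
move=> x k i /andP[x0 x1]; pose m := (Num.trunc (Num.sqrt (a0 / x))).+1.
have /andP[m1 m2] := truncn_itv (sqrtr_ge0 (a0 / x)).
have mgt : a0 / x < m%:R ^+ 2.
  rewrite -[a0 / x]sqr_sqrtr ?divr_ge0 ?(ltW a00) ?(ltW x0) //.
  by rewrite ltr_pXn2r ?nnegrE ?sqrtr_ge0.
have mle : m%:R ^+ 2 <= a ^+ 2 / x.
  have -> : a ^+ 2 / x = (a / Num.sqrt x) ^+ 2 by rewrite exprMn exprVn sqr_sqrtr // ltW.
  rewrite ler_pXn2r ?nnegrE ?divr_ge0 ?(ltW a_gt0) ?sqrtr_ge0 // -natr1 /a mulrDl.
  apply: lerD; first by rewrite (le_trans m1) // sqrtrM ?(ltW a00) // sqrtrV // ltW.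
  by rewrite mul1r invf_ge1 ?sqrtr_gt0 // -[leRHS]sqrtr1 ler_wsqrtr.
exists (same_cell L m k i); split.
- by move=> s sk; exact: csig_same_cell.
- move=> w /metricD_same_cell; move=> /le_lt_trans; apply.
  have -> : 2 * d%:R ^+ 3 * (2 * L / m%:R) ^+ 2 = a0 / m%:R ^+ 2 by rewrite /a0; field; rewrite pnatr_eq0.
  by rewrite ltr_pdivrMr ?exprn_gt0 ?ltr0n // mulrC -ltr_pdivrMr.
- apply: le_trans (pr_same_cell L0 (ltn0Sn _) k i).
  rewrite -/v -mulrA ler_wpM2l ?sqr_ge0 //.
  have -> : ((m ^ (d * d * 2))%:R)^-1 = ((m%:R : R) ^+ 2)^-1 ^+ (d * d).
    by rewrite exprVn natrX mulnC exprM.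
  rewrite -exprVn -exprMn; apply: lerXn2r; rewrite ?nnegrE ?invr_ge0 ?sqr_ge0 //.
    by rewrite mulr_ge0 ?invr_ge0 ?sqr_ge0 // ltW.
  by rewrite mulrC -invf_div lef_pV2 ?posrE ?divr_gt0 ?exprn_gt0 ?ltr0n.
Qed.

End SmallDistance.

(** * All users *)

(** The integral of a nonnegative function is a supremum over the simple functions below it, hence
    monotone even when [f] is not measurable. *)
Lemma integral_ge_on (R : realType) dT (T : measurableType dT) (Pr : probability T R)
    (f : T -> R) (A : set T) (c : R) : measurable A -> 0 <= c ->
  (forall t, 0 <= f t) -> (forall t, A t -> c <= f t) ->
  (c%:E * Pr A <= \int[Pr]_t (f t)%:E)%E.
Proof.
move=> mA c0 f0 fc.
have -> : (c%:E * Pr A = \int[Pr]_t (c%:E * (\1_A t)%:E))%E.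
  rewrite ge0_integralZl_EFin //=.
  - by rewrite integral_indic // setIT.
  - by apply/measurable_EFinP; exact: measurable_indic.
rewrite !ge0_integralTE => [|t|t]; last 2 first.
- by rewrite lee_fin.
- by rewrite -EFinM lee_fin mulr_ge0.
apply: le_ereal_sup => _ [h hle <-]; exists h => //= t.
apply: le_trans (hle t) _; rewrite -EFinM lee_fin indicE.
have [tA|tA] := boolP (t \in A); first by rewrite mulr1 fc // -inE.
by rewrite mulr0.
Qed.

Section Selection.
Variables (R : realType) (T : Type) (d : nat) (X : chan_idx d -> T -> R).

Lemma rate_ge0 P i k t : (0 < d)%N -> 0 < P -> 0 <= rate X P i k t.
Proof. by move=> d0 P0; exact: (rateN_up_ge0 (NRE d)). Qed.

Lemma sel_rate_ge0 P K x i t : (0 < d)%N -> 0 < P -> 0 <= sel_rate X P K x i t.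
Proof.
move=> d0 P0; rewrite /sel_rate divr_ge0 //.
by apply: sumr_ge0 => k _; exact: rate_ge0.
Qed.

Lemma sel_rate_ge P K x i t (c : R) :
  (exists2 k, (k < K)%N & metricD X i k t < x) ->
  (forall k, (k < K)%N -> metricD X i k t < x -> c <= rate X P i k t) ->
  c <= sel_rate X P K x i t.
Proof.
move=> [k kK Dk] h; rewrite /sel_rate.
have kS : k \in [seq k <- iota 0 K | metricD X i k t < x].
  by rewrite mem_filter Dk mem_iota add0n kK.
have -> : candidates X K x i t = [seq k <- iota 0 K | metricD X i k t < x].
  by move: kS; rewrite /candidates; case: [seq _ <- _ | _].
set S := [seq k <- iota 0 K | metricD X i k t < x] in kS *.
have S0 : 0 < (size S)%:R :> R by rewrite ltr0n; case: S kS.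
rewrite ler_pdivlMr //.
have -> : c * (size S)%:R = \sum_(j <- S) c.
  by rewrite big_const_seq count_predT iter_addr_0 mulr_natr.
rewrite big_seq [leRHS]big_seq; apply: ler_sum => j.
by rewrite mem_filter mem_iota => /andP[Dj /andP[_ jK]]; exact: h.
Qed.

End Selection.

Section Users.
Variables (R : realType) (dT : measure_display) (T : measurableType dT).
Variables (Pr : probability T R) (d : nat) (X : chan_idx d -> T -> R).
Hypotheses (d0 : (0 < d)%N) (iidX : iid_CN Pr X).
Local Notation I := (chan_idx d).
Local Notation pr := (pr Pr X).

Let indX : mutually_independent Pr X. Proof. by case: iidX. Qed.

Definition user (a : I) : nat := a.1.1.1.1.1.

(** Different users are independent, and [1 - e <= expR (- e)]. *)
Lemma pr_no_user (E : nat -> set (I -> R)) (e : R) n :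
  (forall k, csig [set a | user a = k] (E k)) -> (forall k, e <= pr (E k)) ->
  pr (~` \big[setU/set0]_(k <- iota 0 n) E k) <= expR (- (e * n%:R)).
Proof.
move=> sE eE; have iotaE m : iota 0 m.+1 = iota 0 m ++ [:: m] by rewrite -addn1 iotaD.
have sU m : csig [set a | (user a < m)%N] (\big[setU/set0]_(k <- iota 0 m) E k).
  elim: m => [|m IH]; first by rewrite big_nil; exact: csig0.
  rewrite iotaE big_cat /= big_seq1; apply: csigU.
    by apply: sub_csig IH => a /= /ltnW.
  by apply: sub_csig (sE m) => a /= ->.
elim: n => [|n IH].
  rewrite big_nil mulr0 oppr0 expR0; exact: (pr_le1 indX (csigC (@csig0 R I setT))).
rewrite iotaE big_cat /= big_seq1 setCU.
rewrite (pr_indep indX _ (csigC (sU n)) (csigC (sE n))); last first.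
  by move=> a [/= an ae]; rewrite ae ltnn in an.
rewrite (pr_setC indX (sE n)) -natr1 [e * _]mulrDr mulr1 opprD expRD.
have En := pr_le1 indX (sE n).
apply: ler_pM; [exact: pr_ge0|by rewrite subr_ge0|exact: IH|].
apply: le_trans (_ : 1 - e <= _); first by rewrite lerB.
by have := expR_ge1Dx (- e).
Qed.

Variable i : 'I_3.

(* With probability at least the factor below, some user reports 1 and no
   reporting user is exceptional. *)
Lemma sel_rate_mean_ge : exists2 c0 : R, 0 < c0 & exists2 C : R, 0 < C &
  forall (P : R) (K : nat) (x y tau : R),
  let M := (NR d * d * 2)%:R * y ^+ 2 in
  0 < P -> 0 < x <= 1 -> 0 < y -> 0 < tau <= 1 ->
  0 <= rate_bound d P M tau x ->
  ((rate_bound d P M tau x * (1 - expR (- (c0 * x ^+ (d * d) * K%:R))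
     - K%:R * (C * (expR (- (y ^+ 2 / 2)) + (x * M) ^+ (d * d) * tau))))%:E <=
   \int[Pr]_t (sel_rate X P K x i t)%:E)%E.
Proof.
have [c0 c00 hE] := small_distance d0 iidX; exists c0 => //.
pose C1 : R := (3 * NR d * d * 2)%:R * 2.
pose C2 : R := (NR d ^ d)%:R * ((3%:R * d.+1%:R) ^+ (d * d * 2) * (3 * (d + d))%:R).
have C10 : 0 <= C1 by rewrite mulr_ge0.
have C20 : 0 <= C2 by rewrite !mulr_ge0 // exprn_ge0 // mulr_ge0.
exists (C1 + C2 + 1); first by rewrite ltr_wpDl // addr_ge0.
move=> P K x y tau M P0 x01 y0 tau01 rb0; have [x0 x1] := andP x01.
have [tau0 tau1] := andP tau01.
have M0 : 0 < M by rewrite mulr_gt0 ?exprn_gt0 // ltr0n !muln_gt0 d0.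
pose eta := d.+1%:R * Num.sqrt (x * M).
have eta0 : 0 < eta by rewrite mulr_gt0 // sqrtr_gt0 mulr_gt0.
have /boolp.choice [E EP] : forall k, exists E : set (I -> R),
    [/\ forall s : set I, (forall j r c b, s (k, i, j, r, c, b)) -> csig s E,
        forall w, E w -> metricD (@coord R d) i k w < x &
        c0 * x ^+ (d * d) <= pr E] by move=> k; exact: hE.
have sE k : csig [set a | user a = k] (E k) by have [h _ _] := EP k; exact: h.
have sET k : csig setT (E k) by have [h _ _] := EP k; exact: h.
pose bad k : set (I -> R) := bad_event k i y tau eta.
have sbad k : csig setT (bad k) by exact: csig_bad.
(* [anyE] is built from explicit events inside D < x, whereas [anybad] covers all users: the set of
   reporting users is random and each of them may be selected. *)
pose anyE := \big[setU/set0]_(k <- iota 0 K) E k.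
pose anybad := \big[setU/set0]_(k <- iota 0 K) bad k.
have sanyE : csig setT anyE by exact: csig_bigsetU.
have sanybad : csig setT anybad by exact: csig_bigsetU.
pose good := ~` (~` anyE `|` anybad).
have sgood : csig setT good by apply: csigC; apply: csigU => //; exact: csigC.
have pgood : 1 - expR (- (c0 * x ^+ (d * d) * K%:R))
     - K%:R * ((C1 + C2 + 1) * (expR (- (y ^+ 2 / 2)) + (x * M) ^+ (d * d) * tau)) <= pr good.
  rewrite /good (pr_setC indX (csigU (csigC sanyE) sanybad)) -addrA lerD2l.
  rewrite -opprD lerN2; apply: le_trans (pr_setU indX (csigC sanyE) sanybad) _.
  apply: lerD; first by apply: pr_no_user => // k; have [_ _] := EP k.
  apply: le_trans (pr_bigsetU indX _ _ sbad) _.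
  apply: le_trans (_ : \sum_(k <- iota 0 K) ((C1 + C2 + 1) *
      (expR (- (y ^+ 2 / 2)) + (x * M) ^+ (d * d) * tau)) <= _); last first.
    by rewrite big_const_seq count_predT size_iota iter_addr_0 mulr_natl.
  apply: ler_sum => k _; apply: le_trans (pr_bad iidX k i (ltW y0) eta0 tau01) _.
  have -> : (3%:R * eta) ^+ (d * d * 2) =
      (3%:R * d.+1%:R) ^+ (d * d * 2) * (x * M) ^+ (d * d).
    rewrite /eta mulrA exprMn; congr (_ * _).
    by rewrite [(d * d * 2)%N]mulnC exprM sqr_sqrtr // mulr_ge0 // ltW.
  set u := expR _; set v := (x * M) ^+ _.
  have u0 : 0 <= u by exact: expR_ge0.
  have v0 : 0 <= v * tau by rewrite mulr_ge0 ?exprn_ge0 ?mulr_ge0 // ltW.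
  have -> : (3 * NR d * d * 2)%:R * (2 * u) = C1 * u by rewrite /C1 mulrA.
  have -> : (NR d ^ d)%:R * ((3%:R * d.+1%:R) ^+ (d * d * 2) * v * ((3 * (d + d))%:R * tau)) =
     C2 * (v * tau) by rewrite /C2; ring.
  rewrite mulrDr; apply: lerD; apply: ler_wpM2r => //.
    by rewrite -addrA lerDl addr_ge0.
  by rewrite addrAC lerDr addr_ge0.
apply: le_trans (_ : ((rate_bound d P M tau x)%:E * Pr (pull X id good) <= _)%E).
  by rewrite (PrE indX sgood) -EFinM lee_fin ler_wpM2l.
apply: integral_ge_on => //.
- exact: (measurable_pull indX _ sgood).
- by move=> t; exact: sel_rate_ge0.
- move=> t gt; pose w a := X a t.
  have [[k [kK Ek]] nbad] : (exists k, (k < K)%N /\ E k w) /\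
      forall k, (k < K)%N -> ~ bad k w.
    have [g1 g2] : anyE w /\ ~ anybad w.
      by split; [apply: contrapT => h; apply: gt; left|move=> h; apply: gt; right].
    split.
      move: g1; rewrite /anyE -bigcup_seq => -[k /=]; rewrite mem_iota => /andP[_ kK] Ek.
      by exists k.
    move=> k kK bk; apply: g2; rewrite /anybad -bigcup_seq; exists k => //=.
    by rewrite mem_iota.
  apply: sel_rate_ge.
    by exists k => //; have [_ h _] := EP k; exact: (h w Ek).
  move=> k' k'K Dk'.
  exact: (rate_user_ge d0 P0 tau0 x0 (ltW y0) (lexx eta) Dk' (nbad _ k'K)).
Qed.

End Users.

(** * Asymptotics *)

(** [expR u] is the square of [expR (u / 2)], hence at least [u ^+ 2 / 4] for [u >= 0]. For [L >= 1]
    the left side is at most [2 |A| L], whence the threshold [8 |A| / delta ^+ 2]. *)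
Lemma growth (R : realType) (A delta : R) : 0 < delta ->
  \forall L \near +oo, A * (1 + L) <= expR (delta * L).
Proof.
move=> dl0; near=> L.
have L1 : 1 <= L by near: L; apply: nbhs_pinfty_ge; exact: num_real.
have LA : 8 * `|A| / delta ^+ 2 <= L by near: L; apply: nbhs_pinfty_ge; exact: num_real.
have h1 : A * (1 + L) <= `|A| * (2 * L).
  apply: le_trans (_ : `|A| * (1 + L) <= _); first by rewrite ler_wpM2r ?ler_norm //; lra.
  by rewrite ler_wpM2l //; lra.
apply: le_trans h1 _.
have h2 : 8 * `|A| * L <= (delta * L) ^+ 2.
  move: LA; rewrite ler_pdivrMr ?exprn_gt0 // => LA.
  have L0 : 0 <= L by lra.
  by rewrite exprMn [L ^+ 2]expr2 mulrA ler_wpM2r // [_ ^+ 2 * _]mulrC.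
have h3 : 1 + delta * L / 2 <= expR (delta * L / 2) by exact: expR_ge1Dx.
have dL : 0 <= delta * L by rewrite mulr_ge0 ?(ltW dl0) //; lra.
have -> : expR (delta * L) = expR (delta * L / 2) ^+ 2.
  by rewrite expr2 -expRD; congr expR; field.
have h4 : (delta * L / 2) ^+ 2 <= expR (delta * L / 2) ^+ 2.
  by apply: lerXn2r; rewrite ?nnegrE ?expR_ge0 //; lra.
apply: le_trans h4.
have -> : (delta * L / 2) ^+ 2 = (delta * L) ^+ 2 / 4 by field.
lra.
Unshelve. all: by end_near. Qed.

Section Asymptotics.
Variables (R : realType) (d : nat) (d' e kappa B c c0 C : R).
Hypotheses (d0 : (0 < d)%N) (e0 : 0 < e) (ed' : e < d') (d'd : d' <= d%:R).
Hypotheses (kappa0 : 0 < kappa) (c_gt0 : 0 < c) (c00 : 0 < c0) (C0 : 0 < C).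

Local Notation dr := (d%:R : R).
Local Notation D := (d * d)%N.
(** With P = exp L, [M] is of order P^eps and [tau] is P^(-2 eps d^2). The two factors of the
    denominator lose the exponents [d eps] and [2 d eps], and the squared threshold
    [tau ^+ (2 ^ (d + d))] loses [4 d^2 2^(2d) eps]. This choice makes the total loss [e / 8]. *)
Definition eps : R := e / (8 * (3 * dr + 4 * dr ^+ 2 * (2 ^ (d + d))%:R)).

Let dr0 : 0 < dr. Proof. by rewrite ltr0n. Qed.
Let dr1 : 1 <= dr. Proof. by rewrite ler1n. Qed.
Let d'0 : 0 < d'. Proof. exact: lt_trans ed'. Qed.
Let N2 : R := (2 ^ (d + d))%:R.
Let eps0 : 0 < eps.
Proof. by rewrite divr_gt0 // mulr_gt0 // addr_gt0 ?mulr_gt0 ?exprn_gt0. Qed.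

Let epsE : 3 * dr * eps + 4 * dr ^+ 2 * N2 * eps = e / 8.
Proof.
rewrite /eps -/N2; field.
by rewrite gt_eqF // addr_gt0 ?mulr_gt0 ?exprn_gt0.
Qed.

Let eps_d' : dr * eps <= d'.
Proof.
have v0 : 0 <= 4 * dr ^+ 2 * N2 * eps by rewrite !mulr_ge0 ?exprn_ge0 // ltW.
have u0 : 0 < dr * eps by rewrite mulr_gt0.
have := epsE; rewrite -mulrA; move: (dr * eps) (4 * dr ^+ 2 * N2 * eps) u0 v0 => u v u0 v0.
have := e0; have := ed'; lra.
Qed.

(** [A1 * (1 + L)] will bound the logarithm of [K], and [A2 * (1 + L)] the product [K x^(d^2)]. *)
Let A1 := `|ln (2 * kappa)| + dr * d'.
Let A2 := (A1 + `|B|) / c.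

Let A1_ge0 : 0 <= A1.
Proof. by rewrite /A1 addr_ge0 ?normr_ge0 ?mulr_ge0 ?(ltW dr0) ?(ltW d'0). Qed.
Section FixedL.
Variables (L : R) (K : nat) (x : R).
Hypotheses (L1 : 1 <= L).
Hypothesis Klo : kappa / 2 * expR (dr * d' * L) <= K%:R.
Hypothesis Khi : K%:R <= 2 * kappa * expR (dr * d' * L).
Hypotheses (x0 : 0 <= x).
Hypothesis xE : c * x ^+ D = K%:R^-1 * (ln K%:R / D%:R + B).

Let K0 : 0 < K%:R :> R.
Proof. by apply: lt_le_trans Klo; rewrite mulr_gt0 ?expR_gt0 // divr_gt0. Qed.

Let KxE : K%:R * x ^+ D = (ln K%:R / D%:R + B) / c.
Proof.
apply: (mulfI (x := c)); first by rewrite gt_eqF.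
by rewrite mulrCA xE mulrA mulfV ?gt_eqF // mul1r [RHS]mulrC divfK // gt_eqF.
Qed.

Let D1 : 1 <= D%:R :> R. Proof. by rewrite ler1n muln_gt0 d0. Qed.

Lemma Kx_le : K%:R * x ^+ D <= A2 * (1 + L).
Proof.
rewrite KxE /A2 -mulrA [c^-1 * _]mulrC mulrA ler_pM2r ?invr_gt0 //.
have lnK : ln K%:R <= A1 * (1 + L).
  apply: le_trans (_ : ln (2 * kappa * expR (dr * d' * L)) <= _).
    by rewrite ler_ln ?posrE // ?mulr_gt0 ?expR_gt0.
  rewrite lnM ?posrE ?expR_gt0 ?mulr_gt0 // expRK /A1 [(_ + _) * (1 + L)]mulrDl.
  apply: lerD; first by rewrite (le_trans (ler_norm _)) // ler_peMr //; (have := L1; lra).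
  by rewrite ler_wpM2l ?mulr_ge0 ?(ltW dr0) ?(ltW d'0) //; (have := L1; lra).
have h : ln K%:R / D%:R <= A1 * (1 + L).
  have A0 : 0 <= A1 * (1 + L) by rewrite mulr_ge0 //; (have := L1; lra).
  by rewrite ler_pdivrMr ?(lt_le_trans ltr01) // (le_trans lnK) // ler_peMr.
rewrite [(_ + _) * (1 + L)]mulrDl; apply: lerD h _; apply: le_trans (ler_norm _) _.
by rewrite ler_peMr //; (have := L1; lra).
Qed.

Lemma Kx_ge : ((ln (kappa / 2) + dr * d' * L) / D%:R + B) / c <= K%:R * x ^+ D.
Proof.
rewrite KxE ler_pM2r ?invr_gt0 // lerD2r ler_pM2r ?invr_gt0 ?(lt_le_trans ltr01) //.
rewrite -[dr * d' * L]expRK -lnM ?posrE ?expR_gt0 ?divr_gt0 // ler_ln ?posrE //.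
by rewrite mulr_gt0 ?expR_gt0 // divr_gt0.
Qed.

Hypothesis grow1 : 2 * A2 / kappa * (1 + L) <= expR (eps * D%:R * L).

(** x^(d^2) is at most of order L exp(- d d' L); the d^2-th root gives the exponent - d'/d, and
    [eps] absorbs the factor L. *)
Lemma x_le : x <= expR ((eps - d' / dr) * L).
Proof.
rewrite -(@ler_pXn2r _ D) ?nnegrE ?expR_ge0 ?muln_gt0 ?d0 // -expRM_natl.
have -> : D%:R * ((eps - d' / dr) * L) = eps * D%:R * L - dr * d' * L.
  by rewrite natrM; field; rewrite gt_eqF.
rewrite expRD expRN ler_pdivlMr ?expR_gt0 //.
apply: le_trans grow1.
have -> : 2 * A2 / kappa * (1 + L) = A2 * (1 + L) / (kappa / 2) by field; rewrite gt_eqF.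
rewrite ler_pdivlMr ?divr_gt0 //; apply: le_trans Kx_le.
by rewrite [K%:R * _]mulrC -mulrA ler_wpM2l ?exprn_ge0 // mulrC.
Qed.

Lemma x_le1 : x <= 1.
Proof.
apply: le_trans x_le _; rewrite -[leRHS]expR0 ler_expR mulr_le0_ge0 //; last by (have := L1; lra).
by rewrite subr_le0 ler_pdivlMr // mulrC.
Qed.

(** [M] inflates (x M)^(d^2) by exp(eps d^2 L) up to a constant. The exponent of [tau] is twice as
    large, which leaves exp(- eps d^2 L) against the linear growth in [Kx_le]. *)
Let y := expR (eps / 2 * L).
Let tau := expR (- (2 * eps * D%:R * L)).
Let M := (NR d * d * 2)%:R * y ^+ 2.

Let ME : M = 4 * dr ^+ 2 * expR (eps * L).
Proof.
rewrite /M /y -expRM_natl /NR !natrM; congr (_ * expR _); first by ring.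
by field.
Qed.

Let A3 := 2 * dr * ln dr + dr * ln (13 * dr) + dr * ln (5 * dr).
Hypothesis L3 : 8 * A3 / e <= L.

(** The exponents add up to 2d - d - (d - d') = d' minus the loss [e / 8] of [epsE]. The constants
    collected in [A3] cost another [e / 8 * L] once [L] is large. The factors [13 * dr] and [5 * dr]
    come from 12 d and 4 d by absorbing the summand 1. *)
Lemma rate_bound_ge : (d' - e / 4) * log2 (expR L) <= rate_bound d (expR L) M tau x.
Proof.
have ln20 : 0 < ln 2 :> R by rewrite ln_gt0 // ltr1n.
rewrite /rate_bound /log2 mulrA -mulrBl ler_pM2r ?invr_gt0 // expRK.
have g0 : 0 < expR L / dr by rewrite divr_gt0 ?expR_gt0.
have tau0 : 0 < tau := expR_gt0 _.
have M0 : 0 < M by rewrite ME mulr_gt0 ?expR_gt0 // mulr_gt0 ?exprn_gt0.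
have e1 : ln ((expR L / dr) ^+ (d + d) * (tau ^+ (2 ^ (d + d))) ^+ 2) =
    2 * dr * L - 2 * dr * ln dr - 4 * dr ^+ 2 * N2 * eps * L.
  rewrite lnM ?posrE ?exprn_gt0 // !lnXn ?exprn_gt0 // ln_div ?posrE ?expR_gt0 //.
  rewrite /tau !expRK -(mulr_natl _ (d + d)) -(mulr_natl _ (2 ^ (d + d))) -/N2.
  rewrite natrD natrM; move: N2 eps (ln dr) => n2 ep ld; ring.
have u0 : 0 < 1 + expR L / dr * (3%:R * M).
  by rewrite ltr_wpDr // (mulr_ge0 (ltW g0)) // mulr_ge0 // ltW.
have v0 : 0 < 1 + expR L / dr * (x * M).
  by rewrite ltr_wpDr // (mulr_ge0 (ltW g0)) // mulr_ge0 // ltW.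
have e2 : ln (((1 + expR L / dr * (3%:R * M)) * (1 + expR L / dr * (x * M))) ^+ d) =
    dr * (ln (1 + expR L / dr * (3%:R * M)) + ln (1 + expR L / dr * (x * M))).
  by rewrite lnXn ?mulr_gt0 // lnM ?posrE // [RHS]mulr_natl.
have e3 : ln (1 + expR L / dr * (3%:R * M)) <= ln (13 * dr) + (1 + eps) * L.
  rewrite -[(1 + eps) * L]expRK -lnM ?posrE ?expR_gt0 ?mulr_gt0 // ler_ln ?posrE //;
    last by rewrite (mulr_gt0 (mulr_gt0 _ dr0)) ?expR_gt0.
  have -> : expR L / dr * (3%:R * M) = 12 * dr * expR ((1 + eps) * L).
    have -> : (1 + eps) * L = L + eps * L by ring.
    rewrite ME expRD; move: (expR L) (expR (eps * L)) => a b; field.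
    by rewrite gt_eqF.
  have : 1 <= dr * expR ((1 + eps) * L).
    rewrite -[leLHS]mulr1; apply: ler_pM => //.
    by rewrite -[leLHS]expR0 ler_expR mulr_ge0 //; [have := eps0; lra|(have := L1; lra)].
  by rewrite -!mulrA; (have := L1; lra).
have e4 : ln (1 + expR L / dr * (x * M)) <= ln (5 * dr) + (1 - d' / dr + 2 * eps) * L.
  rewrite -[(1 - d' / dr + 2 * eps) * L]expRK -lnM ?posrE ?expR_gt0 ?mulr_gt0 // ler_ln ?posrE //;
    last by rewrite (mulr_gt0 (mulr_gt0 _ dr0)) ?expR_gt0.
  (* This is where [d' <= d] enters: the exponent is nonnegative, so the summand 1 can be
     absorbed. *)
  have ex : 0 <= 1 - d' / dr + 2 * eps.
    have : d' / dr <= 1 by rewrite ler_pdivrMr // mul1r.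
    have := eps0; (have := L1; lra).
  have h1 : expR L / dr * (x * M) <= 4 * (dr * expR ((1 - d' / dr + 2 * eps) * L)).
    apply: le_trans (_ : expR L / dr * (expR ((eps - d' / dr) * L) * M) <= _).
      by rewrite ler_pM2l // ler_pM2r // x_le.
    have -> : (1 - d' / dr + 2 * eps) * L = L + ((eps - d' / dr) * L + eps * L) by ring.
    rewrite ME !expRD le_eqVlt; apply/orP; left; apply/eqP; field.
    by rewrite gt_eqF.
  have h2 : 1 <= dr * expR ((1 - d' / dr + 2 * eps) * L).
    rewrite -[leLHS]mulr1; apply: ler_pM => //.
    by rewrite -[leLHS]expR0 ler_expR mulr_ge0 //; (have := L1; lra).
  by rewrite -mulrA; (have := L1; lra).
rewrite e1 e2.
have h5 : dr * (ln (1 + expR L / dr * (3%:R * M)) + ln (1 + expR L / dr * (x * M))) <=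
    dr * ((ln (13 * dr) + (1 + eps) * L) + (ln (5 * dr) + (1 - d' / dr + 2 * eps) * L)).
  by rewrite ler_wpM2l ?(ltW dr0) // lerD.
have h6 : dr * ((ln (13 * dr) + (1 + eps) * L) + (ln (5 * dr) + (1 - d' / dr + 2 * eps) * L)) =
    A3 - 2 * dr * ln dr + (2 * dr - d' + 3 * dr * eps) * L.
  by rewrite /A3; field; rewrite gt_eqF.
have h7 : A3 <= e / 8 * L.
  move: L3; rewrite ler_pdivrMr // => h; (have := L1; lra).
have h8 : 3 * dr * eps * L + 4 * dr ^+ 2 * N2 * eps * L = e / 8 * L by rewrite -mulrDl epsE.
move: h5; rewrite h6 => h5.
have -> : (d' - e / 4) * L = d' * L - e / 4 * L by ring.
have h9 : (2 * dr - d' + 3 * dr * eps) * L = 2 * dr * L - d' * L + 3 * dr * eps * L by ring.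
rewrite h9 in h5.
have h10 : e / 4 * L = e / 8 * L + e / 8 * L by field.
(have := L1; lra).
Qed.

Let A4 := C * 2 * kappa.
Let A6 := C * A2 * (4 * dr ^+ 2) ^+ D.
Hypothesis grow2 : 2 * (dr * d' + 1) * (1 + L) <= expR (eps * L).
Hypothesis grow3 : A4 * (8 * d' / e) * (1 + L) <= expR (1 * L).
Hypothesis grow4 : A6 * (8 * d' / e) * (1 + L) <= expR (eps * D%:R * L).
Hypothesis L4 : ln (4 * d' / e) <=
  c0 * (((ln (kappa / 2) + dr * d' * L) / D%:R + B) / c).

(** The budget [e / (2 d')] is split into [e / (4 d')] for the absence of reports and [e / (8 d')]
    each for large entries and for small determinants. As [y ^+ 2 = expR (eps * L)], the Gaussian
    tail decays faster than any power of P and beats [K]. *)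
Lemma failure_le :
  1 - e / (2 * d') <= 1 - expR (- (c0 * x ^+ D * K%:R))
     - K%:R * (C * (expR (- (y ^+ 2 / 2)) + (x * M) ^+ D * tau)).
Proof.
have b0 : 0 < 8 * d' / e by rewrite divr_gt0 // mulr_gt0.
have h1 : expR (- (c0 * x ^+ D * K%:R)) <= e / (4 * d').
  have -> : e / (4 * d') = expR (- ln (4 * d' / e)).
    by rewrite expRN lnK ?posrE ?divr_gt0 ?mulr_gt0 // invf_div.
  rewrite ler_expR lerN2; apply: le_trans L4 _.
  by rewrite -[leRHS]mulrA ler_wpM2l ?(ltW c00) // [x ^+ D * _]mulrC; exact: Kx_ge.
have h2 : K%:R * (C * expR (- (y ^+ 2 / 2))) <= e / (8 * d').
  have yE : y ^+ 2 = expR (eps * L) by rewrite /y -expRM_natl; congr expR; field.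
  apply: le_trans (_ : 2 * kappa * expR (dr * d' * L) * (C * expR (- ((dr * d' + 1) * L))) <= _).
    apply: ler_pM => //; first by rewrite mulr_ge0 ?expR_ge0 // ltW.
    rewrite ler_wpM2l ?(ltW C0) // ler_expR lerN2 ler_pdivlMr // yE.
    apply: le_trans grow2; rewrite mulrC mulrA ler_wpM2l //; last by (have := L1; lra).
    by rewrite mulr_ge0 // addr_ge0 // mulr_ge0 // ltW.
  have -> : 2 * kappa * expR (dr * d' * L) * (C * expR (- ((dr * d' + 1) * L))) = A4 / expR L.
    have -> : - ((dr * d' + 1) * L) = - (dr * d' * L) - L by ring.
    rewrite expRD !expRN /A4; field.
    by rewrite !gt_eqF ?expR_gt0.
  have -> : e / (8 * d') = (8 * d' / e)^-1 by rewrite invf_div.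
  rewrite ler_pdivrMr ?expR_gt0 // -ler_pdivrMl ?invr_gt0 // invrK.
  move: grow3; rewrite mul1r; apply: le_trans; rewrite [_ * A4]mulrC.
  rewrite ler_peMr //; last by (have := L1; lra).
  by rewrite !mulr_ge0 ?invr_ge0 // ltW.
have h3 : K%:R * (C * ((x * M) ^+ D * tau)) <= e / (8 * d').
  apply: le_trans (_ : A6 * (1 + L) / expR (eps * D%:R * L) <= _).
    have -> : K%:R * (C * ((x * M) ^+ D * tau)) =
        C * (K%:R * x ^+ D) * (4 * dr ^+ 2) ^+ D / expR (eps * D%:R * L).
      rewrite ME !exprMn -expRM_natl /tau.
      have -> : - (2 * eps * D%:R * L) = - (eps * D%:R * L) - (eps * D%:R * L) by ring.
      have -> : D%:R * (eps * L) = eps * D%:R * L by ring.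
      by rewrite expRD !expRN; field; rewrite gt_eqF ?expR_gt0.
    rewrite ler_pM2r ?invr_gt0 ?expR_gt0 //.
    have -> : A6 * (1 + L) = C * (A2 * (1 + L)) * (4 * dr ^+ 2) ^+ D by rewrite /A6; ring.
    by rewrite ler_wpM2r ?exprn_ge0 ?mulr_ge0 ?exprn_ge0 ?(ltW dr0) // ler_wpM2l ?(ltW C0) // Kx_le.
  have -> : e / (8 * d') = (8 * d' / e)^-1 by rewrite invf_div.
  rewrite ler_pdivrMr ?expR_gt0 // -ler_pdivrMl ?invr_gt0 // invrK.
  apply: le_trans grow4; rewrite le_eqVlt; apply/orP; left; apply/eqP.
  by move: A6 (8 * d' / e) => a b; ring.
have -> : e / (2 * d') = e / (4 * d') + (e / (8 * d') + e / (8 * d')) by field; rewrite gt_eqF.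
rewrite mulrDr mulrDr; (have := L1; lra).
Qed.

End FixedL.
Lemma asymptotics : \forall L \near +oo, forall (K : nat) (x : R),
  kappa / 2 * expR (dr * d' * L) <= K%:R ->
  K%:R <= 2 * kappa * expR (dr * d' * L) ->
  0 <= x -> c * x ^+ D = K%:R^-1 * (ln K%:R / D%:R + B) ->
  let y := expR (eps / 2 * L) in
  let tau := expR (- (2 * eps * D%:R * L)) in
  let M := (NR d * d * 2)%:R * y ^+ 2 in
  [/\ 0 < x <= 1, 0 < tau <= 1,
      (d' - e / 4) * log2 (expR L) <= rate_bound d (expR L) M tau x &
      1 - e / (2 * d') <= 1 - expR (- (c0 * x ^+ D * K%:R))
        - K%:R * (C * (expR (- (y ^+ 2 / 2)) + (x * M) ^+ D * tau))].
Proof.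
have D0 : 0 < D%:R :> R by rewrite ltr0n muln_gt0 d0.
near=> L => K x Klo Khi x0 xE y tau M.
have L1 : 1 <= L by near: L; apply: nbhs_pinfty_ge; exact: num_real.
have grow1 : 2 * A2 / kappa * (1 + L) <= expR (eps * D%:R * L).
  by near: L; apply: growth; rewrite mulr_gt0.
have L3 : 8 * (2 * dr * ln dr + dr * ln (13 * dr) + dr * ln (5 * dr)) / e <= L.
  by near: L; apply: nbhs_pinfty_ge; exact: num_real.
have grow2 : 2 * (dr * d' + 1) * (1 + L) <= expR (eps * L) by near: L; exact: growth.
have grow3 : C * 2 * kappa * (8 * d' / e) * (1 + L) <= expR (1 * L).
  by near: L; exact: growth.
have grow4 : C * A2 * (4 * dr ^+ 2) ^+ D * (8 * d' / e) * (1 + L) <= expR (eps * D%:R * L).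
  by near: L; apply: growth; rewrite mulr_gt0.
have L4 : ln (4 * d' / e) <= c0 * (((ln (kappa / 2) + dr * d' * L) / D%:R + B) / c).
  have h : ((ln (4 * d' / e) / c0 * c - B) * D%:R - ln (kappa / 2)) / (dr * d') <= L.
    by near: L; apply: nbhs_pinfty_ge; exact: num_real.
  move: h; rewrite ler_pdivrMr ?mulr_gt0 // lerBlDl [L * _]mulrC.
  rewrite -ler_pdivlMr // lerBlDr -ler_pdivlMr // ler_pdivrMr // mulrC.
  by rewrite [_ * c0]mulrC.
have Sgt : 0 < ln (4 * d' / e).
  rewrite ln_gt0 // ltr_pdivlMr // mul1r.
  by have := ed'; have := e0; lra.
(* [x = 0] would make the lower bound of [Kx_ge] at most 0, contradicting [L4], whose left side is
   positive because [e < d']. *)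
have xgt : 0 < x.
  rewrite lt_neqAle x0 andbT eq_sym; apply/eqP => x00.
  have := Kx_ge Klo xE; rewrite x00 expr0n muln_eq0 eqn0Ngt d0 /= mulr0.
  rewrite leNgt => /negP; apply; rewrite -(pmulr_rgt0 _ c00).
  exact: lt_le_trans L4.
split.
- by rewrite xgt /=; exact: (x_le1 L1 Klo Khi x0 xE grow1).
- rewrite expR_gt0 -[leRHS]expR0 ler_expR oppr_le0.
  apply: mulr_ge0 (le_trans ler01 L1); apply: mulr_ge0 (ltW D0).
  exact: mulr_ge0 (ltW eps0).
- exact: (rate_bound_ge L1 Klo Khi x0 xE grow1 L3).
- exact: (failure_le L1 Klo Khi xE grow2 grow3 grow4 L4).
Unshelve. all: by end_near. Qed.

End Asymptotics.

Lemma cNd_gt0 (R : realType) N d : 0 < cNd R N d.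
Proof.
rewrite /cNd mulr_gt0 ?invr_gt0 ?ltr0n ?fact_gt0 //.
by apply: prodr_gt0 => j _; rewrite divr_gt0 // ltr0n fact_gt0.
Qed.

(** The inequality for the limit inferior is in epsilon form: log2 P is positive for large P, so it
    amounts to a lower bound with slope d' - e for every positive e. *)
Theorem theorem2 (R : realType) (dT : measure_display) (T : measurableType dT)
  (Pr : probability T R) (d : nat) (X : chan_idx d -> T -> R)
  (K : R -> nat) (kappa d' B : R) (xhat : R -> R) (i : 'I_3) :
  (0 < d)%N ->
  0 <= d' <= d%:R ->
  iid_CN Pr X ->
  (forall P, (0 < K P)%N) ->
  0 < kappa ->
  (K P)%:R / powR P (d%:R * d') @[P --> +oo] --> kappa ->
  (\forall P \near +oo,
     0 <= xhat P /\
     cNd R (NR d) d * xhat P ^+ (d * d) =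
       ((K P)%:R)^-1 * (ln (K P)%:R / (d * d)%:R + B)) ->
  forall e : R, 0 < e ->
    \forall P \near +oo,
      (((d' - e) * log2 P)%:E <=
       \int[Pr]_t (sel_rate X P (K P) (xhat P) i t)%:E)%E.
Proof.
move=> d0 /andP[d'0 d'd] iidX K0 kappa0 Kcvg xP e e0.
have ln20 : 0 < ln 2 :> R by rewrite ln_gt0 // ltr1n.
(* For [d' <= e] the bound is nonpositive and nonnegativity of the rate suffices. This covers
   [d' = 0], where [K] stays bounded and a report need not become likely. *)
have [d'e|ed'] := leP d' e.
  near=> P.
  have P1 : 1 <= P by near: P; apply: nbhs_pinfty_ge; exact: num_real.
  apply: le_trans (_ : 0 <= _)%E; last first.
    by apply: integral_ge0 => t _; rewrite lee_fin sel_rate_ge0 // (lt_le_trans ltr01).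
  by rewrite lee_fin mulr_le0_ge0 ?subr_le0 // /log2 divr_ge0 ?ln_ge0 ?ler1n.
have d'gt0 : 0 < d' := lt_trans e0 ed'.
have [c0 c00 [C C0 mean]] := sel_rate_mean_ge d0 iidX i.
have [L0 [_ asy]] := asymptotics B d0 e0 ed' d'd kappa0 (cNd_gt0 R (NR d) d) c00 C0.
near=> P.
have P1 : 1 < P by near: P; apply: nbhs_pinfty_gt; exact: num_real.
have P0 : 0 < P := lt_trans ltr01 P1.
have PL : L0 < ln P.
  have h : expR L0 < P by near: P; apply: nbhs_pinfty_gt; exact: num_real.
  by rewrite -[L0]expRK ltr_ln ?posrE ?expR_gt0.
have powE : powR P (d%:R * d') = expR (d%:R * d' * ln P) by rewrite /powR gt_eqF.
have pow0 : 0 < powR P (d%:R * d') by rewrite powR_gt0.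
have Klo : kappa / 2 * expR (d%:R * d' * ln P) <= (K P)%:R.
  rewrite -powE -ler_pdivlMr //; apply: ltW; near: P.
  by apply: (cvgr_gt kappa Kcvg); rewrite ltr_pdivrMr // ltr_pMr // ltr1n.
have Khi : (K P)%:R <= 2 * kappa * expR (d%:R * d' * ln P).
  rewrite -powE -ler_pdivrMr //; apply: ltW; near: P.
  by apply: (cvgr_lt kappa Kcvg); rewrite ltr_pMl // ltr1n.
have [x0 xE] : 0 <= xhat P /\ cNd R (NR d) d * xhat P ^+ (d * d) =
       ((K P)%:R)^-1 * (ln (K P)%:R / (d * d)%:R + B) by near: P.
have [x01 tau01 rb fl] := asy _ PL (K P) (xhat P) Klo Khi x0 xE.
rewrite lnK ?posrE // in rb.
have lP0 : 0 < log2 P by rewrite divr_gt0 // ln_gt0.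
have s0 : 0 <= 1 - e / (2 * d').
  by rewrite subr_ge0 ler_pdivrMr ?mulr_gt0 // mul1r; lra.
have rb0 : 0 <= (d' - e / 4) * log2 P by rewrite mulr_ge0 ?(ltW lP0) //; lra.
have rbnd := le_trans rb0 rb.
apply: le_trans (mean _ _ _ _ _ P0 x01 (expR_gt0 _) tau01 rbnd); rewrite lee_fin.
apply: le_trans (_ : (d' - e / 4) * log2 P * (1 - e / (2 * d')) <= _); last first.
  by apply: ler_pM.
(* The loss [e / 4] in the rate and the relative loss [e / (2 d')] in probability together stay
   below [e]. *)
have -> : (d' - e / 4) * log2 P * (1 - e / (2 * d')) =
    ((d' - e) + (e / 4 + e * e / (8 * d'))) * log2 P by field; rewrite gt_eqF.
rewrite ler_pM2r // lerDl addr_ge0 ?divr_ge0 ?mulr_ge0 // ltW.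
Unshelve. all: by end_near. Qed.
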